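(* Let $\sigma,\rho_\ell,R_0>0$ be fixed, and let resonances of the time-harmonic pressure--interface problem, and the associated mode $l$, be defined as in the context, with $c_\alpha=\sqrt{K_\alpha/\rho_\alpha}$ for $\alpha\in\{\ell,g\}$. The constants implicit in the $O(\cdot)$-terms below are independent of the limiting parameters in the corresponding regime. (a) Assume $0<\rho_g\le\beta<\infty$, where $\beta$ is independent of $c_g$ and $c_\ell$. For each mode $l\ge2$ there exist (Lamb-type) resonances satisfying $$\omega_L^{(l),\pm}=\pm\sqrt{\frac{(l+2)(l-1)\sigma}{\bigl(\frac{\rho_\ell}{l+1}+\frac{\rho_g}{l}\bigr)R_0^3}}+O\bigl(\max(c_g^{-1},c_\ell^{-1})\bigr)\qquad\text{as }c_g,c_\ell\to\infty.$$ (b) Assume $K_g\in(K_-,K_+)$, where $K_\pm$ are independent of $c_g$ and $c_\ell$. There exist (Minnaert) resonances, in the mode $l=0$, satisfying $$\omega_M^\pm=\pm\sqrt{\frac{3K_g}{\rho_\ell R_0^2}-\frac{2\sigma}{\rho_\ell R_0^3}}+O\bigl(\max(c_g^{-1},c_\ell^{-1})\bigr)\qquad\text{as }c_g,c_\ell\to\infty.$$ (c) Assume $c_\ell\in(c_-,c_+)$ and $c_g\in(c_-,c_+)$, where $c_\pm$ are independent of $\rho_g$. For each mode $l\ge1$ there exist (Fabry--Pérot-type) resonances satisfying $$\omega_F^{(l,\pm)}=\pm\lambda^{(l)}+O(\rho_g)\qquad\text{as }\rho_g\to0,$$ where $(\lambda^{(l)})^2/c_g^2$ denotes the Neumann eigenvalue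 of $-\Delta$ in the ball $B_{R_0}$ associated with the $l$-th modes.
   Context: $\Omega_g^{(0)}=B_{R_0}$ is the open ball of radius $R_0$ centred at $0$, $\Omega_\ell^{(0)}=\mathbb R^3\setminus\overline{B_{R_0}}$, $S^{(0)}=\partial B_{R_0}$, $n$ the normal pointing into $\Omega_\ell^{(0)}$; $\rho_\alpha,K_\alpha>0$ are density and bulk modulus. The time convention is $e^{-i\omega t}$. A resonance is a nonzero $\omega\in\mathbb C$ for which the homogeneous problem $$\Delta u_\alpha+k_\alpha^2u_\alpha=0\ \text{in }\Omega_\alpha^{(0)},\ \alpha\in\{\ell,g\},\qquad k_\alpha=\omega/c_\alpha,$$ $$\frac1{\rho_\ell}\partial_nu_\ell=\frac1{\rho_g}\partial_nu_g=\omega^2\hat\eta,\qquad u_\ell-u_g=\sigma\Bigl(\Delta_{S^{(0)}}+\frac2{R_0^2}\Bigr)\hat\eta\quad\text{on }S^{(0)},\qquad u_\ell\ \text{is }k_\ell\text{-outgoing},$$ admits a nontrivial solution $(u_\ell,u_g,\hat\eta)$. It is a resonance in the mode $l$ if there is a nontrivial solution of the form $u_\ell=A\,h_l^{(1)}(k_\ell r)Y_l^m(\hat x)$, $u_g=C\,j_l(k_gr)Y_l^m(\hat x)$, $\hat\eta=\eta\,Y_l^m(\hat x)$, where $j_l$ and $h_l^{(1)}$ are the spherical Bessel and Hankel functions of the first kind (outgoing for complex $k_\ell$ is understood through the expansion in $h_l^{(1)}$). The $l$-th mode Neumann condition reads $j_l'(\lambda^{(l)}R_0/c_g)=0$ with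 $\lambda^{(l)}>0$.
   Formalization: In (b) the radicand is assumed nonzero: when it vanishes there is no nonzero resonance near 0, so the claim fails there; a negative radicand is allowed (complex root). In (c) the lower bound c_- is taken positive, since for l=1 the O(ρ_g) bound is not uniform as c_ℓ tends to 0. *)

(* Defs.v *)
(* The complex numbers are R[i] from mathcomp.real_closed. R[i] is not a normed
   module over R in MathComp-Analysis, so derivatives, limits and continuity of
   complex-valued functions are taken on real and imaginary parts. *)
From HB Require Import structures.
From mathcomp Require Import all_boot all_order all_algebra.
From mathcomp Require Import all_classical all_reals all_analysis.
From mathcomp Require Import complex.
Set Implicit Arguments.
Unset Strict Implicit.
Unset Printing Implicit Defensive.
Import Order.TTheory GRing.Theory Num.Theory numFieldNormedType.Exports.
Local Open Scope classical_set_scope.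
Local Open Scope ring_scope.
Local Open Scope complex_scope.

(* real-valued modulus of a complex number (`|z| itself has type R[i]) *)
Definition cmod (R : realType) (z : R[i]) : R := ComplexField.Normc.normc z.

Section SpecialFunctions.
Variable R : realType.
Implicit Types (l k : nat) (z : R[i]).

Definition cexp z : R[i] :=
  (expR (complex.Re z))%:C
  * (cos (complex.Im z) +i* sin (complex.Im z)).

(* j_l(z) = 2^l z^l \sum_k (-1)^k (k+l)! / (k! (2k+2l+1)!) z^(2k) *)
Definition sph_bessel_psum l z (n : nat) : R[i] :=
  \sum_(k < n) (-1) ^+ k *
    (2 ^+ l * (k + l)`!%:R / (k`!%:R * (2 * k + 2 * l + 1)`!%:R)) *
    z ^+ (2 * k + l).

Definition sph_bessel l z : R[i] :=
  lim ((fun n => complex.Re (sph_bessel_psum l z n)) @ \oo)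
  +i* lim ((fun n => complex.Im (sph_bessel_psum l z n)) @ \oo).

(* h_l^(1)(z) =
   e^(iz) \sum_(k <= l) i^(k-l-1) (l+k)! / (2^k k! (l-k)!) z^(-k-1),
   the finite closed form (z != 0) *)
Definition sph_hankel1 l z : R[i] :=
  cexp ('i * z) *
  \sum_(k < l.+1) ('i ^+ k / 'i ^+ l.+1) *
    ((l + k)`!%:R / (2 ^+ k * k`!%:R * (l - k)`!%:R)) / z ^+ k.+1.

(* Rodrigues' formula *)
Definition legendre l : {poly R} :=
  (2 ^+ l * l`!%:R)^-1 *: (('X ^+ 2 - 1) ^+ l)^`(l).

(* Y_l^m on the unit sphere, Condon-Shortley phase, 0 <= m <= l.  On
   x = (sin t cos p, sin t sin p, cos t) one has
   P_l^m(cos t) e^(imp) = (-1)^m P_l^(m)(x_2) (x_0 + i x_1)^m. *)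
Definition sph_harm_pos l (m : nat) (x : 'rV[R]_3) : R[i] :=
  ((-1) ^+ m *
   Num.sqrt ((2 * l + 1)%:R / (4 * pi) * ((l - m)`!%:R / (l + m)`!%:R)) *
   ((legendre l)^`(m)).[x 0 (inord 2)])%:C *
  (x 0 (inord 0) +i* x 0 (inord 1)) ^+ m.

Definition sph_harm l (m : int) (x : 'rV[R]_3) : R[i] :=
  match m with
  | Posz n => sph_harm_pos l n x
  | Negz n => (-1) ^+ n.+1 * conjc (sph_harm_pos l n.+1 x)
  end.

End SpecialFunctions.

Section Calculus.
Variable R : realType.

(* derivative in the direction v of a complex-valued function *)
Definition cderive (V : normedModType R) (v : V) (f : V -> R[i]) (x : V)
  : R[i] :=
  'D_v (fun y => complex.Re (f y)) x +i* 'D_v (fun y => complex.Im (f y)) x.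

(* derivative of j_l at a real point *)
Definition sph_bessel_deriv (l : nat) (x : R) : R[i] :=
  cderive (1 : R) (fun t : R => sph_bessel l t%:C) x.

Local Notation V := 'rV[R]_3.
Implicit Types (x : V) (u : V -> R[i]).

Definition basis_vec (i : 'I_3) : V := delta_mx 0 i.

(* Euclidean norm (the library norm of 'rV is the sup norm) *)
Definition enorm x : R := Num.sqrt (\sum_i x 0 i ^+ 2).

(* x / |x|, and 0 at the origin *)
Definition unit_vec x : V := (enorm x)^-1 *: x.

Definition laplacian u x : R[i] :=
  \sum_i cderive (basis_vec i) (cderive (basis_vec i) u) x.

(* f is C^2 on the set Om (used for open Om) *)
Definition C2_on (Om : set V) (f : V -> R) : Prop :=
  forall x, Om x -> forall i j,
    [/\ derivable f x (basis_vec i),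
        derivable ('D_(basis_vec i) f) x (basis_vec j)
      & {for x, continuous ('D_(basis_vec j) ('D_(basis_vec i) f))}].

Definition cC2_on (Om : set V) u : Prop :=
  C2_on Om (fun x => complex.Re (u x)) /\ C2_on Om (fun x => complex.Im (u x)).

Definition ccontinuous_on (D : set V) u : Prop :=
  {within D, continuous (fun x => complex.Re (u x))} /\
  {within D, continuous (fun x => complex.Im (u x))}.

(* u has derivative d along x/|x| at x, the increment t running along F:
   F = 0^'+ uses the values of u outside the ball of radius |x|, F = 0^'- the
   values inside. *)
Definition radial_derivative (F : set_system R) u x (d : R[i]) : Prop :=
  ((fun t => complex.Re (u (x + t *: unit_vec x) - u x) / t) @ F
     --> complex.Re d) /\
  ((fun t => complex.Im (u (x + t *: unit_vec x) - u x) / t) @ F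
     --> complex.Im d).

(* A function on the sphere of radius R0 is given by u : V -> R[i], of which
   only the values on that sphere matter; sphere_ext is its extension to
   V minus {0} that is constant along rays. The Laplace-Beltrami operator is
   the Laplacian of this extension, restricted to the sphere. *)
Definition sphere_ext (R0 : R) u : V -> R[i] :=
  fun x => u (R0 *: unit_vec x).

Definition laplace_beltrami (R0 : R) u x : R[i] :=
  laplacian (sphere_ext R0 u) x.

(* u = \sum_l \sum_(|m| <= l) a_lm h_l^(1)(k r) Y_l^m for r > R0, uniformly
   on each sphere; the inner index j stands for m = j - l *)
Definition outgoing (R0 : R) (k : R[i]) u : Prop :=
  exists a : nat -> int -> R[i],
    forall r eps : R, R0 < r -> 0 < eps ->
    exists N : nat, forall n : nat, (N <= n)%N ->
    forall x, enorm x = r ->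
      cmod (u x - \sum_(l < n) \sum_(j < (2 * l).+1)
              a l (j%:Z - l%:Z) * sph_hankel1 l (k * (enorm x)%:C)
              * sph_harm l (j%:Z - l%:Z) (unit_vec x)) <= eps.

End Calculus.

Section Bubble.
Variable R : realType.
Local Notation V := 'rV[R]_3.

Definition sound_speed (K rho : R) : R := Num.sqrt (K / rho).

Definition wavenumber (w : R[i]) (K rho : R) : R[i] :=
  w / (sound_speed K rho)%:C.

(* Classical solutions of the homogeneous pressure-interface problem; K_l, K_g
   are the bulk moduli and rho_l, rho_g the densities. *)
Definition homogeneous_solution (R0 sigma rho_l rho_g K_l K_g : R) (w : R[i])
    (u_l u_g eta : V -> R[i]) : Prop :=
  let k_l := wavenumber w K_l rho_l in
  let k_g := wavenumber w K_g rho_g in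
  [/\ [/\ cC2_on [set x | R0 < enorm x] u_l,
          ccontinuous_on [set x | R0 <= enorm x] u_l,
          cC2_on [set x | enorm x < R0] u_g,
          ccontinuous_on [set x | enorm x <= R0] u_g
        & cC2_on [set x | x != 0] (sphere_ext R0 eta)],
      (forall x, R0 < enorm x -> laplacian u_l x + k_l ^+ 2 * u_l x = 0),
      (forall x, enorm x < R0 -> laplacian u_g x + k_g ^+ 2 * u_g x = 0),
      (forall x, enorm x = R0 ->
        (exists d_l d_g : R[i],
          [/\ radial_derivative 0^'+ u_l x d_l,
              radial_derivative 0^'- u_g x d_g,
              d_l / rho_l%:C = w ^+ 2 * eta x
            & d_g / rho_g%:C = w ^+ 2 * eta x]) /\
        u_l x - u_g x =
          sigma%:C * (laplace_beltrami R0 eta x + (2 / R0 ^+ 2)%:C * eta x))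
    & outgoing R0 k_l u_l].

Definition nontrivial (R0 : R) (u_l u_g eta : V -> R[i]) : Prop :=
  [\/ exists2 x, R0 < enorm x & u_l x != 0,
      exists2 x, enorm x < R0 & u_g x != 0
    | exists2 x, enorm x = R0 & eta x != 0].

Definition resonance (R0 sigma rho_l rho_g K_l K_g : R) (w : R[i]) : Prop :=
  w != 0 /\
  exists u_l u_g eta : V -> R[i],
    homogeneous_solution R0 sigma rho_l rho_g K_l K_g w u_l u_g eta /\
    nontrivial R0 u_l u_g eta.

Definition resonance_in_mode (R0 sigma rho_l rho_g K_l K_g : R) (l : nat)
    (w : R[i]) : Prop :=
  w != 0 /\
  exists (m : int) (A C e : R[i]), (`|m| <= l)%N /\
    let u_l x := A * sph_hankel1 l (wavenumber w K_l rho_l * (enorm x)%:C)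
                   * sph_harm l m (unit_vec x) in
    let u_g x := C * sph_bessel l (wavenumber w K_g rho_g * (enorm x)%:C)
                   * sph_harm l m (unit_vec x) in
    let eta x := e * sph_harm l m (unit_vec x) in
    homogeneous_solution R0 sigma rho_l rho_g K_l K_g w u_l u_g eta /\
    nontrivial R0 u_l u_g eta.

Lemma resonance_in_mode_resonance (R0 sigma rho_l rho_g K_l K_g : R) l w :
  resonance_in_mode R0 sigma rho_l rho_g K_l K_g l w ->
  resonance R0 sigma rho_l rho_g K_l K_g w.
Proof.
by case=> w0 [m [A [C [e [_ sol]]]]]; split=> //; do 3!eexists; exact: sol.
Qed.

(* lam > 0 and j_l'(lam R0 / c_g) = 0 *)
Definition neumann_mode (R0 c_g : R) (l : nat) (lam : R) : Prop :=
  0 < lam /\ sph_bessel_deriv l (lam * R0 / c_g) = 0.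

End Bubble.

(* Main.v *)
(* For a field proportional to [Y_l^l], the interface problem is a linear system for three
   amplitudes.  Write [k_l], [k_g] for the wave numbers, [x = k_l R0], [s = (k_g R0)^2],
   [p l x = e^(-ix) x^(l+1) h_l(x)] (a polynomial), [f l (z^2) = z^(-l) j_l(z)] (an entire
   function), and [q], [g] for the analogous expressions built from [x h_l'(x)] and
   [z j_l'(z)].  A nonzero solution exists exactly when
     [w^2 R0 (rho_l p g - rho_g f q) + sigma (l (l + 1) - 2) / R0^2 q g = 0].
   In the regimes (a) and (b) both [x] and [s] tend to 0; with [w = w0 v] the equation becomes
   [v^2 X(v) = Y(v)], where [X] and [Y] are close to 1 in a Lipschitz sense, hence has roots
   near [v = 1] and [v = -1].  In the regime (c) it reads [g(z^2) G(z) = rho_g N(z)] with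
   [z = k_g R0].  The nonzero real zeros of [g] are simple by Bessel's equation, and [G] does
   not vanish on the real axis because the imaginary part of [G conj(q)] is a multiple of the
   Wronskian of [h_l] and its conjugate.  In all cases the root is the limit of the simplified
   Newton iteration, with constants that are uniform in the parameters. *)
Require Import Defs.
From HB Require Import structures.
From mathcomp Require Import all_boot all_order all_algebra.
From mathcomp Require Import all_classical all_reals all_analysis.
From mathcomp Require Import complex.
From mathcomp Require Import ring lra zify.
Set Implicit Arguments.
Unset Strict Implicit.
Unset Printing Implicit Defensive.
Import Order.TTheory GRing.Theory Num.Theory numFieldNormedType.Exports.
Local Open Scope classical_set_scope.
Local Open Scope ring_scope.
Local Open Scope complex_scope.

(** * Complex modulus, limits and zeros *)

Section Modulus.
Variable R : realType.
Implicit Types (x y z : R[i]) (a : R).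

(** The choice of [Y_l^l] makes the boundary value problem elementary: up to a constant it is the
    restriction to the unit sphere of [(x_0 + i x_1)^l], a harmonic homogeneous polynomial. Every
    field, including the extension of the interface along rays, has the form
    [g (|x|^2) (x_0 + i x_1)^l], and one Laplacian formula serves them all. Taking [|x|^2] rather
    than [|x|] as radial variable keeps the interior field smooth at the origin and turns
    differentiation into the ladder [l -> l + 1], so that the Helmholtz equation becomes a
    three-term recurrence.

    The error constants must be fixed before the parameters. Functions of a complex variable are
    therefore controlled only by size and Lipschitz bounds on fixed discs and by second-order
    remainders. In (a) the density [rho_g] is not bounded away from 0, and uniformity comes from
    making [X] a convex combination weighted by the densities. In (b) the mode is [l = 0], where [g]
    vanishes at [s = 0] and a factor [s] has to be removed first. In (c) the sound speeds enter only
    through two numbers in a bounded box. *)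

Lemma cmodC z : (cmod z)%:C = `|z|.
Proof. by []. Qed.

Lemma cmod_ge0 z : 0 <= cmod z.
Proof. by rewrite -ler0c cmodC normr_ge0. Qed.

Lemma cmodM x y : cmod (x * y) = cmod x * cmod y.
Proof. exact: ComplexField.Normc.normcM. Qed.

Lemma cmodD x y : cmod (x + y) <= cmod x + cmod y.
Proof. by rewrite -lecR rmorphD /= !cmodC ler_normD. Qed.

Lemma cmodN x : cmod (- x) = cmod x.
Proof. by apply: complexI; rewrite !cmodC normrN. Qed.

Lemma cmodB x y : cmod (x - y) <= cmod x + cmod y.
Proof. by rewrite -(cmodN y) cmodD. Qed.

Lemma cmod0 : cmod (0 : R[i]) = 0.
Proof. by apply: complexI; rewrite cmodC normr0. Qed.

Lemma cmod1 : cmod (1 : R[i]) = 1.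
Proof. by apply: complexI; rewrite cmodC normr1. Qed.

Lemma cmodX x n : cmod (x ^+ n) = cmod x ^+ n.
Proof. by apply: complexI; rewrite rmorphXn /= !cmodC normrX. Qed.

Lemma cmodV x : cmod x^-1 = (cmod x)^-1.
Proof. exact: ComplexField.Normc.normcV. Qed.

Lemma cmod_eq0 x : (cmod x == 0) = (x == 0).
Proof. by rewrite -(inj_eq (@complexI R)) cmodC normr_eq0. Qed.

Lemma cmod_gt0 x : (0 < cmod x) = (x != 0).
Proof. by rewrite lt_neqAle cmod_ge0 andbT eq_sym cmod_eq0. Qed.

Lemma cmod_real a : cmod a%:C = `|a|.
Proof. by rewrite /cmod /= expr0n addr0 sqrtr_sqr. Qed.

Lemma cmod_nat n : cmod (n%:R : R[i]) = n%:R.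
Proof. by apply: complexI; rewrite cmodC normr_nat rmorph_nat. Qed.

Lemma ler_Re_cmod z : `|complex.Re z| <= cmod z.
Proof. by rewrite -lecR cmodC normc_ge_Re. Qed.

Lemma ler_Im_cmod z : `|complex.Im z| <= cmod z.
Proof.
case: z => a b; rewrite /cmod /= -sqrtr_sqr ler_wsqrtr//.
by rewrite lerDr sqr_ge0.
Qed.

Lemma cmod_le_ReIm z : cmod z <= `|complex.Re z| + `|complex.Im z|.
Proof.
rewrite {1}(complexE z); apply: le_trans (cmodD _ _) _.
rewrite cmodM !cmod_real (_ : cmod 'i = 1) ?mul1r//.
by rewrite /cmod /= expr0n expr1n add0r sqrtr1.
Qed.

Lemma cmod_sum (I : Type) (r : seq I) (P : pred I) (F : I -> R[i]) :
  cmod (\sum_(i <- r | P i) F i) <= \sum_(i <- r | P i) cmod (F i).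
Proof.
elim/big_ind2: _ => [|x a y b xa yb|//]; first by rewrite cmod0.
by apply: le_trans (cmodD _ _) _; exact: lerD.
Qed.

Lemma cRe_real a : complex.Re a%:C = a. Proof. by []. Qed.
Lemma cIm_real a : complex.Im a%:C = 0. Proof. by []. Qed.
Lemma cReD x y : complex.Re (x + y) = complex.Re x + complex.Re y.
Proof. by case: x y => [a b] [c d]. Qed.
Lemma cImD x y : complex.Im (x + y) = complex.Im x + complex.Im y.
Proof. by case: x y => [a b] [c d]. Qed.
Lemma cReN x : complex.Re (- x) = - complex.Re x.
Proof. by case: x. Qed.
Lemma cImN x : complex.Im (- x) = - complex.Im x.
Proof. by case: x. Qed.
Lemma cReM x y : complex.Re (x * y) =
  complex.Re x * complex.Re y - complex.Im x * complex.Im y.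
Proof. by case: x y => [a b] [c d]. Qed.
Lemma cImM x y : complex.Im (x * y) =
  complex.Re x * complex.Im y + complex.Im x * complex.Re y.
Proof. by case: x y => [a b] [c d]. Qed.
Lemma cRe_sum n (F : nat -> R[i]) :
  complex.Re (\sum_(k < n) F k) = \sum_(k < n) complex.Re (F k).
Proof. by elim: n => [|n IH]; rewrite ?big_ord0// !big_ord_recr /= cReD IH. Qed.
Lemma cIm_sum n (F : nat -> R[i]) :
  complex.Im (\sum_(k < n) F k) = \sum_(k < n) complex.Im (F k).
Proof. by elim: n => [|n IH]; rewrite ?big_ord0// !big_ord_recr /= cImD IH. Qed.

End Modulus.

Section ComplexLimit.
Variable R : realType.
Implicit Types (u v : nat -> R[i]) (x y z : R[i]).

Definition ccvg u z : Prop :=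
  (fun n => complex.Re (u n)) @ \oo --> complex.Re z /\
  (fun n => complex.Im (u n)) @ \oo --> complex.Im z.

Definition clim u : R[i] :=
  lim ((fun n => complex.Re (u n)) @ \oo)
  +i* lim ((fun n => complex.Im (u n)) @ \oo).

Lemma ccvg_clim u z : ccvg u z -> clim u = z.
Proof.
by case: z => a b [ua ub]; rewrite /clim (cvg_lim _ ua)// (cvg_lim _ ub).
Qed.

Lemma ccvgD u v x y : ccvg u x -> ccvg v y -> ccvg (fun n => u n + v n) (x + y).
Proof.
move=> [u1 u2] [v1 v2]; split.
  by under eq_fun do rewrite cReD; rewrite cReD; exact: cvgD.
by under eq_fun do rewrite cImD; rewrite cImD; exact: cvgD.
Qed.

Lemma ccvgN u x : ccvg u x -> ccvg (fun n => - u n) (- x).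
Proof.
move=> [u1 u2]; split.
  by under eq_fun do rewrite cReN; rewrite cReN; exact: cvgN.
by under eq_fun do rewrite cImN; rewrite cImN; exact: cvgN.
Qed.

Lemma ccvgM u v x y : ccvg u x -> ccvg v y -> ccvg (fun n => u n * v n) (x * y).
Proof.
move=> [u1 u2] [v1 v2]; split.
  by under eq_fun do rewrite cReM; rewrite cReM; apply: cvgB; exact: cvgM.
by under eq_fun do rewrite cImM; rewrite cImM; apply: cvgD; exact: cvgM.
Qed.

Lemma ccvg_cst x : ccvg (fun=> x) x.
Proof. by split; exact: cvg_cst. Qed.

Lemma ccvgS u x : ccvg u x -> ccvg (fun n => u n.+1) x.
Proof.
move=> [u1 u2]; split.
  by rewrite (cvg_shiftS (fun n => complex.Re (u n))).
by rewrite (cvg_shiftS (fun n => complex.Im (u n))).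
Qed.

(** The limit is taken in [Re^2 + Im^2], a polynomial in the two real sequences; the bound is then
    recovered by comparing squares. *)
Lemma ccvg_le u x a : ccvg u x -> (forall n, cmod (u n) <= a) -> cmod x <= a.
Proof.
move=> [u1 u2] ua; have a0 : 0 <= a := le_trans (cmod_ge0 _) (ua 0%N).
have c : (fun n => complex.Re (u n) ^+ 2 + complex.Im (u n) ^+ 2) @ \oo -->
    complex.Re x ^+ 2 + complex.Im x ^+ 2.
  by apply: cvgD; rewrite expr2; under eq_fun do rewrite expr2; exact: cvgM.
have E z : complex.Re z ^+ 2 + complex.Im z ^+ 2 = cmod z ^+ 2.
  by case: z => p q; rewrite /cmod /= sqr_sqrtr// addr_ge0 ?sqr_ge0.
rewrite -(@ler_pXn2r _ 2) ?nnegrE ?cmod_ge0//.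
rewrite -E -(cvg_lim _ c)//; apply: limr_le; first by apply/cvg_ex; eexists; exact: c.
by apply: nearW => n; rewrite E lerXn2r// nnegrE ?cmod_ge0.
Qed.

Lemma ccvg_geometric u (a : R) :
  (forall n, cmod (u n.+1 - u n) <= a / 2 ^+ n) -> exists z, ccvg u z.
Proof.
move=> ua.
have key (f : nat -> R) : (forall n, `|f n.+1 - f n| <= a / 2 ^+ n) ->
    cvgn f.
  move=> fa; have : cvgn (series (fun n => `|f n.+1 - f n|)).
    have a0 : 0 <= a by have := fa 0%N; rewrite expr0 divr1; exact: le_trans.
    apply: (@series_le_cvg _ _ (geometric a 2^-1)).
    - by move=> n.
    - by move=> n; rewrite /geometric /= mulr_ge0// exprn_ge0.
    - by move=> n; rewrite /geometric /= exprVn; exact: fa.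
    - by apply: is_cvg_geometric_series; rewrite ger0_norm ?invf_lt1// ltr1n.
  move=> /normed_cvg; rewrite (_ : series _ = (fun n => f n - f 0%N)); last first.
    by apply/funext => n; rewrite /series /= telescope_sumr.
  move=> c; rewrite (_ : f = (fun n => f n - f 0%N) \+ cst (f 0%N)).
    by apply: is_cvgD => //; exact: is_cvg_cst.
  by apply/funext => n /=; rewrite subrK.
have c1 : cvgn (fun n => complex.Re (u n)).
  by apply: key => n; rewrite -cReN -cReD; apply: le_trans (ler_Re_cmod _) (ua n).
have c2 : cvgn (fun n => complex.Im (u n)).
  by apply: key => n; rewrite -cImN -cImD; apply: le_trans (ler_Im_cmod _) (ua n).
by by exists (clim u); split.
Qed.

(* Simplified Newton iteration [w - F w], a contraction of ratio 1/2. *)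
Lemma zero_near (F : R[i] -> R[i]) (a : R[i]) (r : R) :
  (forall u v : R[i], cmod (u - a) <= r -> cmod (v - a) <= r ->
     cmod (F u - F v - (u - v)) <= cmod (u - v) / 2) ->
  cmod (F a) <= r / 2 ->
  exists w, cmod (w - a) <= 2 * cmod (F a) /\ F w = 0.
Proof.
move=> HF; have := cmod_ge0 (F a); move bE : (cmod (F a)) => b b0 Fa.
pose T w := w - F w; pose u n := iter n T a.
have [e [eE e00 e0 eS]] : exists e : nat -> R, [/\ forall n, e n = (2 ^+ n)^-1,
    e 0%N = 1, forall n, 0 < e n & forall n, e n.+1 = e n / 2].
  exists (fun n => (2 ^+ n)^-1); split=> [//||n|n].
  - by rewrite expr0 invr1.
  - by rewrite invr_gt0 exprn_gt0.
  - by rewrite exprSr invfM mulrC.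
(* Increments halve, so the iterates stay within [2 b (1 - 2^-n)] of [a], inside the disc of the
   hypothesis because [2 b <= r]. *)
have step n : cmod (u n - a) <= 2 * b * (1 - e n) /\
    cmod (u n.+1 - u n) <= b * e n.
  elim: n => [|n [IH1 IH2]].
    rewrite e00 /u /= subrr cmod0 subrr mulr0 mulr1 /T.
    by rewrite addrAC subrr sub0r cmodN bE.
  have h1 : cmod (u n.+1 - a) <= 2 * b * (1 - e n.+1).
    have := cmodD (u n.+1 - u n) (u n - a); rewrite addrA subrK eS; lra.
  split=> //; rewrite /u !iterS -/(u n) -/(u n.+1).
  have -> : T (T (u n)) - T (u n) = - (F (u n.+1) - F (u n) - (u n.+1 - u n)).
    by rewrite /u iterS -/(u n) /T; ring.
  have ? := e0 n; have ? := e0 n.+1.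
  rewrite cmodN; apply: (@le_trans _ _ (cmod (u n.+1 - u n) / 2)); last first.
    by rewrite eS; lra.
  by apply: HF; [apply: le_trans h1 _|apply: le_trans IH1 _]; nra.
have [w uw] : exists w, ccvg u w.
  by apply: (@ccvg_geometric u b) => n; have [_] := step n; rewrite eE.
have ur n : cmod (u n - a) <= 2 * b.
  by have [h _] := step n; apply: le_trans h _; have := e0 n; nra.
have wa : cmod (w - a) <= 2 * b.
  apply: (@ccvg_le (fun n => u n - a)) => //.
  by apply: ccvgD => //; exact: ccvg_cst.
exists w; split=> //; apply/eqP; rewrite -cmod_eq0 eq_le cmod_ge0 andbT.
have uF : ccvg (fun n => F (u n)) 0.
  have -> : (fun n => F (u n)) = (fun n => u n - u n.+1).
    by apply/funext => n; rewrite /u iterS -/(u n) /T; ring.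
  by rewrite -(subrr w); apply: ccvgD => //; apply: ccvgN; exact: ccvgS.
(* The contraction hypothesis makes [F] Lipschitz on the disc, which gives the continuity needed to
   identify the limit of [F (u n)] with [F w]. *)
have dist : forall n, cmod (F w - F (u n)) <= 2 * cmod (w - u n).
  move=> n; have ua : cmod (u n - a) <= r by have := ur n; lra.
  have wr : cmod (w - a) <= r by lra.
  have := HF w (u n) wr ua; have := cmodD (F w - F (u n) - (w - u n)) (w - u n).
  by rewrite subrK; have := cmod_ge0 (w - u n); lra.
have sub z v : ccvg v z -> forall d, 0 < d -> \forall n \near \oo, cmod (z - v n) < d.
  move=> [v1 v2] d d0; have d2 : 0 < d / 2 by rewrite divr_gt0.
  near=> n; apply: le_lt_trans (cmod_le_ReIm _) _; rewrite (splitr d) cReD cReN cImD cImN.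
  by apply: ltrD; near: n; [move/cvgrPdist_lt: v1; exact|move/cvgrPdist_lt: v2; exact].
apply/ler_addgt0Pr => d d0; rewrite add0r.
have d4 : 0 < d / 4 by rewrite divr_gt0.
near \oo => n.
have h1 : cmod (w - u n) < d / 4 by near: n; exact: sub.
have h2 : cmod (0 - F (u n)) < d / 4 by near: n; exact: (sub 0 (fun n => F (u n))).
have := dist n; have := cmodD (F w - F (u n)) (F (u n)); rewrite subrK.
by move: h2; rewrite sub0r cmodN; lra.
Unshelve. all: by end_near. Qed.

End ComplexLimit.

(** * Spherical Bessel functions *)

Section ExponentialTypeSeries.
Variable R : realType.
Implicit Types (a b : nat -> R) (s : R[i]) (r : R).

(** Domination by the coefficients of the exponential is stable under [dcoef], so a series, its
    derivative and its second-order remainder are all bounded in terms of [expR r] on the disc of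
    radius [r]. *)
Definition exp_bounded a := forall k, `|a k| <= (k`!%:R)^-1.

Definition cpsum a s n : R[i] := \sum_(k < n) (a k)%:C * s ^+ k.

Definition cpser a s : R[i] := clim (cpsum a s).

Definition dcoef a k : R := k.+1%:R * a k.+1.

Lemma dcoef_bounded a : exp_bounded a -> exp_bounded (dcoef a).
Proof.
move=> ha k; rewrite /dcoef normrM normr_nat.
apply: le_trans (ler_wpM2l (ler0n _ _) (ha k.+1)) _.
by rewrite factS natrM invfM mulrA divff ?mul1r// pnatr_eq0.
Qed.

Lemma series_exp_le r n : 0 <= r -> \sum_(k < n) (k`!%:R)^-1 * r ^+ k <= expR r.
Proof.
move=> r0; rewrite /expR.
have -> : \sum_(k < n) (k`!%:R)^-1 * r ^+ k = series (exp_coeff r) n.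
  by rewrite /series /= big_mkord; apply: eq_bigr => k _; rewrite /exp_coeff mulrC.
apply: (nondecreasing_cvgn_le _ (is_cvg_series_exp_coeff r)).
apply/nondecreasing_seqP => m; rewrite /series /= big_nat_recr//= lerDl.
exact: exp_coeff_ge0.
Qed.

Lemma cpsum_ccvg a s : exp_bounded a -> ccvg (cpsum a s) (cpser a s).
Proof.
move=> ha.
have key (f : nat -> R) : (forall k, `|f k| <= exp_coeff (cmod s) k) ->
    cvgn (fun n => \sum_(k < n) f k).
  move=> hf; have -> : (fun n => \sum_(k < n) f k) = series f.
    by apply/funext => n; rewrite /series /= big_mkord.
  apply: normed_cvg; apply: (@series_le_cvg _ _ (exp_coeff (cmod s))).
  - by move=> n /=.
  - by move=> n; apply: exp_coeff_ge0; exact: cmod_ge0.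
  - exact: hf.
  - exact: is_cvg_series_exp_coeff.
have bnd k : cmod ((a k)%:C * s ^+ k) <= exp_coeff (cmod s) k.
  rewrite cmodM cmod_real cmodX /exp_coeff /= mulrC.
  by apply: ler_wpM2l; [rewrite exprn_ge0// cmod_ge0|exact: ha].
have c1 : cvgn (fun n => complex.Re (cpsum a s n)).
  under eq_fun do rewrite (cRe_sum _ (fun k => (a k)%:C * s ^+ k)).
  apply: (key (fun k => complex.Re ((a k)%:C * s ^+ k))) => k.
  by apply: le_trans (bnd k); exact: ler_Re_cmod.
have c2 : cvgn (fun n => complex.Im (cpsum a s n)).
  under eq_fun do rewrite (cIm_sum _ (fun k => (a k)%:C * s ^+ k)).
  apply: (key (fun k => complex.Im ((a k)%:C * s ^+ k))) => k.
  by apply: le_trans (bnd k); exact: ler_Im_cmod.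
by split.
Qed.

Lemma cpser_le a s r : exp_bounded a -> cmod s <= r -> cmod (cpser a s) <= expR r.
Proof.
move=> ha sr; apply: (ccvg_le (cpsum_ccvg s ha)) => n.
have r0 : 0 <= r := le_trans (cmod_ge0 _) sr.
apply: le_trans (series_exp_le n r0); apply: le_trans (cmod_sum _ _ _) _.
apply: ler_sum => k _; rewrite cmodM cmod_real cmodX.
by apply: ler_pM => //; [rewrite exprn_ge0// cmod_ge0|rewrite lerXn2r// nnegrE cmod_ge0].
Qed.

(** The remainder of degree [m + 3] is [s] times the previous one plus [(m + 2) t^(m+1) (s - t)^2].
    The constant is twice the sharp one; it is chosen to turn the bound [1 / (m + 2)!] on a
    coefficient into [1 / m!]. *)
Lemma expr_taylor r (s t : R[i]) m : cmod s <= r -> cmod t <= r ->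
  cmod (s ^+ m.+2 - t ^+ m.+2 - m.+2%:R * t ^+ m.+1 * (s - t))
   <= (m.+2 * m.+1)%:R * r ^+ m * cmod (s - t) ^+ 2.
Proof.
move=> sr tr; have r0 : 0 <= r := le_trans (cmod_ge0 _) sr.
elim: m => [|m IH].
  rewrite (_ : _ - _ = (s - t) ^+ 2); last by ring.
  by rewrite cmodX expr0 mulr1 ler_peMl ?sqr_ge0// ler1n.
set T := (X in cmod X) in IH.
rewrite (_ : _ - _ = s * T + m.+2%:R * t ^+ m.+1 * (s - t) ^+ 2); last first.
  by rewrite /T -[m.+3%:R]natr1 !exprS; ring.
apply: le_trans (cmodD _ _) _; rewrite !cmodM cmod_nat !cmodX.
have h1 : cmod s * cmod T <= r * ((m.+2 * m.+1)%:R * r ^+ m * cmod (s - t) ^+ 2).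
  by apply: ler_pM; rewrite ?cmod_ge0.
have h2 : m.+2%:R * cmod t ^+ m.+1 * cmod (s - t) ^+ 2 <=
          m.+2%:R * r ^+ m.+1 * cmod (s - t) ^+ 2.
  by rewrite ler_wpM2r ?sqr_ge0// ler_wpM2l// lerXn2r// ?nnegrE// cmod_ge0.
apply: le_trans (lerD h1 h2) _.
rewrite (_ : _ + _ = ((m.+2 * m.+1)%:R + m.+2%:R) * r ^+ m.+1 * cmod (s - t) ^+ 2).
  rewrite ler_wpM2r ?sqr_ge0// ler_wpM2r ?exprn_ge0// -natrD ler_nat.
  by rewrite -mulnSr mulnC leq_mul.
rewrite !exprS; move: (m.+2 * m.+1)%:R (m.+2%:R) => A B.
ring.
Qed.

Lemma cpser_taylor a r (s t : R[i]) : exp_bounded a -> cmod s <= r -> cmod t <= r ->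
  cmod (cpser a s - cpser a t - cpser (dcoef a) t * (s - t))
    <= expR r * cmod (s - t) ^+ 2.
Proof.
move=> ha sr tr; have r0 : 0 <= r := le_trans (cmod_ge0 _) sr.
have cv2 z : ccvg (fun n => cpsum a z n.+2) (cpser a z).
  apply: (ccvgS (u := fun n => cpsum a z n.+1)); apply: ccvgS.
  exact: cpsum_ccvg.
apply: (@ccvg_le _ (fun n => cpsum a s n.+2 - cpsum a t n.+2
    - cpsum (dcoef a) t n.+1 * (s - t))).
  apply: ccvgD; first apply: ccvgD.
  - exact: cv2.
  - by apply: ccvgN; exact: cv2.
  - apply: ccvgN; apply: ccvgM; last exact: ccvg_cst.
    by apply: ccvgS; apply: cpsum_ccvg; exact: dcoef_bounded.
move=> n.
(* Terms of degree 0 and 1 have no remainder, hence the shift by 2; the derivative series needs one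
   term less. *)
have -> : cpsum a s n.+2 - cpsum a t n.+2 - cpsum (dcoef a) t n.+1 * (s - t) =
   \sum_(m < n) (a m.+2)%:C *
     (s ^+ m.+2 - t ^+ m.+2 - m.+2%:R * t ^+ m.+1 * (s - t)).
  elim: n => [|n IH].
    rewrite /cpsum !big_ord_recr !big_ord0 /= /dcoef !rmorphM /= rmorph1; ring.
  rewrite big_ord_recr /= -IH /cpsum ![in LHS](big_ord_recr n.+2) ![in LHS](big_ord_recr n.+1) /=.
  rewrite ![in RHS](big_ord_recr n.+1) /= /dcoef !rmorphM /= rmorph_nat; ring.
apply: le_trans (cmod_sum _ _ _) _.
apply: (@le_trans _ _ (\sum_(m < n) (m`!%:R)^-1 * r ^+ m * cmod (s - t) ^+ 2)).
  apply: ler_sum => m _; rewrite cmodM cmod_real.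
  apply: le_trans (ler_pM _ _ (ha _) (expr_taylor m sr tr)) _; rewrite ?cmod_ge0//.
  rewrite mulrA ler_wpM2r ?sqr_ge0// mulrA ler_wpM2r ?exprn_ge0//.
  rewrite !factS !natrM [m.+2%:R * (_ * _)]mulrA invfM mulrAC mulVf ?mul1r// mulf_neq0// pnatr_eq0.
by rewrite -mulr_suml ler_wpM2r ?sqr_ge0// series_exp_le.
Qed.

Lemma cpser0 a : exp_bounded a -> cpser a 0 = (a 0%N)%:C.
Proof.
move=> ha; apply: ccvg_clim.
have -> : cpsum a 0 = fun n => if n is n'.+1 then (a 0%N)%:C else 0.
  apply/funext => -[|n]; first by rewrite /cpsum big_ord0.
  by rewrite /cpsum big_ord_recl expr0 mulr1 big1 ?addr0// => k _; rewrite expr0n mulr0.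
split; rewrite -cvg_shiftS; exact: cvg_cst.
Qed.

Lemma cpser_conj_real a (x : R) : exp_bounded a -> complex.Im (cpser a x%:C) = 0.
Proof.
move=> ha; have [_ c] := cpsum_ccvg x%:C ha.
rewrite -(cvg_lim _ c)// (_ : (fun n => _) = cst 0) ?lim_cst//.
apply/funext => n; rewrite (cIm_sum _ (fun k => (a k)%:C * x%:C ^+ k)) big1// => k _.
by rewrite -rmorphXn -rmorphM.
Qed.

End ExponentialTypeSeries.

(** * Power series of the spherical Bessel functions in the variable [z^2] *)

Section BesselSeries.
Variable R : realType.
Implicit Types (l k : nat) (s z : R[i]).

Definition bessel_coef l k : R :=
  (-1) ^+ k * (2 ^+ l * (k + l)`!%:R / (k`!%:R * (2 * k + 2 * l + 1)`!%:R)).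

(* [j_l z = z ^ l * phi l (z ^ 2)] *)
Definition phi l s : R[i] := cpser (bessel_coef l) s.

Lemma fact_neq0 n : n`!%:R != 0 :> R.
Proof. by rewrite pnatr_eq0 -lt0n fact_gt0. Qed.

(** After removing [1 / k!] it remains that [2^l (k+l)! <= (2(k+l)+1)!], which follows from
    [2^m m! <= (2m+1)!] with [m = k + l]. *)
Lemma bessel_coef_bounded l : exp_bounded (bessel_coef l).
Proof.
move=> k; rewrite /bessel_coef normrM normrX normrN1 expr1n mul1r.
rewrite invfM [_^-1 * _]mulrC mulrA ger0_norm; last first.
  by rewrite !mulr_ge0 ?invr_ge0 ?exprn_ge0.
rewrite ler_piMl ?invr_ge0// ler_pdivrMr ?ltr0n ?fact_gt0// mul1r -natrX -natrM ler_nat.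
apply: (@leq_trans (2 ^ (k + l) * (k + l)`!)%N).
  by rewrite leq_mul2r leq_pexp2l ?leq_addl ?orbT.
rewrite -mulnDr; elim: (k + l)%N => [//|m IH].
rewrite expnS factS (_ : 2 * m.+1 + 1 = (2 * m + 1).+2)%N; last by lia.
rewrite 2!factS; move: IH; set A := (2 ^ m)%N; set B := m`!; set C := (_`!)%N; nia.
Qed.

(** The ladder relation [(z^(-l) j_l)' = - z^(-l) j_(l+1)]; in the variable [s = z^2] it reads
    [phi_l' = - phi_(l+1) / 2], without any division by [z]. *)
Lemma dcoef_bessel l k : dcoef (bessel_coef l) k = - 2^-1 * bessel_coef l.+1 k.
Proof.
rewrite /dcoef /bessel_coef !exprS factS natrM.
rewrite (_ : k.+1 + l = k + l.+1)%N; last by lia.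
rewrite (_ : 2 * k.+1 + 2 * l + 1 = 2 * k + 2 * l.+1 + 1)%N; last by lia.
field.
by rewrite !fact_neq0 addrC natr1 pnatr_eq0.
Qed.

Lemma cpserZ (c : R) (a : nat -> R) s : exp_bounded a ->
  cpser (fun k => c * a k) s = c%:C * cpser a s.
Proof.
move=> ha; apply: ccvg_clim.
have -> : cpsum (fun k => c * a k) s = fun n => c%:C * cpsum a s n.
  apply/funext => n; rewrite /cpsum mulr_sumr; apply: eq_bigr => k _.
  by rewrite rmorphM mulrA.
by apply: ccvgM; [exact: ccvg_cst|exact: cpsum_ccvg].
Qed.

Lemma phi_taylor l r (s t : R[i]) : cmod s <= r -> cmod t <= r ->
  cmod (phi l s - phi l t + phi l.+1 t / 2 * (s - t)) <= expR r * cmod (s - t) ^+ 2.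
Proof.
move=> sr tr.
have := cpser_taylor (bessel_coef_bounded l) sr tr.
have -> : dcoef (bessel_coef l) = fun k => - 2^-1 * bessel_coef l.+1 k.
  by apply/funext => k; exact: dcoef_bessel.
rewrite cpserZ; last exact: bessel_coef_bounded.
rewrite -/(phi _ _) -/(phi _ _) -/(phi _ _) rmorphN fmorphV rmorph_nat.
by rewrite !mulNr opprK [2^-1 * _]mulrC.
Qed.

Lemma phi_le l r s : cmod s <= r -> cmod (phi l s) <= expR r.
Proof. exact/cpser_le/bessel_coef_bounded. Qed.

Lemma phi0_neq0 l : phi l 0 != 0.
Proof.
rewrite /phi cpser0; last exact: bessel_coef_bounded.
rewrite -cmod_eq0 cmod_real normr_eq0 /bessel_coef expr0 mul1r.
by rewrite !mulf_neq0 ?invr_eq0 ?mulf_neq0 ?fact_neq0// expf_neq0// pnatr_eq0.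
Qed.

Lemma phi_real l (x : R) : complex.Im (phi l x%:C) = 0.
Proof. exact/cpser_conj_real/bessel_coef_bounded. Qed.

Lemma phi0_gt0 l : 0 < complex.Re (phi l 0).
Proof.
rewrite /phi cpser0; last exact: bessel_coef_bounded.
rewrite /= /bessel_coef expr0 mul1r divr_gt0// ?mulr_gt0 ?exprn_gt0//;
  by rewrite ltr0n fact_gt0.
Qed.

(** This is [j_(l+2) + j_l = (2l+3) j_(l+1) / z] divided by [z^l]. Together with the ladder relation
    it is the radial Helmholtz equation of the interior field. *)
Lemma phi_rec l s : s * phi l.+2 s - (2 * l + 3)%:R * phi l.+1 s + phi l s = 0.
Proof.
have cv m : ccvg (cpsum (bessel_coef m) s) (phi m s).
  exact/cpsum_ccvg/bessel_coef_bounded.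
(* The factor [s] raises degrees by one, so the first sum is cut one term earlier; with this
   alignment the combination vanishes for every [n], not only in the limit. *)
have c : ccvg (fun n => s * cpsum (bessel_coef l.+2) s n
    - (2 * l + 3)%:R * cpsum (bessel_coef l.+1) s n.+1
    + cpsum (bessel_coef l) s n.+1)
    (s * phi l.+2 s - (2 * l + 3)%:R * phi l.+1 s + phi l s).
  apply: ccvgD; first apply: ccvgD.
  - by apply: ccvgM => //; exact: ccvg_cst.
  - by apply/ccvgN/ccvgM; [exact: ccvg_cst|exact: ccvgS].
  - exact: ccvgS.
rewrite -(ccvg_clim c); apply: ccvg_clim; rewrite (_ : (fun n => _) = fun=> 0).
  exact: ccvg_cst.
apply/funext => n; elim: n => [|n IH].
  rewrite /cpsum !big_ord_recr !big_ord0 /= !expr0 !mulr1 !add0r mulr0 add0r.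
  rewrite -(rmorph_nat (real_complex R)) -rmorphM -rmorphN -rmorphD.
  apply/eqP; rewrite fmorph_eq0; apply/eqP; rewrite /bessel_coef !add0n.
  rewrite (_ : 2 * 0 + 2 * l.+1 + 1 = (2 * l + 1).+2)%N; last by lia.
  rewrite !factS !natrM -!natr1 natrD natrM !exprS.
  have l0 : 0 <= l%:R :> R by [].
  field.
  by apply/and3P; split; [exact: fact_neq0|apply: lt0r_neq0; lra|apply: lt0r_neq0; lra].
rewrite /cpsum (big_ord_recr n) /= [X in _ - _ * X]big_ord_recr /=.
rewrite [X in _ + X = _]big_ord_recr /= -/(cpsum _ _ _) -/(cpsum _ _ _) -/(cpsum _ _ _).
have key : bessel_coef l.+2 n - (2 * l + 3)%:R * bessel_coef l.+1 n.+1
    + bessel_coef l n.+1 = 0.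
  rewrite /bessel_coef !exprS (_ : n + l.+2 = (n.+1 + l).+1)%N; last by lia.
  rewrite (_ : n.+1 + l.+1 = (n.+1 + l).+1)%N; last by lia.
  rewrite (_ : 2 * n + 2 * l.+2 + 1 = (2 * (n.+1 + l) + 1).+2)%N; last by lia.
  rewrite (_ : 2 * n.+1 + 2 * l.+1 + 1 = (2 * (n.+1 + l) + 1).+2)%N; last by lia.
  rewrite (_ : 2 * n.+1 + 2 * l + 1 = 2 * (n.+1 + l) + 1)%N; last by lia.
  have mR : (n.+1 + l)%:R = n%:R + 1 + l%:R :> R by rewrite natrD natr1.
  move: (n.+1 + l)%N mR => m mR.
  rewrite factS [(_.+2)`!]factS [(_.+1)`!]factS [(n.+1)`!]factS.
  move: (fact_neq0 m) (fact_neq0 n) (fact_neq0 (2 * m + 1)).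
  rewrite !natrM -!natr1 !natrD ?natrM mR.
  move: (m`!%:R) (n`!%:R) ((2 * m + 1)`!%:R) => x y z x0 y0 z0.
  have l0 : 0 <= l%:R :> R by [].
  have n0 : 0 <= n%:R :> R by [].
  field.
  by apply/and5P; split => //; apply: lt0r_neq0; lra.
have {}key : (bessel_coef l.+2 n)%:C - (2 * l + 3)%:R * (bessel_coef l.+1 n.+1)%:C
    + (bessel_coef l n.+1)%:C = 0.
  by rewrite -(rmorph_nat (real_complex R)) -rmorphM -rmorphN -!rmorphD /= key.
rewrite -[RHS](mulr0 (s ^+ n.+1)) -key -[RHS]add0r -IH exprS; ring.
Qed.

Lemma sph_besselE l z : sph_bessel l z = z ^+ l * phi l (z ^+ 2).
Proof.
apply: ccvg_clim; rewrite (_ : sph_bessel_psum l z =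
   fun n => z ^+ l * cpsum (bessel_coef l) (z ^+ 2) n).
  by apply: ccvgM; [exact: ccvg_cst|exact/cpsum_ccvg/bessel_coef_bounded].
apply/funext => n; rewrite /sph_bessel_psum /cpsum mulr_sumr; apply: eq_bigr => k _.
rewrite /bessel_coef !(rmorphM, fmorphV, rmorphXn, rmorphN, rmorph1, rmorph_nat) /=.
by rewrite exprD exprM; ring.
Qed.

End BesselSeries.

Global Opaque phi.

(** * Differential calculus for complex-valued functions *)

Section ComplexDifferential.
Variables (R : realType) (V : normedModType R).
Implicit Types (f g : V -> R[i]) (x v : V) (d : V -> R[i]).

(** The whole real differential is carried rather than one directional derivative, so that product
    and chain rules apply and partial derivatives are read off by evaluating [d]. *)
Definition cdiff f x d : Prop :=
  is_diff x (fun y => complex.Re (f y)) (fun v => complex.Re (d v)) /\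
  is_diff x (fun y => complex.Im (f y)) (fun v => complex.Im (d v)).

Lemma cdiff_ext f x d d' : d =1 d' -> cdiff f x d -> cdiff f x d'.
Proof. by move=> /funext ->. Qed.

Lemma cdiff_cst (c : R[i]) x : cdiff (fun=> c) x (fun=> 0).
Proof. by split; apply: is_diff_cst. Qed.

Lemma cdiffD f g x d e : cdiff f x d -> cdiff g x e ->
  cdiff (fun y => f y + g y) x (fun v => d v + e v).
Proof.
move=> [f1 f2] [g1 g2]; split.
  under eq_fun do rewrite cReD; under [X in is_diff _ _ X]eq_fun do rewrite cReD.
  exact: is_diffD.
under eq_fun do rewrite cImD; under [X in is_diff _ _ X]eq_fun do rewrite cImD.
exact: is_diffD.
Qed.

Lemma cdiffM f g x d e : cdiff f x d -> cdiff g x e ->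
  cdiff (fun y => f y * g y) x (fun v => f x * e v + g x * d v).
Proof.
move=> [f1 f2] [g1 g2]; split.
  under eq_fun do rewrite cReM.
  apply: is_diff_eq (is_diffB (is_diffM f1 g1) (is_diffM f2 g2)) _.
  by apply/funext => v; rewrite cReD !cReM /= !fctE /= /GRing.scale /=; ring.
under eq_fun do rewrite cImM.
apply: is_diff_eq (is_diffD (is_diffM f1 g2) (is_diffM f2 g1)) _.
by apply/funext => v; rewrite cImD !cImM /= !fctE /= /GRing.scale /=; ring.
Qed.

Lemma cdiffZ (c : R[i]) f x d : cdiff f x d -> cdiff (fun y => c * f y) x (fun v => c * d v).
Proof.
move=> fd; apply: cdiff_ext (cdiffM (cdiff_cst c x) fd) => v.
by rewrite mulr0 addr0.
Qed.

Lemma cdiffX f x d n : cdiff f x d ->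
  cdiff (fun y => f y ^+ n) x (fun v => n%:R * f x ^+ n.-1 * d v).
Proof.
move=> fd; elim: n => [|n IH].
  by apply: cdiff_ext (cdiff_cst 1 x) => v; rewrite !mul0r.
under eq_fun do rewrite exprS.
apply: cdiff_ext (cdiffM fd IH) => v; case: n IH => [|n] _.
  by rewrite /= !expr0; ring.
by rewrite /= -[n.+2%:R]natr1 !exprS; ring.
Qed.

Lemma cdiff_real (q dq : V -> R) x : is_diff x q dq ->
  cdiff (fun y => (q y)%:C) x (fun v => (dq v)%:C).
Proof. by move=> qd; split => //; exact: (is_diff_cst 0). Qed.

Lemma cdiff_Re_continuous f x d : cdiff f x d ->
  {for x, continuous (fun y => complex.Re (f y))}.
Proof. by move=> [[fd _] _]; exact: differentiable_continuous. Qed.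

Lemma cdiff_Im_continuous f x d : cdiff f x d ->
  {for x, continuous (fun y => complex.Im (f y))}.
Proof. by move=> [_ [fd _]]; exact: differentiable_continuous. Qed.

Lemma cdiff_derivable f x d v : cdiff f x d ->
  derivable (fun y => complex.Re (f y)) x v /\ derivable (fun y => complex.Im (f y)) x v.
Proof. by move=> [[f1 _] [f2 _]]; split; exact: diff_derivable. Qed.

Lemma cdiff_derive f x d v : cdiff f x d ->
  'D_v (fun y => complex.Re (f y)) x = complex.Re (d v) /\
  'D_v (fun y => complex.Im (f y)) x = complex.Im (d v).
Proof. by move=> [[f1 e1] [f2 e2]]; rewrite !deriveE// e1 e2. Qed.

Lemma cderiveE f x d v : cdiff f x d -> cderive v f x = d v.
Proof. by move=> /cdiff_derive; rewrite /cderive => /(_ v) [-> ->]; case: (d v). Qed.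

End ComplexDifferential.

Section RealVariable.
Variable R : realType.

Definition has_cder (f : R -> R[i]) (t : R) (d : R[i]) : Prop :=
  cdiff f t (fun h => h%:C * d).

Lemma is_derive_is_diff (f : R -> R) (t d : R) : is_derive t 1 f d ->
  is_diff t f (fun h => h * d).
Proof.
move=> [df fd]; have fdiff : differentiable f t by apply/derivable1_diffP.
by apply: DiffDef => //; rewrite diff1E// derive1E fd.
Qed.

Lemma has_cder_real (f : R -> R) (t d : R) : is_derive t 1 f d ->
  has_cder (fun s => (f s)%:C) t d%:C.
Proof.
move=> /is_derive_is_diff fd; apply: cdiff_ext (cdiff_real fd) => h.
by rewrite rmorphM.
Qed.

Lemma has_cder_eq (f : R -> R[i]) t d d' : has_cder f t d -> d = d' -> has_cder f t d'.
Proof. by move=> ? <-. Qed.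

Lemma has_cderD (f g : R -> R[i]) t d e : has_cder f t d -> has_cder g t e ->
  has_cder (fun s => f s + g s) t (d + e).
Proof. by move=> fd ge; apply: cdiff_ext (cdiffD fd ge) => h; rewrite mulrDr. Qed.

Lemma has_cderM (f g : R -> R[i]) t d e : has_cder f t d -> has_cder g t e ->
  has_cder (fun s => f s * g s) t (f t * e + g t * d).
Proof. by move=> fd ge; apply: cdiff_ext (cdiffM fd ge) => h; ring. Qed.

Lemma has_cderZ (c : R[i]) (f : R -> R[i]) t d : has_cder f t d ->
  has_cder (fun s => c * f s) t (c * d).
Proof. by move=> fd; apply: cdiff_ext (cdiffZ c fd) => h; ring. Qed.

Lemma has_cder_cst (c : R[i]) t : has_cder (fun=> c) t 0.
Proof. by apply: cdiff_ext (cdiff_cst c t) => h; rewrite mulr0. Qed.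

Lemma has_cder_comp (V : normedModType R) (g : R -> R[i]) (q dq : V -> R) x d :
  is_diff x q dq -> has_cder g (q x) d ->
  cdiff (fun y => g (q y)) x (fun v => (dq v)%:C * d).
Proof.
move=> qd [g1 g2]; split; first exact: (is_diff_comp qd g1).
exact: (is_diff_comp qd g2).
Qed.

Lemma has_cder_comp1 (g : R -> R[i]) (q : R -> R) (t dq : R) d :
  is_derive t 1 q dq -> has_cder g (q t) d ->
  has_cder (fun y => g (q y)) t (dq%:C * d).
Proof.
move=> /is_derive_is_diff qd gd; apply: cdiff_ext (has_cder_comp qd gd) => h.
by rewrite rmorphM mulrA.
Qed.

(** The remainder estimates of the power series have exactly this shape, so their derivatives along
    the real line are obtained without differentiating limits. *)
Lemma is_derive_quad (f : R -> R) (t d K : R) :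
  (forall s, `|s - t| <= 1 -> `|f s - f t - (s - t) * d| <= K * (s - t) ^+ 2) ->
  is_derive t 1 f d.
Proof.
move=> fq; suff c : h^-1 *: (f (h *: (1 : R) + t) - f t) @[h --> 0^'] --> d.
  by apply: DeriveDef; [apply/cvg_ex; exists d|exact: cvg_lim c].
have K0 : 0 <= K.
  have := fq (t + 1); rewrite (addrC t) addrK normr1 expr1n mulr1 => /(_ (lexx _)).
  exact: le_trans.
apply/cvgrPdist_le => e e0; near=> h.
have h0 : h != 0 by near: h; exact: nbhs_dnbhs_neq.
have h1 : `|h| <= 1 by near: h; apply: dnbhs0_le.
have h2 : `|h| <= e / (K + 1).
  by near: h; apply: dnbhs0_le; rewrite divr_gt0// ltr_pwDr.
have := fq (h + t); rewrite addrK => /(_ h1) H.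
have -> : h *: (1 : R) = h by rewrite /GRing.scale /= mulr1.
rewrite distrC -(@ler_pM2l _ `|h|) ?normr_gt0// -normrM.
rewrite mulrBr {1}/GRing.scale /= mulrA divff// mul1r.
apply: le_trans H _; rewrite -[h ^+ 2]ger0_norm ?sqr_ge0// normrX expr2 mulrCA.
rewrite ler_pM2l ?normr_gt0//; move: h2; rewrite ler_pdivlMr ?ltr_pwDr// => h2.
by have := normr_ge0 h; nra.
Unshelve. all: by end_near. Qed.

Lemma has_cder_quad (f : R -> R[i]) (t K : R) d :
  (forall s, `|s - t| <= 1 ->
     cmod (f s - f t - (s - t)%:C * d) <= K * (s - t) ^+ 2) ->
  has_cder f t d.
Proof.
move=> fq; split.
  apply: is_diff_eq; first apply: is_derive_is_diff; first apply: is_derive_quad.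
    move=> s /fq; apply: le_trans; apply: le_trans (ler_Re_cmod _).
    by rewrite !cReD !cReN cReM /= mul0r subr0.
  by apply/funext => h; rewrite cReM /= mul0r subr0.
apply: is_diff_eq; first apply: is_derive_is_diff; first apply: is_derive_quad.
  move=> s /fq; apply: le_trans; apply: le_trans (ler_Im_cmod _).
  by rewrite !cImD !cImN cImM /= mul0r addr0.
by apply/funext => h; rewrite cImM /= mul0r addr0.
Qed.

Lemma has_cder_is_derive (f : R -> R[i]) (t : R) d : has_cder f t d ->
  is_derive t 1 (fun s => complex.Re (f s)) (complex.Re d) /\
  is_derive t 1 (fun s => complex.Im (f s)) (complex.Im d).
Proof.
move=> fd; have [a b] := cdiff_derivable (1 : R) fd.
have [p q] := cdiff_derive (1 : R) fd.
by split; apply: DeriveDef; rewrite ?p ?q ?mul1r.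
Qed.

Lemma has_cder_phi l (k : R[i]) t :
  has_cder (fun s => phi l (k * s%:C)) t (- (k / 2) * phi l.+1 (k * t%:C)).
Proof.
pose r := cmod k * (`|t| + 1).
apply: (@has_cder_quad _ _ (expR r * cmod k ^+ 2)) => s st.
have tr : cmod (k * t%:C) <= r.
  by rewrite cmodM cmod_real ler_wpM2l ?cmod_ge0// lerDl.
have sr : cmod (k * s%:C) <= r.
  rewrite cmodM cmod_real ler_wpM2l ?cmod_ge0//.
  by rewrite -[s](subrK t) addrC; apply: le_trans (ler_normD _ _) _; rewrite lerD2l.
have := phi_taylor l sr tr.
rewrite -mulrBr -rmorphB cmodM cmod_real exprMn.
rewrite -normrX ger0_norm ?sqr_ge0// [expR r * (_ * _)]mulrA; congr (cmod _ <= _).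
rewrite /=; move: (phi l.+1 _) (phi l (k * s%:C)) (phi l (k * t%:C)) (s - t)%:C.
by move=> a b c d; ring.
Qed.

Lemma has_cder_cexp (c : R[i]) t :
  has_cder (fun s => cexp (c * s%:C)) t (c * cexp (c * t%:C)).
Proof.
case: c => a b.
have dl (p : R) : is_derive t 1 (fun s => p * s) p.
  by apply: is_derive_eq; rewrite scaler1.
rewrite (_ : (fun s => _) = fun s => (expR (a * s))%:C *
    ((cos (b * s))%:C + 'i * (sin (b * s))%:C)); last first.
  apply/funext => s; apply/eqP; rewrite eq_complex /=.
  by apply/andP; split; apply/eqP; rewrite !(mulr0, mul0r, subr0, addr0, add0r, mul1r).
have E := has_cder_real (is_derive1_comp (is_derive_expR (a * t)) (dl a)).
have C := has_cder_real (is_derive1_comp (is_derive_cos (b * t)) (dl b)).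
have S := has_cder_real (is_derive1_comp (is_derive_sin (b * t)) (dl b)).
apply: has_cder_eq (has_cderM E (has_cderD C (has_cderZ 'i S))) _.
have -> : (a +i* b) * t%:C = (a * t) +i* (b * t).
  by apply/eqP; rewrite eq_complex /= !mulr0 subr0 add0r !eqxx.
rewrite /cexp /=; apply/eqP; rewrite eq_complex /=.
by apply/andP; split; apply/eqP; ring.
Qed.

(** [F] will be either one-sided filter at 0. Both fields are given by formulas that are smooth
    across the sphere, so a two-sided derivative yields the exterior and the interior normal
    derivative alike. *)
Lemma has_cder_radial_cvg (f : R -> R[i]) d (F : set_system R) :
  F `=>` 0^' -> Filter F -> has_cder f 0 d ->
  (fun t => complex.Re (f t - f 0) / t) @ F --> complex.Re d /\
  (fun t => complex.Im (f t - f 0) / t) @ F --> complex.Im d.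
Proof.
move=> F0 FF /has_cder_is_derive [[a1 b1] [a2 b2]]; split.
  move: a1 => /cvg_ex [l cl]; move: (cl) b1 => /(cvg_lim _) h; rewrite /derive h// => <-.
  apply: cvg_trans; last exact: cl; apply: cvg_trans; first exact: (cvg_app _ F0).
  apply: near_eq_cvg; near=> t.
  by rewrite /= addr0 cReD cReN /GRing.scale /= mulr1 mulrC.
move: a2 => /cvg_ex [l cl]; move: (cl) b2 => /(cvg_lim _) h; rewrite /derive h// => <-.
apply: cvg_trans; last exact: cl; apply: cvg_trans; first exact: (cvg_app _ F0).
apply: near_eq_cvg; near=> t.
by rewrite /= addr0 cImD cImN /GRing.scale /= mulr1 mulrC.
Unshelve. all: by end_near. Qed.

End RealVariable.

(** * Radial functions times [(x_0 + i x_1)^l] *)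

Section Space.
Variable R : realType.
Local Notation V := 'rV[R]_3.
Implicit Types (x v : V).

(* [x_0 + i x_1], whose powers are harmonic and carry the angular dependence
   of the spherical harmonics with [m = l] *)
Definition zeta x : R[i] := x 0 (inord 0) +i* x 0 (inord 1).

Definition sq x : R := \sum_i x 0 i ^+ 2.

Lemma big_ord3 (M : nmodType) (F : 'I_3 -> M) :
  \sum_i F i = F (inord 0) + F (inord 1) + F (inord 2).
Proof.
rewrite !big_ord_recl big_ord0 addr0 addrA.
by congr (F _ + F _ + F _); apply/val_inj; rewrite /= inordK.
Qed.

Lemma is_diff_coord x (i : 'I_3) :
  is_diff x (fun y : V => y 0 i) (fun v : V => v 0 i).
Proof.
have lin : linear (fun v : V => v 0 i : R) by move=> a u v; rewrite !mxE.
pose fl := GRing.isLinear.Build _ _ _ _ _ lin.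
pose f : {linear V -> R} := HB.pack (fun v : V => v 0 i : R) fl.
have cf : continuous f by exact: coord_continuous.
by apply: (@DiffDef _ _ _ _ _ f f); [exact: linear_differentiable|rewrite diff_lin].
Qed.

Lemma is_diff_sq x : is_diff x sq (fun v => 2 * \sum_i x 0 i * v 0 i).
Proof.
have d i := is_diffX 1 (is_diff_coord x i).
have e : sq = (fun y : V => y 0 (inord 0)) ^+ 2 + (fun y : V => y 0 (inord 1)) ^+ 2
    + (fun y : V => y 0 (inord 2)) ^+ 2 :> (V -> R).
  by apply/funext => y; rewrite /sq big_ord3.
rewrite e; apply: is_diff_eq (is_diffD (is_diffD (d _) (d _)) (d _)) _.
apply/funext => v; rewrite big_ord3 !fctE /GRing.scale /= !expr1; ring.
Qed.

Lemma cdiff_zeta x : cdiff zeta x zeta.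
Proof. by split; apply: is_diff_coord. Qed.

Lemma cdiff_coord x (i : 'I_3) : cdiff (fun y : V => (y 0 i)%:C) x (fun v => (v 0 i)%:C).
Proof. exact/cdiff_real/is_diff_coord. Qed.

Lemma basis_vecE (i j : 'I_3) : (basis_vec R i : V) 0 j = (j == i)%:R.
Proof. by rewrite /basis_vec mxE eqxx. Qed.

Lemma sq_basis x (i : 'I_3) : \sum_j x 0 j * (basis_vec R i : V) 0 j = x 0 i.
Proof.
rewrite (bigD1 i)//= basis_vecE eqxx mulr1 big1 ?addr0// => j ji.
by rewrite basis_vecE (negPf ji) mulr0.
Qed.

Lemma sum_zeta_basis_sq : \sum_i zeta (basis_vec R i) ^+ 2 = 0.
Proof.
rewrite big_ord3 /zeta !basis_vecE -!val_eqE /= !inordK//=.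
by apply/eqP; rewrite eq_complex /=; apply/andP; split; apply/eqP; ring.
Qed.

Lemma sum_zeta_basis x : \sum_i (x 0 i)%:C * zeta (basis_vec R i) = zeta x.
Proof.
rewrite big_ord3 /zeta !basis_vecE -!val_eqE /= !inordK//=.
by apply/eqP; rewrite eq_complex /=; apply/andP; split; apply/eqP; ring.
Qed.

Lemma sum_coord_sq x : \sum_i (x 0 i)%:C ^+ 2 = (sq x)%:C.
Proof. by rewrite rmorph_sum; apply: eq_bigr => i _; rewrite rmorphXn. Qed.

Lemma zetaZ a x : zeta (a *: x) = a%:C * zeta x.
Proof.
by rewrite /zeta !mxE; apply/eqP; rewrite eq_complex /= !mul0r subr0 addr0 !eqxx.
Qed.

Lemma sq_continuous : continuous sq.
Proof. by move=> x; apply: differentiable_continuous; case: (is_diff_sq x). Qed.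

Lemma sq_ge0 x : 0 <= sq x.
Proof. by apply: sumr_ge0 => i _; exact: sqr_ge0. Qed.

Lemma enorm_sq x : enorm x ^+ 2 = sq x.
Proof. by rewrite /enorm sqr_sqrtr// sq_ge0. Qed.

Lemma enormZ a x : enorm (a *: x) = `|a| * enorm x.
Proof.
rewrite /enorm -sqrtr_sqr -sqrtrM ?sqr_ge0//; congr (Num.sqrt _).
by rewrite mulr_sumr; apply: eq_bigr => i _; rewrite mxE exprMn.
Qed.

Lemma sq_gt0 x : (0 < sq x) = (x != 0).
Proof.
rewrite lt_neqAle sq_ge0 andbT eq_sym; congr (~~ _); apply/idP/eqP => [|->]; last first.
  by rewrite /sq big1// => i _; rewrite mxE expr0n.
rewrite /sq psumr_eq0; last by move=> i _; exact: sqr_ge0.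
move=> /allP h; apply/rowP => i; rewrite mxE; apply/eqP.
by have := h i (mem_index_enum _); rewrite sqrf_eq0.
Qed.

Lemma enorm_gt0 x : (0 < enorm x) = (x != 0).
Proof. by rewrite -sq_gt0 /enorm sqrtr_gt0. Qed.

Section Radial.
Variables (l : nat) (g g1 g2 g3 : R -> R[i]) (S : set R).
Hypotheses (oS : open S)
  (dg : forall t, S t -> has_cder g t (g1 t))
  (dg1 : forall t, S t -> has_cder g1 t (g2 t))
  (dg2 : forall t, S t -> has_cder g2 t (g3 t)).

Local Notation u := (fun x => g (sq x) * zeta x ^+ l).
Local Notation e i := (zeta (basis_vec R i)).

(** The truncated exponents [l.-1] and [l.-2] are harmless for small [l]: the factors [l%:R] and
    [l.-1%:R] vanish exactly there. *)
Definition radial_grad i x : R[i] := g (sq x) * (l%:R * zeta x ^+ l.-1 * e i)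
  + 2 * (x 0 i)%:C * g1 (sq x) * zeta x ^+ l.
Definition radial_hess i j x : R[i] :=
  g (sq x) * (l%:R * (l.-1%:R * zeta x ^+ l.-2) * e i * e j)
  + 2 * (x 0 j)%:C * g1 (sq x) * (l%:R * zeta x ^+ l.-1 * e i)
  + 2 * (x 0 i)%:C * g1 (sq x) * (l%:R * zeta x ^+ l.-1 * e j)
  + (2 * (j == i)%:R * g1 (sq x) + 4 * (x 0 i)%:C * (x 0 j)%:C * g2 (sq x))
      * zeta x ^+ l.

Lemma cdiff_sq_comp (x : V) (h h1 : R -> R[i]) : has_cder h (sq x) (h1 (sq x)) ->
  cdiff (fun y => h (sq y)) x
    (fun v => (2 * \sum_i x 0 i * v 0 i)%:C * h1 (sq x)).
Proof. exact/has_cder_comp/is_diff_sq. Qed.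

Lemma cdiff_radial x : S (sq x) ->
  exists d, cdiff u x d /\ forall i, d (basis_vec R i) = radial_grad i x.
Proof.
move=> Sx; eexists; split.
  apply: cdiffM; first exact: (cdiff_sq_comp (dg Sx)).
  exact: (cdiffX l (cdiff_zeta x)).
by move=> i /=; rewrite sq_basis /radial_grad rmorphM rmorph_nat; ring.
Qed.

Lemma cdiff_radial1 i x : S (sq x) ->
  exists d, cdiff (radial_grad i) x d /\ forall j, d (basis_vec R j) = radial_hess i j x.
Proof.
move=> Sx; eexists; split.
  apply: cdiffD.
    apply: cdiffM; first exact: (cdiff_sq_comp (dg Sx)).
    apply: cdiffM; last exact: cdiff_cst.
    apply: cdiffZ; exact: (cdiffX l.-1 (cdiff_zeta x)).
  apply: cdiffM; last exact: (cdiffX l (cdiff_zeta x)).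
  apply: cdiffM; last exact: (cdiff_sq_comp (dg1 Sx)).
  by apply: cdiffZ; exact: cdiff_coord.
move=> j /=; rewrite !sq_basis basis_vecE (eq_sym i) !rmorphM !rmorph_nat /radial_hess.
by rewrite /=; ring.
Qed.

Lemma cdiff_radial2 i j x : S (sq x) -> exists d, cdiff (radial_hess i j) x d.
Proof.
move=> Sx; have Z n := cdiffX n (cdiff_zeta x).
have G := cdiff_sq_comp (dg Sx); have G1 := cdiff_sq_comp (dg1 Sx); have G2 := cdiff_sq_comp (dg2 Sx).
have C k := cdiff_coord x k.
eexists; apply: cdiffD; first (apply: cdiffD; first apply: cdiffD).
- apply: cdiffM; first exact: G.
  apply: cdiffM; last exact: cdiff_cst.
  apply: cdiffM; last exact: cdiff_cst.
  by apply: cdiffZ; apply: cdiffZ; exact: Z.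
- apply: cdiffM; first by apply: cdiffM; [apply: cdiffZ; exact: C|exact: G1].
  by apply: cdiffM; [apply: cdiffZ; exact: Z|exact: cdiff_cst].
- apply: cdiffM; first by apply: cdiffM; [apply: cdiffZ; exact: C|exact: G1].
  by apply: cdiffM; [apply: cdiffZ; exact: Z|exact: cdiff_cst].
- apply: cdiffM; last exact: Z.
  apply: cdiffD; first by apply: cdiffZ; exact: G1.
  by apply: cdiffM; [apply: cdiffM; [apply: cdiffZ; exact: C|exact: C]|exact: G2].
Qed.

Lemma near_sq x : S (sq x) -> \forall y \near x, S (sq y).
Proof. by move=> Sx; exact: (sq_continuous (open_nbhs_nbhs (conj oS Sx))). Qed.

(** A neighbourhood is required because these identities are differentiated once more. *)
Lemma near_radial_grad i x : S (sq x) -> \forall y \near x,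
  [/\ complex.Re (radial_grad i y) = 'D_(basis_vec R i) (fun y => complex.Re (u y)) y,
      complex.Im (radial_grad i y) = 'D_(basis_vec R i) (fun y => complex.Im (u y)) y
    & radial_grad i y = cderive (basis_vec R i) u y].
Proof.
move=> Sx; near=> y; have Sy : S (sq y) by near: y; exact: near_sq.
have [d [ud dE]] := cdiff_radial Sy; rewrite (cderiveE _ ud) dE.
by have [-> ->] := cdiff_derive (basis_vec R i) ud; rewrite dE.
Unshelve. all: by end_near. Qed.

Lemma near_radial_hess i j x : S (sq x) -> \forall y \near x,
  complex.Re (radial_hess i j y) =
    'D_(basis_vec R j) ('D_(basis_vec R i) (fun y => complex.Re (u y))) y /\
  complex.Im (radial_hess i j y) =
    'D_(basis_vec R j) ('D_(basis_vec R i) (fun y => complex.Im (u y))) y.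
Proof.
move=> Sx; near=> y; have Sy : S (sq y) by near: y; exact: near_sq.
have [d [ud dE]] := cdiff_radial1 i Sy.
have [p q] := cdiff_derive (basis_vec R j) ud; rewrite -dE -p -q.
by split; apply: near_eq_derive; near=> z; (have [//] : [/\ complex.Re (radial_grad i z) = 'D_(basis_vec R i) (fun y => complex.Re (u y)) z,
      complex.Im (radial_grad i z) = 'D_(basis_vec R i) (fun y => complex.Im (u y)) z
    & radial_grad i z = cderive (basis_vec R i) u z] by near: z; exact: near_radial_grad).
Unshelve. all: by end_near. Qed.

(** Continuity of the second derivatives is deduced from their differentiability, which is what [g3]
    provides. *)
Lemma radial_C2 (Om : set V) : (forall x, Om x -> S (sq x)) -> cC2_on Om u.
Proof.
move=> OmS; split=> x /OmS Sx i j.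
  have [d [ud _]] := cdiff_radial Sx; have [d1 [ud1 _]] := cdiff_radial1 i Sx.
  have [d2 ud2] := cdiff_radial2 i j Sx; split.
  - have [h _] := cdiff_derivable (basis_vec R i) ud; exact: h.
  - have [a _] := cdiff_derivable (basis_vec R j) ud1; apply: near_eq_derivable a.
    apply: filterS (near_radial_grad i Sx) => y [h _ _]; exact: h.
  - have c := cdiff_Re_continuous ud2; rewrite /prop_for /continuous_at.
    rewrite -(nbhs_singleton (near_radial_hess i j Sx)).1.
    apply: cvg_trans c; apply: (@near_eq_cvg _ _ (nbhs x)).
    apply: filterS (near_radial_hess i j Sx) => y [h _]; exact: h.
have [d [ud _]] := cdiff_radial Sx; have [d1 [ud1 _]] := cdiff_radial1 i Sx.
have [d2 ud2] := cdiff_radial2 i j Sx; split.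
- have [_ h] := cdiff_derivable (basis_vec R i) ud; exact: h.
- have [_ a] := cdiff_derivable (basis_vec R j) ud1; apply: near_eq_derivable a.
  apply: filterS (near_radial_grad i Sx) => y [_ h _]; exact: h.
- have c := cdiff_Im_continuous ud2; rewrite /prop_for /continuous_at.
  rewrite -(nbhs_singleton (near_radial_hess i j Sx)).2.
  apply: cvg_trans c; apply: (@near_eq_cvg _ _ (nbhs x)).
  apply: filterS (near_radial_hess i j Sx) => y [_ h]; exact: h.
Qed.

(** The gradient of [zeta] is isotropic (its squares sum to 0), so the Hessian of [zeta^l] has no
    trace; Euler's identity turns the cross terms into [4 l g1], and [6 g1] is twice the
    dimension. *)
Lemma radial_laplacian x : S (sq x) -> laplacian u x =
  (4 * (sq x)%:C * g2 (sq x) + (4 * l + 6)%:R * g1 (sq x)) * zeta x ^+ l.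
Proof.
move=> Sx; rewrite /laplacian.
have -> : \sum_i cderive (basis_vec R i) (cderive (basis_vec R i) u) x = \sum_i radial_hess i i x.
  apply: eq_bigr => i _; rewrite -[RHS](_ : cderive (basis_vec R i) (radial_grad i) x = _).
    rewrite /cderive; congr (_ +i* _); apply: near_eq_derive;
      by apply: filterS (near_radial_grad i Sx) => y [_ _ ->].
  by have [d [ud dE]] := cdiff_radial1 i Sx; rewrite (cderiveE _ ud) dE.
have -> : \sum_i radial_hess i i x =
   g (sq x) * (l%:R * (l.-1%:R * zeta x ^+ l.-2)) * \sum_i e i ^+ 2
   + 4 * g1 (sq x) * (l%:R * zeta x ^+ l.-1) * \sum_i (x 0 i)%:C * e i
   + 6 * g1 (sq x) * zeta x ^+ l
   + 4 * g2 (sq x) * zeta x ^+ l * \sum_i (x 0 i)%:C ^+ 2.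
  rewrite !big_ord3 /radial_hess !eqxx /=.
  move: (zeta x ^+ l) (zeta x ^+ l.-1) (zeta x ^+ l.-2) (l%:R) (l.-1%:R) (g _) (g1 _) (g2 _).
  move: (e _) (e _) (e _) (_%:C) (_%:C) (_%:C) => *; ring.
rewrite sum_zeta_basis_sq sum_zeta_basis sum_coord_sq natrD natrM.
by case: l => [|n] /=; rewrite ?exprS; ring.
Qed.

Lemma radial_continuous (D : set V) : (forall x, D x -> S (sq x)) -> ccontinuous_on D u.
Proof.
move=> DS; split; apply: continuous_in_subspaceT => x; rewrite inE => /DS Sx;
  have [d [ud _]] := cdiff_radial Sx.
- exact: cdiff_Re_continuous ud.
- exact: cdiff_Im_continuous ud.
Qed.

Lemma radial_radial_derivative x (r : R) (F : set_system R) :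
  F `=>` 0^' -> Filter F -> 0 < r -> enorm x = r -> S (r ^+ 2) ->
  radial_derivative F u x
    ((2 * r%:C * g1 (r ^+ 2) + l%:R / r%:C * g (r ^+ 2)) * zeta x ^+ l).
Proof.
move=> F0 FF r0 xr Sr; have rC : r%:C != 0 by rewrite fmorph_eq0 gt_eqF.
pose f (t : R) : R[i] := g ((r + t) ^+ 2) * (((r + t) / r)%:C ^+ l * zeta x ^+ l).
(* Moving along the normal is a dilation of [x] by [(r + t) / r], under which [zeta] is
   homogeneous. *)
have uf t : u (x + t *: unit_vec x) = f t.
  have -> : x + t *: unit_vec x = ((r + t) / r) *: x.
    by rewrite /unit_vec xr scalerA -{1}[x]scale1r -scalerDl mulrDl divff// gt_eqF.
  rewrite zetaZ exprMn -enorm_sq enormZ xr exprMn -normrX ger0_norm ?sqr_ge0//.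
  by rewrite -[X in g X]exprMn divfK ?gt_eqF// /f exprMn.
rewrite /radial_derivative.
have -> : (fun t => complex.Re (u (x + t *: unit_vec x) - u x) / t)
    = fun t => complex.Re (f t - f 0) / t.
  by apply/funext => t; rewrite uf -(uf 0) scale0r addr0.
have -> : (fun t => complex.Im (u (x + t *: unit_vec x) - u x) / t)
    = fun t => complex.Im (f t - f 0) / t.
  by apply/funext => t; rewrite uf -(uf 0) scale0r addr0.
apply: has_cder_radial_cvg => //.
have d1 : is_derive (0 : R) 1 (fun t => (r + t) ^+ 2) (2 * r).
  apply: is_derive_eq; rewrite /= ?addr0 add0r ?expr1 /GRing.scale /=; ring.
have d2 : is_derive (0 : R) 1 (fun t => (r + t) / r) r^-1.
  apply: is_derive_eq; rewrite /= ?addr0 add0r ?expr1 /GRing.scale /=; ring.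
have D1 := has_cder_comp1 d1 (dg (t := (r + 0) ^+ 2) _).
have D2 := cdiffX l (has_cder_real d2).
have D3 : has_cder (fun t => ((r + t) / r)%:C ^+ l) 0 (l%:R / r%:C).
  apply: cdiff_ext D2 => h; rewrite addr0 divff ?gt_eqF// expr1n mulr1 fmorphV; ring.
rewrite addr0 in D1; apply: has_cder_eq (has_cderM (D1 Sr) (has_cderM D3 (has_cder_cst _ _))) _.
by rewrite addr0 divff ?gt_eqF// !expr1n rmorphM rmorph_nat; ring.
Qed.

End Radial.
End Space.

(** * Spherical Hankel functions *)

Section Hankel.
Variable R : realType.
Implicit Types (z : R[i]) (t : R).

(* [h_l z = e^(iz) z^(-l-1) hpoly l z] *)
Fixpoint hpoly l z : R[i] :=
  match l with
  | 0 => - 'i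
  | l1.+1 => match l1 with
    | 0 => - z - 'i
    | l2.+1 => (2 * l2 + 3)%:R * hpoly l1 z - z ^+ 2 * hpoly l2 z
    end
  end.

Lemma hpolySS l z :
  hpoly l.+2 z = (2 * l + 3)%:R * hpoly l.+1 z - z ^+ 2 * hpoly l z.
Proof. by []. Qed.

(* [(l + k)! / (2^k k! (l - k)!)], with the value 0 when [l < k] *)
Definition hcoef (l k : nat) : R := 'C(l + k, 2 * k)%:R * ((2 * k)`!%:R / (2 ^+ k * k`!%:R)).

Lemma hcoefE l k : (k <= l)%N ->
  hcoef l k = (l + k)`!%:R / (2 ^+ k * k`!%:R * (l - k)`!%:R).
Proof.
move=> kl; have kl2 : (2 * k <= l + k)%N by lia.
rewrite /hcoef -(bin_fact kl2) (_ : (l + k - 2 * k = l - k)%N); last by lia.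
rewrite !natrM; field.
by rewrite !fact_neq0 expf_neq0// pnatr_eq0.
Qed.

Lemma hcoef0 l : hcoef l 0 = 1.
Proof. by rewrite /hcoef muln0 bin0 expr0 fact0; field. Qed.

Lemma hcoef_gt l k : (l < k)%N -> hcoef l k = 0.
Proof. by move=> lk; rewrite /hcoef bin_small ?mul0r//; lia. Qed.

(** Once the ratio of factorials is removed, this is an integer identity: Pascal's rule twice, then
    [(m+1) C(N, m+1) = (N-m) C(N, m)] with [N = l + k + 1] and [m = 2k]. *)
Lemma hcoef_rec l k :
  hcoef l.+2 k.+1 = (2 * l + 3)%:R * hcoef l.+1 k + hcoef l k.+1.
Proof.
rewrite /hcoef (_ : (l.+2 + k.+1 = (l + k).+3)%N); last by lia.
rewrite (_ : (l.+1 + k = (l + k).+1)%N); last by lia.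
rewrite (_ : (l + k.+1 = (l + k).+1)%N); last by lia.
rewrite (_ : (2 * k.+1 = (2 * k).+2)%N); last by lia.
set N := (l + k).+1; set m := (2 * k)%N.
have E : (m.+1 * 'C(N.+2, m.+2) = (2 * l + 3) * 'C(N, m) + m.+1 * 'C(N, m.+2))%N.
  have B n j : 'C(n.+2, j.+2) = ('C(n, j.+2) + 2 * 'C(n, j.+1) + 'C(n, j))%N.
    by rewrite !binS; lia.
  have := mul_bin_left N m; rewrite B.
  have [kl|kl] := leqP k l.+1; last by rewrite [in 'C(N, m)]bin_small /N /m; nia.
  have -> : (N - m = l.+1 - k)%N by rewrite /N /m; lia.
  move: 'C(N, m) 'C(N, m.+1) 'C(N, m.+2) => b a c; rewrite mulnBl => h.
  have {}h : (m.+1 * a + k * b = l.+1 * b)%N by rewrite h subnK// leq_mul2r kl orbT.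
  by rewrite /m in h *; nia.
have {}E : m.+1%:R * 'C(N.+2, m.+2)%:R =
    (2 * l + 3)%:R * 'C(N, m)%:R + m.+1%:R * 'C(N, m.+2)%:R :> R.
  by rewrite -!natrM -natrD E.
have -> : (m.+2)`!%:R / (2 ^+ k.+1 * (k.+1)`!%:R) = m.+1%:R * (m`!%:R / (2 ^+ k * k`!%:R)) :> R.
  have mE : m.+2%:R = 2 * k.+1%:R :> R by rewrite -natrM /m; congr (_%:R); lia.
  rewrite !factS !natrM mE exprS; field.
  by rewrite fact_neq0 expf_neq0 ?pnatr_eq0//= addrC natr1 pnatr_eq0.
set d := _ / _; rewrite mulrA [_ * m.+1%:R]mulrC E; ring.
Qed.

Lemma i_neq0 : 'i != 0 :> R[i].
Proof. by rewrite eq_complex /= oner_eq0 andbF. Qed.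

Lemma hankel_sumE l z : z != 0 ->
  \sum_(k < l.+1) ('i ^+ k / 'i ^+ l.+1) *
    ((l + k)`!%:R / (2 ^+ k * k`!%:R * (l - k)`!%:R)) / z ^+ k.+1 =
  hpoly l z / z ^+ l.+1.
Proof.
move=> z0; have i0 := i_neq0.
have i2 : 'i ^+ 2 = -1 :> R[i] := sqr_i R.
pose T l n := \sum_(k < n) ('i ^+ k / 'i ^+ l.+1) * (hcoef l k)%:C / z ^+ k.+1.
have -> : \sum_(k < l.+1) ('i ^+ k / 'i ^+ l.+1) *
    ((l + k)`!%:R / (2 ^+ k * k`!%:R * (l - k)`!%:R)) / z ^+ k.+1 = T l l.+1.
  apply: eq_bigr => k _; rewrite hcoefE ?leq_ord//.
  by rewrite !(rmorphM, fmorphV, rmorphXn, rmorph_nat).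
(* Since [hcoef] vanishes beyond the diagonal, sums may be lengthened freely; this aligns the three
   sums of the recurrence, which have different lengths. *)
have Tn m n : (m < n)%N -> T m n = T m m.+1.
  elim: n => [//|n IH]; rewrite ltnS leq_eqVlt => /predU1P[->//|mn].
  by rewrite {1}/T big_ord_recr /= -/(T m n) IH// hcoef_gt// mulr0 mul0r addr0.
have Trec m n : T m.+2 n.+1 = (2 * m + 3)%:R / z * T m.+1 n - T m n.+1.
  have e1 : 'i ^+ m.+1 = - ('i * 'i ^+ m.+2) :> R[i].
    by rewrite -exprS -addn2 exprD i2 mulrN1 opprK.
  have M0 : 'i ^+ m.+2 != 0 :> R[i] by rewrite expf_neq0.
  rewrite /T e1 (exprS _ m.+2); elim: n => [|n IH].
    rewrite !big_ord_recl !big_ord0 !hcoef0 /= !expr0 !expr1.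
    by field; rewrite z0 i0 M0.
  have key : (hcoef m.+2 n.+1)%:C =
      (2 * m + 3)%:R * (hcoef m.+1 n)%:C + (hcoef m n.+1)%:C :> R[i].
    by rewrite -(rmorph_nat (real_complex R)) -rmorphM -rmorphD hcoef_rec.
  rewrite [in LHS]big_ord_recr /= IH [X in _ = _ * X - _]big_ord_recr /=.
  rewrite [X in _ = _ - X]big_ord_recr /= key !(exprS _ n.+1) !(exprS _ n).
  field; by rewrite z0 i0 M0 expf_neq0.
suff [//] : T l l.+1 = hpoly l z / z ^+ l.+1 /\ T l.+1 l.+2 = hpoly l.+1 z / z ^+ l.+2.
elim: l => [|l [IH1 IH2]].
  have iV : 'i^-1 = - 'i :> R[i].
    by apply: (mulfI i0); rewrite divff// mulrN -expr2 i2 opprK.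
  have h11 : hcoef 1 1 = 1.
    rewrite /hcoef binn mul1r expr1 (_ : (2 * 1)`! = 2)%N// (_ : 1`! = 1)%N//.
    by rewrite mulr1 divff// pnatr_eq0.
  rewrite /T !big_ord_recr !big_ord0 /= !hcoef0 h11 i2 !expr0 !expr1 iV.
  by split; field; rewrite z0.
have e3 : T l l.+3 = T l l.+1 by apply: Tn; lia.
split=> //; rewrite Trec IH2 e3 IH1 hpolySS !exprS; field.
by rewrite z0 expf_neq0.
Qed.

Lemma sph_hankel1E l z : z != 0 ->
  sph_hankel1 l z = cexp ('i * z) * hpoly l z / z ^+ l.+1.
Proof. by move=> z0; rewrite /sph_hankel1 hankel_sumE// mulrA. Qed.

Lemma sph_hankel1_0 l : sph_hankel1 l (0 : R[i]) = 0.
Proof.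
by rewrite /sph_hankel1 big1 ?mulr0// => k _; rewrite expr0n invr0 mulr0.
Qed.

Lemma cexp_neq0 z : cexp z != 0.
Proof.
rewrite /cexp mulf_eq0 negb_or fmorph_eq0 gt_eqF ?expR_gt0//=.
by rewrite -cmod_eq0 /cmod /= cos2Dsin2 sqrtr1 oner_eq0.
Qed.

(** For real [x] the recurrence has real coefficients: its middle terms cancel in the antisymmetric
    combination, and each step multiplies it by [x^2], starting from [2 i x]. *)
Lemma hpoly_wronskian l (x : R) :
  hpoly l x%:C * conjc (hpoly l.+1 x%:C) - conjc (hpoly l x%:C) * hpoly l.+1 x%:C
   = 2 * 'i * x%:C ^+ (2 * l).+1.
Proof.
elim: l => [|l IH].
  by apply/eqP; rewrite eq_complex /=; apply/andP; split; apply/eqP; ring.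
have -> : conjc (hpoly l.+2 x%:C) =
    (2 * l + 3)%:R * conjc (hpoly l.+1 x%:C) - x%:C ^+ 2 * conjc (hpoly l x%:C).
  rewrite hpolySS rmorphB /=; congr (_ - _); rewrite rmorphM.
    by rewrite rmorph_nat.
  have c2 : conjc (x%:C ^+ 2) = x%:C ^+ 2.
    by rewrite -(rmorphXn (real_complex R)); exact: conjc_real.
  by rewrite -[in RHS]c2.
rewrite hpolySS (_ : (2 * l.+1).+1 = (2 * l).+1 + 2)%N; last by lia.
move: IH; rewrite exprD mulrA => <-; ring.
Qed.

(** Two consecutive zeros would propagate down the recurrence, since [z^2] is invertible, to the
    nonzero constant [hpoly 0]. *)
Lemma hpoly_neq0 l z : z != 0 -> hpoly l z = 0 -> hpoly l.+1 z != 0.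
Proof.
move=> z0; elim: l => [/eqP|l IH h].
  by rewrite oppr_eq0 (negPf i_neq0).
apply/negP => /eqP; rewrite hpolySS h mulr0 sub0r => /eqP.
rewrite oppr_eq0 mulf_eq0 expf_eq0 (negPf z0) /= => /eqP h0.
by have := IH h0; rewrite h eqxx.
Qed.

(* [hrad l k (r ^ 2) = k ^ l h_l(k r) r ^ (-l)] *)
Definition hrad l (k : R[i]) t : R[i] :=
  cexp ('i * k * (Num.sqrt t)%:C) * hpoly l (k * (Num.sqrt t)%:C)
  / (k * (Num.sqrt t)%:C ^+ (2 * l).+1).

Definition invsqrt t : R[i] := ((Num.sqrt t)^-1)%:C.

Lemma has_cder_invsqrt t : 0 < t -> has_cder invsqrt t (- (invsqrt t ^+ 3 / 2)).
Proof.
move=> t0; have s0 : 0 < Num.sqrt t by rewrite sqrtr_gt0.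
have d : is_derive t 1 (fun s => (Num.sqrt s)^-1) (- (((Num.sqrt t)^-1) ^+ 3 / 2)).
  apply: is_derive_eq (is_deriveV (f := @Num.sqrt R) (lt0r_neq0 s0) (is_derive1_sqrt t0)) _.
  by rewrite /GRing.scale /=; field; rewrite gt_eqF.
apply: has_cder_eq (has_cder_real d) _.
by rewrite /invsqrt rmorphN rmorphM rmorphXn !fmorphV rmorph_nat.
Qed.

Lemma has_cder_invsqrtX n t : 0 < t ->
  has_cder (fun s => invsqrt s ^+ n) t (- (n%:R / 2 * invsqrt t ^+ n.+2)).
Proof.
move=> t0; apply: cdiff_ext (cdiffX n (has_cder_invsqrt t0)) => h.
by case: n => [|n]; rewrite ?mul0r ?oppr0 ?mulr0//= !exprS; ring.
Qed.

(** Stated for all [t] and [k], with inverses of 0 equal to 0, because it is used as an equality of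
    functions under a derivative. *)
Lemma hrad_rec l (k : R[i]) t :
  hrad l.+2 k t = ((2 * l + 3)%:R * hrad l.+1 k t - k ^+ 2 * hrad l k t) * invsqrt t ^+ 2.
Proof.
rewrite /hrad /invsqrt; case: (eqVneq (Num.sqrt t) 0) => [->|s0].
  by rewrite invr0 rmorph0 (expr0n _ 2) mulr0 exprS mul0r !mulr0 invr0 mulr0.
case: (eqVneq k 0) => [->|k0]; first by rewrite !mul0r invr0 !mulr0 subr0 mul0r.
have c0 : (Num.sqrt t)%:C != 0 by rewrite fmorph_eq0.
rewrite hpolySS fmorphV (_ : (2 * l.+1).+1 = (2 * l).+3)%N; last by lia.
rewrite (_ : (2 * l.+2).+1 = (2 * l).+1.+4)%N; last by lia.
by rewrite !exprS; field; rewrite k0 c0 expf_neq0.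
Qed.

Lemma hrad_rec0 l (k : R[i]) t : 0 < t ->
  t%:C * hrad l.+2 k t - (2 * l + 3)%:R * hrad l.+1 k t + k ^+ 2 * hrad l k t = 0.
Proof.
move=> t0; rewrite hrad_rec.
have -> : invsqrt t ^+ 2 = t%:C^-1 by rewrite /invsqrt -rmorphXn exprVn sqr_sqrtr ?ltW// fmorphV.
by field; rewrite fmorph_eq0 gt_eqF.
Qed.

(** The same ladder as for [phi]. Two consecutive orders are carried along: differentiating the
    recurrence for order [l + 2] uses the derivatives of orders [l] and [l + 1], the explicit orders
    0 and 1 being the base. *)
Lemma has_cder_hrad l (k : R[i]) t : k != 0 -> 0 < t ->
  has_cder (hrad l k) t (- (hrad l.+1 k t / 2)).
Proof.
move=> k0 t0; have s0 : 0 < Num.sqrt t by rewrite sqrtr_gt0.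
have c0 : (Num.sqrt t)%:C != 0 by rewrite fmorph_eq0 gt_eqF.
have dJ n := has_cder_invsqrtX n t0.
suff [//] : has_cder (hrad l k) t (- (hrad l.+1 k t / 2)) /\
            has_cder (hrad l.+1 k) t (- (hrad l.+2 k t / 2)).
elim: l => [|l [IH1 IH2]]; last first.
  split=> //; rewrite (funext (hrad_rec l k)).
  have := has_cderM (has_cderD (has_cderZ (2 * l + 3)%:R IH2) (has_cderZ (- k ^+ 2) IH1)) (dJ 2).
  under eq_fun do rewrite mulNr.
  move/has_cder_eq; apply; rewrite (hrad_rec l.+1).
  rewrite !hrad_rec natrD natrM natrD natrM -[l.+1%:R]natr1; field; exact: c0.
have dE : has_cder (fun s => cexp ('i * k * (Num.sqrt s)%:C)) t
    ('i * k * cexp ('i * k * (Num.sqrt t)%:C) * invsqrt t / 2).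
  apply: has_cder_eq (has_cder_comp1 (is_derive1_sqrt t0) (has_cder_cexp _ _)) _.
  by rewrite /invsqrt invfM rmorphM fmorphV rmorph_nat; ring.
have h0 s : hrad 0 k s = cexp ('i * k * (Num.sqrt s)%:C) * (- 'i / k * invsqrt s ^+ 1).
  by rewrite /hrad /invsqrt /= fmorphV /= !expr1 invfM; ring.
have h1 s : hrad 1 k s = cexp ('i * k * (Num.sqrt s)%:C) *
    ((- 1) * invsqrt s ^+ 2 + (- 'i / k) * invsqrt s ^+ 3).
  case: (eqVneq (Num.sqrt s) 0) => [e|q0].
    by rewrite /hrad /invsqrt e invr0 rmorph0 !expr0n /= !mulr0 invr0 addr0 !mulr0.
  have q1 : (Num.sqrt s)%:C != 0 by rewrite fmorph_eq0.
  by rewrite /hrad /invsqrt fmorphV /=; field; rewrite k0 q1.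
have ii : 'i * 'i = -1 :> R[i] by rewrite -expr2 sqr_i.
split.
  rewrite (funext h0); apply: has_cder_eq (has_cderM dE (has_cderZ _ (dJ 1%N))) _.
  rewrite h1; move: (cexp _) (invsqrt t) => E j.
  transitivity (E * ('i / k * (j ^+ 3 / 2)) - ('i * 'i) * (E * j ^+ 2 / 2)).
    by field.
  by rewrite ii; field.
rewrite (funext h1).
apply: has_cder_eq (has_cderM dE (has_cderD (has_cderZ _ (dJ 2)) (has_cderZ _ (dJ 3)))) _.
rewrite hrad_rec h0 h1; move: (cexp _) (invsqrt t) => E j.
transitivity (E * (j ^+ 4 + 'i / k * (3 / 2 * j ^+ 5) - 'i * k * j ^+ 3 / 2)
  - ('i * 'i) * (E * j ^+ 4 / 2)); first by field.
by rewrite ii; field.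
Qed.

End Hankel.

(** * Characteristic equation of a mode *)

Section Modes.
Variable R : realType.
Local Notation V := 'rV[R]_3.
Implicit Types (x : V).

(* [sph_harm l l x = sect l (x_0 + i x_1)^l] *)
Definition sect (l : nat) : R :=
  (-1) ^+ l * Num.sqrt ((2 * l + 1)%:R / (4 * pi) * ((l - l)`!%:R / (l + l)`!%:R))
  * ((2 ^+ l * l`!%:R)^-1 * (2 * l)`!%:R).

Lemma sect_neq0 l : sect l != 0.
Proof.
rewrite /sect !mulf_neq0 ?invr_neq0 ?mulf_neq0 ?fact_neq0 ?expf_neq0 ?oppr_eq0 ?oner_eq0 ?pnatr_eq0//.
rewrite lt0r_neq0// sqrtr_gt0 !(mulr_gt0, invr_gt0)// ?pi_gt0 ?ltr0n ?fact_gt0//.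
Qed.

(** For [m = l] Rodrigues' formula takes [2 l] derivatives of a monic polynomial of degree [2 l], so
    the Legendre factor is the constant [(2l)!] up to normalisation. *)
Lemma sph_harm_zeta l x : sph_harm l (Posz l) x = (sect l)%:C * zeta x ^+ l.
Proof.
rewrite /sph_harm /sph_harm_pos /zeta /sect; congr (_%:C * _); congr (_ * _).
rewrite /legendre derivnZ hornerZ; congr (_ * _).
rewrite /derivn -iterD -/(derivn _ _) addnn -mul2n.
set P := (_ ^+ l); set n := (2 * l)%N.
have Pm : P \is monic by apply: monic_exp; exact: monicXnsubC.
have sP : size P = n.+1.
  have P0 : (0 < size P)%N by rewrite size_poly_gt0 monic_neq0.
  rewrite -(prednK P0) size_exp (_ : 'X^2 - 1 = 'X^2 - 1%:P); last by [].
  by rewrite size_XnsubC.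
rewrite (_ : P^`(n) = (n`!%:R)%:P) ?hornerC//.
apply/polyP => i; rewrite coef_derivn coefC; case: i => [|i].
  rewrite addn0 ffactnn /=; move: Pm; rewrite monicE /lead_coef sP /= => /eqP ->.
  by [].
by rewrite [P`_ _]nth_default ?mul0rn// sP addnS ltnS leq_addr.
Qed.

Lemma unit_vecZ x (a : R) : 0 < a -> unit_vec (a *: unit_vec x) = unit_vec x.
Proof.
move=> a0; case: (eqVneq x 0) => [->|x0].
  by rewrite /unit_vec !scaler0.
have e0 : 0 < enorm x by rewrite enorm_gt0.
have e1 : enorm (unit_vec x) = 1.
  by rewrite /unit_vec enormZ ger0_norm ?invr_ge0 ?ltW// mulVf// gt_eqF.
rewrite {1}/unit_vec enormZ e1 mulr1 ger0_norm ?ltW// scalerA mulVf ?gt_eqF//.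
by rewrite scale1r.
Qed.

Lemma zeta_unit_vec x l : zeta (unit_vec x) ^+ l = invsqrt (sq x) ^+ l * zeta x ^+ l.
Proof. by rewrite /unit_vec zetaZ exprMn. Qed.

Lemma zeta0 : zeta (0 : V) = 0.
Proof. by rewrite /zeta !mxE. Qed.

Lemma exterior_field l (k : R[i]) x : k != 0 ->
  sph_hankel1 l (k * (enorm x)%:C) * zeta (unit_vec x) ^+ l =
  hrad l k (sq x) / k ^+ l * zeta x ^+ l.
Proof.
move=> k0; rewrite zeta_unit_vec /hrad /invsqrt -/(enorm x).
(* At the origin both sides are 0 by the convention on inverses; the identity thus holds on the
   whole space and can be used as an equality of functions. *)
case: (eqVneq (enorm x) 0) => [->|e0].
  rewrite -[0%:C]/(0 : R[i]) mulr0 sph_hankel1_0 mul0r.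
  by rewrite [k * 0 ^+ _](_ : _ = 0) ?invr0 ?mulr0 ?mul0r// exprS mul0r mulr0.
have c0 : (enorm x)%:C != 0 by rewrite fmorph_eq0.
rewrite sph_hankel1E ?mulf_neq0// fmorphV /= (mulrA 'i k).
rewrite (_ : (2 * l).+1 = l + l.+1)%N; last by lia.
rewrite exprD exprVn exprMn !(exprS _ l); field.
by rewrite k0 c0 !expf_neq0.
Qed.

Lemma interior_field l (k : R[i]) x :
  sph_bessel l (k * (enorm x)%:C) * zeta (unit_vec x) ^+ l =
  k ^+ l * phi l (k ^+ 2 * (sq x)%:C) * zeta x ^+ l.
Proof.
have sE : (enorm x)%:C ^+ 2 = (sq x)%:C :> R[i].
  by rewrite -(rmorphXn (real_complex R)) enorm_sq.
rewrite sph_besselE [(_ * _) ^+ 2]exprMn sE zeta_unit_vec /invsqrt -/(enorm x).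
case: (eqVneq (enorm x) 0) => [e0|e0].
  have -> : x = 0 by apply/eqP; rewrite -[_ == _]negbK -enorm_gt0 e0 ltxx.
  rewrite zeta0 !exprMn; case: l => [|l]; last by rewrite !(exprS _ l) !(mul0r, mulr0).
  by rewrite !expr0 !mulr1.
have c0 : (enorm x)%:C != 0 by rewrite fmorph_eq0.
by rewrite fmorphV /= exprMn exprVn; field; rewrite expf_neq0.
Qed.

Lemma outgoing_mode l (R0 : R) (k A : R[i]) :
  outgoing R0 k (fun x => A * sph_hankel1 l (k * (enorm x)%:C)
                          * sph_harm l (Posz l) (unit_vec x)).
Proof.
exists (fun l' m' => if (l' == l) && (m' == Posz l) then A else 0) => r eps _ e0.
exists l.+1 => n ln x _.
rewrite (bigD1 (Ordinal ln))//= [X in _ - (_ + X)]big1 ?addr0; last first.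
  move=> i il; rewrite big1// => j _.
  by rewrite (negPf (_ : val i != l)) ?mul0r//; apply: contraNneq il => h; apply/eqP/val_inj.
(* The inner index is [j = m + l], so [m = l] is the last one, [j = 2 l]. *)
have l2 : (2 * l < (2 * l).+1)%N by [].
rewrite (bigD1 (Ordinal l2))//= [X in _ - (_ + X)]big1 ?addr0; last first.
  move=> j jl; rewrite eqxx /= (negPf (_ : j%:Z - l%:Z != l%:Z)) ?mul0r//.
  by apply: contraNneq jl => h; apply/eqP/val_inj => /=; lia.
rewrite (_ : (2 * l)%N%:Z - l%:Z = Posz l); last by lia.
by rewrite !eqxx /= subrr cmod0 ltW.
Qed.

(** Serves nontriviality: it provides interior points where [u_g] does not vanish. On the unit disc
    the variation of [phi l] is at most [3/2 expR 1 |s|], whence the choice of [d]. *)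
Lemma phi_neq0_near l : exists2 d : R, 0 < d & forall s, cmod s <= d -> phi l s != 0.
Proof.
pose e := cmod (phi l 0 : R[i]); have e0 : 0 < e by rewrite cmod_gt0 phi0_neq0.
have E0 : 0 < expR 1 :> R := expR_gt0 _.
pose d := Num.min 1 (e / (4 * expR 1)).
have d0 : 0 < d by rewrite lt_min ltr01 divr_gt0// mulr_gt0.
exists d => // s sd.
have s1 : cmod s <= 1 by apply: le_trans sd _; rewrite ge_min lexx.
have s2 : cmod s * (4 * expR 1) <= e.
  by rewrite -ler_pdivlMr ?mulr_gt0//; apply: le_trans sd _; rewrite ge_min lexx orbT.
have z1 : cmod (0 : R[i]) <= 1 by rewrite cmod0.
have h := phi_taylor l s1 z1; rewrite subr0 in h.
have h2 := phi_le l.+1 z1.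
apply/negP => /eqP p0; rewrite p0 sub0r in h.
have := cmodB (phi l.+1 0 / 2 * s) (- phi l 0 + phi l.+1 0 / 2 * s).
rewrite opprD opprK addrCA subrr addr0 -/e !cmodM cmodV cmod_nat.
by have := cmod_ge0 s; nra.
Qed.

(** * From a root of the characteristic equation to a classical solution *)

Section Characteristic.
Variables (R0 sigma rho_l rho_g K_l K_g : R) (l : nat) (w : R[i]).
Hypotheses (R0_gt0 : 0 < R0) (rho_l_gt0 : 0 < rho_l) (rho_g_gt0 : 0 < rho_g)
  (c_l_gt0 : 0 < sound_speed K_l rho_l) (c_g_gt0 : 0 < sound_speed K_g rho_g)
  (w0 : w != 0).

Local Notation k_l := (wavenumber w K_l rho_l).
Local Notation k_g := (wavenumber w K_g rho_g).
Local Notation r := (R0%:C : R[i]).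

Definition hpoly1 z : R[i] := l%:R * hpoly l z - hpoly l.+1 z.
Definition phi1 (s : R[i]) : R[i] := l%:R * phi l s - s * phi l.+1 s.

(* The determinant of the linear system satisfied by the amplitudes of
   [u_l], [u_g] and the interface, for the mode [l]. *)
Definition char_eq : Prop :=
  w ^+ 2 * r * (rho_l%:C * hpoly l (k_l * r) * phi1 ((k_g * r) ^+ 2)
                - rho_g%:C * phi l ((k_g * r) ^+ 2) * hpoly1 (k_l * r))
  + sigma%:C * (l%:R * (l.+1)%:R - 2) / r ^+ 2
    * hpoly1 (k_l * r) * phi1 ((k_g * r) ^+ 2) = 0.

(** The amplitudes are rescaled so that on the sphere [u_l], [u_g] and the interface are [a hpoly],
    [c phi] and [e] times one common angular factor. The three equations are the two kinematic
    conditions and the pressure jump; [c != 0] ensures nontriviality. *)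
Lemma mode_resonance (a c e : R[i]) : c != 0 ->
  a * hpoly1 (k_l * r) / r = rho_l%:C * w ^+ 2 * e ->
  c * phi1 ((k_g * r) ^+ 2) / r = rho_g%:C * w ^+ 2 * e ->
  a * hpoly l (k_l * r) - c * phi l ((k_g * r) ^+ 2) =
    sigma%:C * (2 - l%:R * (l.+1)%:R) / r ^+ 2 * e ->
  resonance_in_mode R0 sigma rho_l rho_g K_l K_g l w.
Proof.
have nE1 : ((2 * l).+1 = l + l.+1)%N by lia.
have nE2 : ((2 * l.+1).+1 = l.+2 + l.+1)%N by lia.
have n46 : (4 * l + 6)%:R = 2 * (2 * l + 3)%:R :> R[i].
  by rewrite -natrM; congr (_%:R); lia.
have n23 : (2 * l + 3)%:R = 2 * l%:R + 3 :> R[i] by rewrite natrD natrM.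
move=> c0 e1 e2 e3; split=> //.
have r0 : r != 0 by rewrite fmorph_eq0 gt_eqF.
have kl0 : k_l != 0 by rewrite mulf_neq0// invr_eq0 fmorph_eq0 gt_eqF.
have kg0 : k_g != 0 by rewrite mulf_neq0// invr_eq0 fmorph_eq0 gt_eqF.
pose E := cexp ('i * k_l * r); have E0 : E != 0 := cexp_neq0 _.
pose n : R[i] := (sect l)%:C; have n0 : n != 0 by rewrite fmorph_eq0 sect_neq0.
pose A := a * k_l ^+ l.+1 * r ^+ l.+1 / E; pose C := c / (k_g ^+ l * r ^+ l).
exists (Posz l), A, C, e; split=> // u_l u_g eta.
(* The index [j] counts derivatives in [t = |x|^2]: by the ladder each one raises the order and
   multiplies by [-1/2], respectively [-k_g^2/2]. *)
pose gl j t := (- 2^-1) ^+ j * (A * n / k_l ^+ l * hrad (l + j) k_l t).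
pose gg j t := (- (k_g ^+ 2 / 2)) ^+ j * (C * n * k_g ^+ l * phi (l + j) (k_g ^+ 2 * t%:C)).
have u_lE : u_l = fun x => gl 0 (sq x) * zeta x ^+ l.
  apply/funext => x; rewrite /u_l /gl sph_harm_zeta -/n expr0 addn0.
  by rewrite [n * _]mulrC mulrA -[A * _ * _]mulrA exterior_field//; ring.
have u_gE : u_g = fun x => gg 0 (sq x) * zeta x ^+ l.
  apply/funext => x; rewrite /u_g /gg sph_harm_zeta -/n expr0 addn0.
  by rewrite [n * _]mulrC mulrA -[C * _ * _]mulrA interior_field//; ring.
(* Being constant along rays, the extension has radial profile [t^(-l/2)]; its first three
   derivatives follow. *)
pose ge0 t := e * n * invsqrt t ^+ l.
pose ge1 t := e * n * (- (l%:R / 2 * invsqrt t ^+ l.+2)).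
pose ge2 t := e * n * ((l%:R / 2) * (l.+2%:R / 2 * invsqrt t ^+ l.+4)).
pose ge3 t := e * n * (- ((l%:R / 2) * (l.+2%:R / 2) * (l.+4%:R / 2 * invsqrt t ^+ l.+4.+2))).
have etaE : sphere_ext R0 eta = fun x => ge0 (sq x) * zeta x ^+ l.
  apply/funext => x; rewrite /sphere_ext /eta unit_vecZ// sph_harm_zeta zeta_unit_vec.
  by rewrite /ge0 -/n; ring.
pose S := [set t : R | 0 < t]; have oS : open S by exact: open_gt.
have dgl j t : S t -> has_cder (gl j) t (gl j.+1 t).
  move=> t0; apply: has_cder_eq.
    by apply: has_cderZ; apply: has_cderZ; exact: has_cder_hrad.
  by rewrite /gl addnS (exprS _ j); ring.
have dgg j t : setT t -> has_cder (gg j) t (gg j.+1 t).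
  move=> _; apply: has_cder_eq.
    by apply: has_cderZ; apply: has_cderZ; exact: has_cder_phi.
  by rewrite /gg addnS (exprS _ j); ring.
have dge0 t : S t -> has_cder ge0 t (ge1 t).
  by move=> t0; apply: has_cderZ; exact: has_cder_invsqrtX.
have dge1 t : S t -> has_cder ge1 t (ge2 t).
  move=> t0; apply: has_cder_eq.
    rewrite /ge1; under eq_fun do rewrite -mulNr.
    by apply: has_cderZ; apply: has_cderZ; exact: has_cder_invsqrtX.
  by rewrite /ge2; ring.
have dge2 t : S t -> has_cder ge2 t (ge3 t).
  move=> t0; apply: has_cder_eq.
    rewrite /ge2; under eq_fun do rewrite (mulrA (l%:R / 2)).
    by apply: has_cderZ; apply: has_cderZ; exact: has_cder_invsqrtX.
  by rewrite /ge3; ring.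
have out x : R0 < enorm x -> S (sq x).
  by move=> h; rewrite /S /= sq_gt0 -enorm_gt0 (lt_trans R0_gt0).
have sphE x : enorm x = R0 -> sq x = R0 ^+ 2 by move=> <-; rewrite enorm_sq.
have sR0 : Num.sqrt (R0 ^+ 2) = R0 by rewrite sqrtr_sqr gtr0_norm.
have hR j : hrad j k_l (R0 ^+ 2) = E * hpoly j (k_l * r) / (k_l * r ^+ (2 * j).+1).
  by rewrite /hrad sR0.
have JR : invsqrt (R0 ^+ 2) = r^-1 by rewrite /invsqrt sR0 fmorphV.
have glS : gl 0 (R0 ^+ 2) = a * n * hpoly l (k_l * r) / r ^+ l.
  rewrite /gl expr0 addn0 hR /A nE1.
  by rewrite exprD !(exprS _ l); field; rewrite E0 r0 kl0 !expf_neq0.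
have gl1S : gl 1 (R0 ^+ 2) = - (a * n * hpoly l.+1 (k_l * r) / r ^+ l.+2 / 2).
  rewrite /gl expr1 addn1 hR /A nE2.
  by rewrite exprD !(exprS _ l.+1) !(exprS _ l); field; rewrite E0 r0 kl0 !expf_neq0.
have kgr : k_g ^+ 2 * (R0 ^+ 2)%:C = (k_g * r) ^+ 2.
  by rewrite [(k_g * r) ^+ 2]exprMn rmorphXn.
have ggS : gg 0 (R0 ^+ 2) = c * n * phi l ((k_g * r) ^+ 2) / r ^+ l.
  by rewrite /gg expr0 addn0 kgr /C; field; rewrite !expf_neq0.
have gg1S : gg 1 (R0 ^+ 2) = - (k_g ^+ 2 / 2 * (c * n * phi l.+1 ((k_g * r) ^+ 2) / r ^+ l)).
  by rewrite /gg expr1 addn1 kgr /C; field; rewrite !expf_neq0.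
have etaS x : enorm x = R0 -> eta x = e * n * zeta x ^+ l / r ^+ l.
  move=> xR; rewrite /eta sph_harm_zeta zeta_unit_vec (sphE x)// JR exprVn -/n.
  by field; rewrite expf_neq0.
split; last first.
  have [d d0 hd] := phi_neq0_near l.
  pose q := cmod (k_g ^+ 2); have q0 : 0 <= q := cmod_ge0 _.
  (* A point at distance [t] from the origin lies in the ball, and [t <= 1] with [t (q + 1) <= d]
     gives [|k_g^2 t^2| <= d]. *)
  pose t := Num.min 1 (Num.min (R0 / 2) (d / (q + 1))).
  have t0 : 0 < t by rewrite !lt_min ltr01 !divr_gt0// ltr_pwDr.
  have t1 : t <= 1 by rewrite ge_min lexx.
  have t2 : t < R0.
    apply: (@le_lt_trans _ _ (R0 / 2)); last by rewrite ltr_pdivrMr// ltr_pMr// ltr1n.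
    by rewrite !ge_min lexx orbT.
  have t3 : t * (q + 1) <= d.
    by rewrite -ler_pdivlMr ?ltr_pwDr// !ge_min lexx !orbT.
  pose x := t *: basis_vec R (inord 0).
  have b1 : enorm (basis_vec R (inord 0) : V) = 1.
    rewrite /enorm (bigD1 (inord 0))//= basis_vecE eqxx expr1n big1 ?addr0 ?sqrtr1//.
    by move=> i /negPf h; rewrite basis_vecE h expr0n.
  have xt : enorm x = t by rewrite /x enormZ b1 mulr1 gtr0_norm.
  have zx : zeta x = t%:C.
    rewrite /x zetaZ (_ : zeta _ = 1) ?mulr1// /zeta !basis_vecE eqxx.
    by rewrite -val_eqE /= !inordK.
  apply: Or32; exists x; first by rewrite xt.
  have kgl : k_g ^+ l != 0 := expf_neq0 l kg0.
  have C0 : C != 0 := mulf_neq0 c0 (invr_neq0 (mulf_neq0 kgl (expf_neq0 l r0))).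
  have tC : t%:C != 0 by rewrite fmorph_eq0 gt_eqF.
  have p0 : phi l (k_g ^+ 2 * (sq x)%:C) != 0.
    apply: hd; rewrite cmodM -/q cmod_real -enorm_sq xt ger0_norm ?sqr_ge0//.
    by nra.
  have h := mulf_neq0 (mulf_neq0 (mulf_neq0 (mulf_neq0 C0 n0) kgl) p0) (expf_neq0 l tC).
  by rewrite u_gE /gg expr0 mul1r addn0 zx.
split; [split| | | |].
- by rewrite u_lE; apply: (radial_C2 l oS (dgl 0%N) (dgl 1%N) (dgl 2)); exact: out.
- rewrite u_lE; apply: (radial_continuous l (dgl 0%N)) => x /= h.
  by rewrite /S /= sq_gt0 -enorm_gt0 (lt_le_trans R0_gt0).
- by rewrite u_gE; apply: (radial_C2 l openT (dgg 0%N) (dgg 1%N) (dgg 2)).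
- by rewrite u_gE; apply: (radial_continuous l (dgg 0%N)).
- by rewrite etaE; apply: (radial_C2 l oS dge0 dge1 dge2) => x /=; rewrite /S /= sq_gt0.
- move=> x /out Sx; rewrite u_lE (radial_laplacian l oS (dgl 0%N) (dgl 1%N))//.
  have := hrad_rec0 l k_l Sx; rewrite /gl !addn0 addn1 addn2 => H.
  rewrite -[RHS](mul0r (A * n / k_l ^+ l * zeta x ^+ l)) -H.
  rewrite n46; move: (2 * l + 3)%:R => N; field; exact: expf_neq0.
- move=> x _; rewrite u_gE (radial_laplacian l openT (dgg 0%N) (dgg 1%N))//.
  have := phi_rec l (k_g ^+ 2 * (sq x)%:C); rewrite /gg !addn0 addn1 addn2 => H.
  rewrite -[RHS](mul0r (k_g ^+ 2 * (C * n * k_g ^+ l * zeta x ^+ l))) -H.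
  by rewrite n46; move: (2 * l + 3)%:R => N; field.
- move=> x xR; split.
    exists ((2 * r * gl 1 (R0 ^+ 2) + l%:R / r * gl 0 (R0 ^+ 2)) * zeta x ^+ l).
    exists ((2 * r * gg 1 (R0 ^+ 2) + l%:R / r * gg 0 (R0 ^+ 2)) * zeta x ^+ l).
    split.
    + rewrite u_lE; apply: (radial_radial_derivative l (dgl 0%N)) => //.
        by apply: within_subset => t; rewrite /= => ?; rewrite gt_eqF.
      by rewrite /S /= exprn_gt0.
    + rewrite u_gE; apply: (radial_radial_derivative l (dgg 0%N)) => //.
      by apply: within_subset => t; rewrite /= => ?; rewrite lt_eqF.
    + rewrite etaS// gl1S glS.
      have H : w ^+ 2 * (e * n * zeta x ^+ l / r ^+ l) =
         (rho_l%:C * w ^+ 2 * e) * (n * zeta x ^+ l / r ^+ l) / rho_l%:C.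
        by field; rewrite expf_neq0//= fmorph_eq0 gt_eqF.
      rewrite H -e1 /hpoly1 !(exprS _ l.+1) !(exprS _ l); field.
      by rewrite r0 expf_neq0//= fmorph_eq0 gt_eqF.
    + rewrite etaS// gg1S ggS.
      have H : w ^+ 2 * (e * n * zeta x ^+ l / r ^+ l) =
         (rho_g%:C * w ^+ 2 * e) * (n * zeta x ^+ l / r ^+ l) / rho_g%:C.
        by field; rewrite expf_neq0//= fmorph_eq0 gt_eqF.
      rewrite H -e2 /phi1; move: ((k_g * r) ^+ 2) (exprMn 2 k_g r) => s ->; field.
      by rewrite r0 expf_neq0//= fmorph_eq0 gt_eqF.
  (* On the profile [t^(-l/2)] the Laplacian produces the factor [l(l+2) - l(2l+3) = -l(l+1)], the
     eigenvalue on the unit sphere. *)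
  rewrite /laplace_beltrami etaE (radial_laplacian l oS dge0 dge1); last first.
    by rewrite /S /= sq_gt0 -enorm_gt0 xR.
  rewrite etaS// u_lE u_gE !(sphE x)// glS ggS /ge1 /ge2 JR.
  rewrite -mulrBl.
  have -> : a * n * hpoly l (k_l * r) / r ^+ l - c * n * phi l ((k_g * r) ^+ 2) / r ^+ l =
    (a * hpoly l (k_l * r) - c * phi l ((k_g * r) ^+ 2)) * (n / r ^+ l).
    by field; rewrite expf_neq0.
  rewrite e3 n46 n23 !rmorphM !fmorphV !rmorphXn !rmorph_nat /=.
  rewrite -[l.+2%:R]natr1 -[l.+1%:R]natr1 !(exprS _ l.+3) !(exprS _ l.+2) !(exprS _ l.+1) !(exprS _ l) !exprVn; field.
  by rewrite r0 expf_neq0.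
- exact: outgoing_mode.
Qed.

(** For [q != 0] the null vector comes from the minors of the system, with [e = q g]. For [q = 0]
    that vector may vanish; but then [p != 0], as consecutive [hpoly] share no nonzero zero, the
    equation forces [g = 0], and [(f, p, 0)] is a solution with the interface at rest. *)
Lemma char_eq_resonance : char_eq ->
  resonance_in_mode R0 sigma rho_l rho_g K_l K_g l w.
Proof.
have r0 : r != 0 by rewrite fmorph_eq0 gt_eqF.
have kl0 : k_l != 0 by rewrite mulf_neq0// invr_eq0 fmorph_eq0 gt_eqF.
have pl0 : rho_l%:C != 0 :> R[i] by rewrite fmorph_eq0 gt_eqF.
have pg0 : rho_g%:C != 0 :> R[i] by rewrite fmorph_eq0 gt_eqF.
rewrite /char_eq; set p := hpoly l _; set q := hpoly1 _; set f := phi l _; set g := phi1 _.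
move=> H; case: (eqVneq q 0) => [q0|q0].
  have p0 : p != 0.
    apply/eqP => p0; have := @hpoly_neq0 _ l _ (mulf_neq0 kl0 r0) p0.
    by move: q0; rewrite /q /hpoly1 -/p p0 mulr0 sub0r => /eqP; rewrite oppr_eq0 => ->.
  have g0 : g = 0.
    have H2 : (w ^+ 2 * r * rho_l%:C * p) * g = 0 by rewrite -[RHS]H q0; ring.
    move/eqP: H2; rewrite mulf_eq0 [X in X || _](negPf _); first by move/eqP.
    by rewrite !mulf_neq0// expf_neq0.
  apply: (@mode_resonance f p 0) => //; rewrite -/p -/q -/f -/g ?q0 ?g0.
  - by rewrite !(mulr0, mul0r).
  - by rewrite !(mulr0, mul0r).
  - by rewrite mulr0 mulrC subrr.
apply: (@mode_resonance (rho_l%:C * w ^+ 2 * r * g) (rho_g%:C * w ^+ 2 * r * q) (q * g)).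
- by rewrite !mulf_neq0// expf_neq0.
- by rewrite -/q; field.
- by rewrite -/g; field.
- rewrite -/p -/f; apply/eqP; rewrite -subr_eq0 -H; apply/eqP; field.
  by rewrite r0.
Qed.

End Characteristic.
End Modes.

(** * Lipschitz and Taylor estimates, simple zeros of [j_l'] *)

Section Lipschitz.
Variable R : realType.
Implicit Types (f g : R[i] -> R[i]) (r b d : R) (u v z : R[i]).

(** Size and Lipschitz constant are kept apart because the rescaling [z -> m z] leaves the first
    bounded and multiplies the second by [|m|], the small parameter of the regimes (a) and (b). *)
Definition lip r b d f := forall u v, cmod u <= r -> cmod v <= r ->
  cmod (f u) <= b /\ cmod (f u - f v) <= d * cmod (u - v).

Definition loclip f := forall r, exists2 b, 0 <= b & lip r b b f.

Lemma lip_le r b d b' d' f : b <= b' -> d <= d' -> lip r b d f -> lip r b' d' f.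
Proof.
move=> bb dd hf u v ur vr; have [h1 h2] := hf u v ur vr; split.
  exact: le_trans h1 bb.
by apply: le_trans h2 _; rewrite ler_wpM2r ?cmod_ge0.
Qed.

Lemma lipD r b d b' d' f g : lip r b d f -> lip r b' d' g ->
  lip r (b + b') (d + d') (fun z => f z + g z).
Proof.
move=> hf hg u v ur vr; have [f1 f2] := hf u v ur vr; have [g1 g2] := hg u v ur vr.
split; first by apply: le_trans (cmodD _ _) _; exact: lerD.
by rewrite opprD addrACA mulrDl; apply: le_trans (cmodD _ _) _; exact: lerD.
Qed.

Lemma lipM r b d b' d' f g : lip r b d f -> lip r b' d' g ->
  lip r (b * b') (b * d' + b' * d) (fun z => f z * g z).
Proof.
move=> hf hg u v ur vr; have [f1 f2] := hf u v ur vr; have [g1 g2] := hg u v ur vr.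
have [h1 _] := hg v v vr vr; have [k1 _] := hf v v vr vr.
split; first by rewrite cmodM; apply: ler_pM => //; exact: cmod_ge0.
rewrite (_ : _ - _ = f u * (g u - g v) + g v * (f u - f v)); last by ring.
apply: le_trans (cmodD _ _) _; rewrite !cmodM mulrDl -!mulrA.
by apply: lerD; apply: ler_pM => //; exact: cmod_ge0.
Qed.

Lemma lipZ r b d c f : lip r b d f -> lip r (cmod c * b) (cmod c * d) (fun z => c * f z).
Proof.
move=> hf u v ur vr; have [f1 f2] := hf u v ur vr; split.
  by rewrite cmodM ler_wpM2l ?cmod_ge0.
by rewrite -mulrBr cmodM -mulrA ler_wpM2l ?cmod_ge0.
Qed.

Lemma lip_scale r b d t f (m : R[i]) : 0 <= d -> cmod m * t <= r -> lip r b d f ->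
  lip t b (d * cmod m) (fun z => f (m * z)).
Proof.
move=> d0 mr hf u v ut vt; have bd x : cmod x <= t -> cmod (m * x) <= r.
  by move=> xt; rewrite cmodM; apply: le_trans mr; rewrite ler_wpM2l ?cmod_ge0.
by have := hf _ _ (bd _ ut) (bd _ vt); rewrite -mulrBr cmodM mulrA.
Qed.

Lemma loclip_cst c : loclip (fun=> c).
Proof.
move=> r; exists (cmod c) => [|u v _ _]; first exact: cmod_ge0.
by rewrite subrr cmod0 mulr_ge0 ?cmod_ge0.
Qed.

Lemma loclip_id : loclip id.
Proof.
move=> r; exists (Num.max r 1) => [|u v ur _]; first by rewrite le_max ler01 orbT.
by rewrite le_max ur ler_peMl ?cmod_ge0// le_max lexx orbT.
Qed.

Lemma loclipD f g : loclip f -> loclip g -> loclip (fun z => f z + g z).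
Proof.
move=> hf hg r; have [b b0 fb] := hf r; have [c c0 gc] := hg r.
by exists (b + c); [exact: addr_ge0|exact: lipD].
Qed.

Lemma loclipM f g : loclip f -> loclip g -> loclip (fun z => f z * g z).
Proof.
move=> hf hg r; have [b b0 fb] := hf r; have [c c0 gc] := hg r.
exists (b * c + c * b); first by rewrite addr_ge0// mulr_ge0.
apply: lip_le (lipM fb gc) => //.
by rewrite lerDl mulr_ge0.
Qed.

Lemma loclipZ c f : loclip f -> loclip (fun z => c * f z).
Proof. exact/loclipM/loclip_cst. Qed.

Lemma loclipN f : loclip f -> loclip (fun z => - f z).
Proof.
move=> hf r; have [b b0 fb] := hf r; exists b => // u v ur vr.
have [h1 h2] := fb _ _ ur vr; split; first by rewrite cmodN.
by rewrite -opprD cmodN.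
Qed.

Lemma loclipB f g : loclip f -> loclip g -> loclip (fun z => f z - g z).
Proof. by move=> hf /loclipN; exact: loclipD. Qed.

Lemma loclip_sq f : loclip f -> loclip (fun z => f (z ^+ 2)).
Proof.
move=> hf r; have [b b0 fb] := hf (r ^+ 2).
exists (b * (2 * `|r| + 1)) => [|u v ur vr]; first by rewrite mulr_ge0// addr_ge0// mulr_ge0.
have bd x : cmod x <= r -> cmod (x ^+ 2) <= r ^+ 2.
  move=> xr; rewrite cmodX lerXn2r// nnegrE ?cmod_ge0//.
  exact: le_trans (cmod_ge0 _) xr.
have [h1 h2] := fb _ _ (bd _ ur) (bd _ vr); split.
  by apply: le_trans h1 _; rewrite ler_peMr// lerDr mulr_ge0.
apply: le_trans h2 _; rewrite subr_sqr cmodM -mulrA ler_wpM2l// mulrC ler_wpM2r ?cmod_ge0//.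
have := cmodD u v; have := ler_norm r; lra.
Qed.

Lemma loclip_phi l : loclip (phi l : R[i] -> R[i]).
Proof.
move=> r; exists (expR r * (2 * `|r| + 1)) => [|u v ur vr].
  by rewrite mulr_ge0 ?expR_ge0// addr_ge0// mulr_ge0.
have e0 := expR_gt0 r; have r0 := normr_ge0 r.
split; first by apply: le_trans (phi_le l ur) _; nra.
have h := phi_taylor l ur vr; have h1 := phi_le l.+1 vr.
have := cmodB (phi l u - phi l v + phi l.+1 v / 2 * (u - v)) (phi l.+1 v / 2 * (u - v)).
rewrite addrK !cmodM cmodV cmod_nat => H.
have uv := cmodB u v; have rr := ler_norm r; have d0 := cmod_ge0 (u - v).
have h2 : cmod (phi l.+1 v) / 2 * cmod (u - v) <= expR r / 2 * cmod (u - v).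
  by rewrite ler_wpM2r// ler_wpM2r.
have h3 : expR r * cmod (u - v) ^+ 2 <= expR r * (2 * `|r|) * cmod (u - v).
  rewrite expr2 mulrA ler_wpM2r// ler_wpM2l ?(ltW e0)//; lra.
have := mulr_ge0 (ltW e0) d0; lra.
Qed.

Lemma loclip_hpoly l : loclip (hpoly l : R[i] -> R[i]).
Proof.
suff [//] : loclip (hpoly l : R[i] -> R[i]) /\ loclip (hpoly l.+1 : R[i] -> R[i]).
elim: l => [|l [IH1 IH2]].
  split; first exact: loclip_cst.
  apply: loclipB; last exact: loclip_cst.
  exact/loclipN/loclip_id.
split=> //; apply: loclipB; first exact: loclipZ.
by apply: loclipM => //; exact: (loclip_sq loclip_id).
Qed.

Lemma loclip_hpoly1 l : loclip (hpoly1 l : R[i] -> R[i]).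
Proof. by apply: loclipB; [apply: loclipZ|]; exact: loclip_hpoly. Qed.

Lemma loclip_phi1 l : loclip (phi1 l : R[i] -> R[i]).
Proof.
apply: loclipB; first by apply: loclipZ; exact: loclip_phi.
by apply: loclipM; [exact: loclip_id|exact: loclip_phi].
Qed.

Lemma loclip_scale f : loclip f -> exists2 b, 0 <= b &
  forall (m : R[i]) d, cmod m <= d -> d <= 1 -> lip 2 b (b * d) (fun z => f (m * z)).
Proof.
move=> /(_ 2) [b b0 fb]; exists b => // m d md d1.
have m2 : cmod m * 2 <= 2 by rewrite ler_piMl// (le_trans md).
by apply: lip_le (lip_scale b0 m2 fb) => //; rewrite ler_wpM2l.
Qed.

(* [v = s] solves the unperturbed equation [v^2 = 1]. *)
Lemma quad_root (X Y : R[i] -> R[i]) (b d : R) (s : R[i]) :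
  s ^+ 2 = 1 -> cmod s = 1 -> d <= 1 / 100 ->
  lip 2 b d X -> lip 2 b d Y -> cmod (X 0 - 1) <= d -> cmod (Y 0 - 1) <= d ->
  exists v, cmod (v - s) <= 6 * d /\ v ^+ 2 * X v = Y v.
Proof.
move=> s2 cs d1 hX hY X0 Y0.
have d0 : 0 <= d := le_trans (cmod_ge0 _) X0.
have ss : s * s = 1 by rewrite -expr2.
have z2 : cmod (0 : R[i]) <= 2 by rewrite cmod0.
have near1 Z v : lip 2 b d Z -> cmod (Z 0 - 1) <= d -> cmod v <= 2 -> cmod (Z v - 1) <= 3 * d.
  move=> hZ Z0 v2; have [_ h] := hZ _ _ v2 z2; rewrite subr0 in h.
  have := cmodD (Z v - Z 0) (Z 0 - 1); rewrite addrA subrK.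
  by have := cmod_ge0 v; nra.
(* As [s^2 = 1], the factor [s / 2] is the inverse of the derivative [2 s] of [v^2] at [s], so [F]
   is close to a translation there. *)
pose F v := s * (v ^+ 2 * X v - Y v) / 2.
have FsE : F s = s * ((X s - 1) - (Y s - 1)) / 2 by rewrite /F s2; ring.
have s22 : cmod s <= 2 by rewrite cs; lra.
have Fs : cmod (F s) <= 3 * d.
  rewrite FsE !cmodM cs cmodV cmod_nat mul1r.
  have := cmodB (X s - 1) (Y s - 1).
  by have := near1 _ _ hX X0 s22; have := near1 _ _ hY Y0 s22; lra.
have [u v us vs| |v [vs Fv]] := @zero_near R F s (1 / 4).
- have bd x : cmod (x - s) <= 1 / 4 -> cmod x <= 5 / 4.
    by move=> h; have := cmodD (x - s) s; rewrite subrK cs; lra.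
  have u2 : cmod u <= 2 by have := bd u us; lra.
  have v2 : cmod v <= 2 by have := bd v vs; lra.
  rewrite (_ : F u - F v - (u - v) = (u - v) * (s * (u + v) / 2 * (X u - 1)
       + s * ((u - s) + (v - s)) / 2)
     + s / 2 * (v ^+ 2 * (X u - X v) - (Y u - Y v))); last first.
    transitivity ((u - v) * (s * (u + v) / 2 * (X u - 1) + s * (u + v) / 2 - s * s)
     + s / 2 * (v ^+ 2 * (X u - X v) - (Y u - Y v))); last by field.
    by rewrite /F ss; field.
  apply: le_trans (cmodD _ _) _; rewrite !cmodM cs cmodV cmod_nat.
  have [_ hx] := hX _ _ u2 v2; have [_ hy] := hY _ _ u2 v2.
  have a1 : cmod (s * (u + v) / 2 * (X u - 1) + s * ((u - s) + (v - s)) / 2) <=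
     5 / 4 * (3 * d) + 1 / 4.
    apply: le_trans (cmodD _ _) _; rewrite !cmodM cs cmodV cmod_nat !mul1r.
    apply: lerD; last by have := cmodD (u - s) (v - s); lra.
    apply: ler_pM; rewrite ?mulr_ge0 ?cmod_ge0//; last exact: near1.
    by have := cmodD u v; have := bd u us; have := bd v vs; lra.
  have a2 : cmod (v ^+ 2 * (X u - X v) - (Y u - Y v)) <= 3 * d * cmod (u - v).
    apply: le_trans (cmodB _ _) _; rewrite cmodM cmodX.
    have v25 : cmod v ^+ 2 <= 25 / 16.
      by have := bd v vs; have := cmod_ge0 v; rewrite expr2; nra.
    have := ler_pM (sqr_ge0 _) (cmod_ge0 _) v25 hx.
    by have := mulr_ge0 d0 (cmod_ge0 (u - v)); lra.
  have := ler_wpM2l (cmod_ge0 (u - v)) a1.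
  by have := cmod_ge0 (u - v); nra.
- by lra.
exists v; split; first by lra.
apply/eqP; rewrite -subr_eq0; apply/eqP.
have s0 : s != 0 by rewrite -cmod_eq0 cs oner_eq0.
by move/eqP: Fv; rewrite /F !mulf_eq0 (negPf s0) invr_eq0 pnatr_eq0 orbF /= => /eqP.
Qed.

(** A quantitative substitute for holomorphy: a quadratic remainder, uniform on discs, is what the
    Newton contraction requires near a simple zero. *)
Definition tayl f f' := [/\ loclip f, loclip f' & forall r, exists2 b, 0 <= b &
  forall u v, cmod u <= r -> cmod v <= r ->
    cmod (f u - f v - f' v * (u - v)) <= b * cmod (u - v) ^+ 2].

Lemma taylM f f' g g' : tayl f f' -> tayl g g' ->
  tayl (fun z => f z * g z) (fun z => f z * g' z + g z * f' z).
Proof.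
move=> [f1 f2 f3] [g1 g2 g3]; split; first exact: loclipM.
  by apply: loclipD; exact: loclipM.
move=> r; have [a a0 fa] := f1 r; have [b b0 gb] := g1 r; have [c c0 gc] := g2 r.
have [d d0 fd] := f3 r; have [e e0 ge] := g3 r.
exists (a * e + a * c + b * d); first by rewrite !addr_ge0// mulr_ge0.
move=> u v ur vr; have [fu fuv] := fa _ _ ur vr; have [gv _] := gb _ _ vr vr.
have [cv _] := gc _ _ vr vr.
rewrite (_ : _ - _ = f u * (g u - g v - g' v * (u - v))
  + (f u - f v) * g' v * (u - v) + g v * (f u - f v - f' v * (u - v))); last by ring.
apply: le_trans (cmodD _ _) _; rewrite [X in _ <= X]mulrDl; apply: lerD.
  rewrite [X in _ <= X]mulrDl.
  apply: le_trans (cmodD _ _) _; rewrite !cmodM; apply: lerD.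
    by rewrite -mulrA; apply: ler_pM; rewrite ?cmod_ge0//; exact: ge.
  have h := ler_pM (cmod_ge0 _) (cmod_ge0 _) fuv cv.
  apply: le_trans (ler_wpM2r (cmod_ge0 (u - v)) h) _.
  by rewrite le_eqVlt; apply/orP; left; apply/eqP; ring.
by rewrite cmodM -mulrA; apply: ler_pM; rewrite ?cmod_ge0//; exact: fd.
Qed.

Lemma tayl_lin f f' g g' (a b : R[i]) : tayl f f' -> tayl g g' ->
  tayl (fun z => a * f z + b * g z) (fun z => a * f' z + b * g' z).
Proof.
move=> [f1 f2 f3] [g1 g2 g3].
split; [by apply: loclipD; exact: loclipZ|by apply: loclipD; exact: loclipZ|].
move=> r; have [d d0 fd] := f3 r; have [e e0 ge] := g3 r.
exists (cmod a * d + cmod b * e); first by rewrite addr_ge0// mulr_ge0// cmod_ge0.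
move=> u v ur vr.
rewrite (_ : _ - _ = a * (f u - f v - f' v * (u - v)) + b * (g u - g v - g' v * (u - v)));
  last by ring.
apply: le_trans (cmodD _ _) _; rewrite !cmodM mulrDl -!mulrA.
by apply: lerD; rewrite ler_wpM2l ?cmod_ge0//; [exact: fd|exact: ge].
Qed.

Lemma tayl_sq : tayl (fun z => z ^+ 2) (fun z => 2 * z).
Proof.
split; [exact: (loclip_sq loclip_id)|exact: (loclipZ _ loclip_id)|].
move=> r; exists 1 => // u v _ _; rewrite mul1r -cmodX (_ : _ - _ = (u - v) ^+ 2)//.
by ring.
Qed.

Lemma tayl_phi_sq l : tayl (fun z => phi l (z ^+ 2)) (fun z => - z * phi l.+1 (z ^+ 2)).
Proof.
split; first by apply: loclip_sq; exact: loclip_phi.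
  apply: loclipM; first exact/loclipN/loclip_id.
  exact/loclip_sq/loclip_phi.
move=> r; have e0 := expR_ge0 (r ^+ 2).
exists (expR (r ^+ 2) * (2 * r) ^+ 2 + expR (r ^+ 2) / 2).
  by apply: addr_ge0; apply: mulr_ge0; rewrite ?sqr_ge0 ?invr_ge0.
move=> u v ur vr; have r0 : 0 <= r := le_trans (cmod_ge0 _) ur.
have bd x : cmod x <= r -> cmod (x ^+ 2) <= r ^+ 2.
  by move=> xr; rewrite cmodX lerXn2r// nnegrE ?cmod_ge0.
have h := phi_taylor l (bd _ ur) (bd _ vr); have p := phi_le l.+1 (bd _ vr).
have E (x y z : R[i]) : x - y - - v * z * (u - v) =
    x - y + z / 2 * (u ^+ 2 - v ^+ 2) - z / 2 * (u - v) ^+ 2 by field.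
rewrite E.
apply: le_trans (cmodB _ _) _; rewrite mulrDl; apply: lerD.
  apply: le_trans h _; rewrite -mulrA ler_wpM2l// subr_sqr cmodM exprMn mulrC.
  rewrite ler_wpM2r ?sqr_ge0// lerXn2r// ?nnegrE ?cmod_ge0// ?mulr_ge0//.
  by have := cmodD u v; lra.
by rewrite cmodM cmodX cmodM cmodV cmod_nat ler_wpM2r ?sqr_ge0// ler_wpM2r.
Qed.

(** The recurrence eliminates [phi l.+2], leaving a derivative in the same two functions as [phi1]
    itself; simplicity of a zero becomes a question about two linear forms in them. *)
Lemma tayl_phi1_sq l : tayl (fun z => phi1 l (z ^+ 2))
  (fun z => z * ((l.+1)%:R * phi l.+1 (z ^+ 2) - phi l (z ^+ 2))).
Proof.
have := tayl_lin l%:R (-1) (tayl_phi_sq l) (taylM tayl_sq (tayl_phi_sq l.+1)).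
congr tayl; apply/funext => z; first by rewrite /phi1 mulN1r.
have E : z ^+ 2 * phi l.+2 (z ^+ 2) = (2 * l + 3)%:R * phi l.+1 (z ^+ 2) - phi l (z ^+ 2).
  by apply/eqP; rewrite -subr_eq0 -(phi_rec l (z ^+ 2)); apply/eqP; ring.
transitivity (l%:R * (- z * phi l.+1 (z ^+ 2)) - 2 * z * phi l.+1 (z ^+ 2)
   + z * (z ^+ 2 * phi l.+2 (z ^+ 2))); first by ring.
by rewrite E natrD natrM -natr1; ring.
Qed.

End Lipschitz.

(** * Simplicity of the nonzero real zeros of [j_l'] *)

Lemma MVT_nondecreasing (R : realType) (f df : R -> R) (x y : R) : x <= y ->
  (forall t : R, is_derive t 1 f (df t)) -> (forall t : R, x <= t <= y -> 0 <= df t) -> f x <= f y.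
Proof.
move=> xy dfE df0; have [|c] := @MVT_segment R f df x y xy (fun t _ => dfE t).
  apply: continuous_subspaceT => t; apply: differentiable_continuous.
  by apply/derivable1_diffP; case: (dfE t).
rewrite in_itv /= => cxy fyx.
by rewrite -subr_ge0 fyx mulr_ge0 ?subr_ge0// df0.
Qed.

Lemma is_derive_expr (R : realType) n (x : R) :
  is_derive x 1 (fun y : R => y ^+ n.+1) (n.+1%:R * x ^+ n).
Proof.
apply: DeriveDef; first exact: exprn_derivable.
by rewrite exp_derive /GRing.scale /= mulr1.
Qed.

Definition phi_sq (R : realType) m (x : R) : R := complex.Re (phi m (x ^+ 2)%:C).

(* [x j_l'(x) = x ^ l psi_sq l x] *)
Definition psi_sq (R : realType) m (x : R) : R :=
  m%:R * phi_sq m x - x ^+ 2 * phi_sq m.+1 x.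

Section SimpleZeros.
Variable R : realType.
Variable l : nat.
Hypothesis l_gt0 : (0 < l)%N.
Implicit Types x : R.

Local Notation a := (@phi_sq R l).
Local Notation b := (@phi_sq R l.+1).
Local Notation psi := (@psi_sq R l).

Lemma phi_sq_rec x : x ^+ 2 * phi_sq l.+2 x = (2 * l + 3)%:R * b x - a x.
Proof.
have : complex.Re ((x ^+ 2)%:C * phi l.+2 (x ^+ 2)%:C
    - (2 * l + 3)%:R * phi l.+1 (x ^+ 2)%:C + phi l (x ^+ 2)%:C) = 0 by rewrite phi_rec.
rewrite -(rmorph_nat (real_complex R)) !(cReD, cReN, cReM).
rewrite !(cRe_real (x ^+ 2)) !(cIm_real (x ^+ 2)).
rewrite (cRe_real (2 * l + 3)%:R).
by rewrite !mul0r !subr0 -/(phi_sq l x) -/(phi_sq l.+1 x) -/(phi_sq l.+2 x) => h; lra.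
Qed.

Lemma is_derive_phi_sq m x :
  is_derive x 1 (@phi_sq R m) (- (x * phi_sq m.+1 x)).
Proof.
have [h _] := has_cder_is_derive (has_cder_phi m 1 (x ^+ 2)).
have d := is_derive_expr 1 x.
have E : @phi_sq R m =
  (fun s => complex.Re (phi m (1 * s%:C))) \o (fun y : R => y ^+ 2).
  by apply/funext => y; rewrite /phi_sq /= mul1r.
have D := @is_derive1_comp R (fun s => complex.Re (phi m (1 * s%:C)))
  (fun y : R => y ^+ 2) x _ _ h d.
rewrite E; apply: is_derive_eq D _.
have -> : - (1 / 2) = (- 2^-1 : R)%:C :> R[i] by rewrite rmorphN fmorphV rmorph_nat mul1r.
by rewrite cReM cRe_real cIm_real !mul1r mul0r subr0 -/(phi_sq _ x); field.
Qed.

Lemma is_derive_a x : is_derive x 1 a (- (x * b x)).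
Proof. exact: is_derive_phi_sq. Qed.

Lemma is_derive_psi x : is_derive x 1 psi (x * (l.+1%:R * b x - a x)).
Proof.
have db := is_derive_phi_sq l.+1 x.
have -> : psi = (l%:R \*: a - ((fun y : R => y ^+ 2) * b)%R)%R by [].
have d2 := is_derive_expr 1 x.
apply: is_derive_eq (is_deriveB (is_deriveZ _ (is_derive_a x)) (is_deriveM d2 db)) _.
rewrite /GRing.scale /=; have := phi_sq_rec x; rewrite natrD natrM -[l.+1%:R]natr1.
set c := phi_sq l.+2 x => E.
transitivity (l%:R * - (x * b x) + x * (x ^+ 2 * c) - 2 * x * b x); first by ring.
by rewrite E; ring.
Qed.

Definition bessel_flux x : R := x ^+ (2 * l).+1 * (a x * psi x).

(** With [y = j_l] and [L = l(l+1)], Bessel's equation [(x^2 y')' = (L - x^2) y] gives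
    [(x^2 y y')' = x^2 y'^2 + (L - x^2) y^2]. *)
Lemma is_derive_flux x :
  is_derive x 1 bessel_flux (x ^+ (2 * l) * (psi x ^+ 2 + (l%:R * l.+1%:R - x ^+ 2) * a x ^+ 2)).
Proof.
have dX := is_derive_expr (2 * l) x.
have -> : bessel_flux = ((fun y : R => y ^+ (2 * l).+1) * (a * psi))%R by [].
apply: is_derive_eq (is_deriveM dX (is_deriveM (is_derive_a x) (is_derive_psi x))) _.
rewrite /GRing.scale /= exprS -[(2 * l).+1%:R]natr1 natrM -[l.+1%:R]natr1 /psi_sq.
by rewrite !fctE /psi_sq; ring.
Qed.

(** In terms of [y = j_l] and [L = l(l+1)] this is [(x^2 y')^2 + x^2 (x^2 - L) y^2], obtained by
    multiplying Bessel's equation by [2 x^2 y']. Its derivative [(4 x^3 - 2 L x) y^2] is nonnegative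
    for [x > 0] with [x^2 >= L / 2]. *)
Definition bessel_energy x : R := x ^+ (2 * l).+2 * (psi x ^+ 2 + (x ^+ 2 - l%:R * l.+1%:R) * a x ^+ 2).

Lemma is_derive_energy x :
  is_derive x 1 bessel_energy (x ^+ (2 * l).+1 * (4 * x ^+ 2 - 2 * (l%:R * l.+1%:R)) * a x ^+ 2).
Proof.
have dX n := is_derive_expr n x.
have -> : bessel_energy = ((fun y : R => y ^+ (2 * l).+2) *
   (psi * psi + ((fun y : R => y ^+ 2) - cst (l%:R * l.+1%:R)) * (a * a)))%R.
  by apply/funext => y; rewrite /bessel_energy !fctE -!expr2.
have da := is_derive_a x; have dp := is_derive_psi x.
apply: is_derive_eq (is_deriveM (dX _) (is_deriveD (is_deriveM dp dp)
  (is_deriveM (is_deriveB (dX 1%N) (is_derive_cst _ _ _)) (is_deriveM da da)))) _.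
rewrite /GRing.scale /= !fctE !(exprS _ (2 * l).+1) !(exprS _ (2 * l)) -[(2 * l).+2%:R]natr1 -[(2 * l).+1%:R]natr1 natrM -[l.+1%:R]natr1.
by rewrite /psi_sq; ring.
Qed.

(* [bessel_flux x = x^2 j_l(x) j_l'(x)] is nondecreasing up to [sqrt (l (l + 1))]. *)
Lemma flux_gt0 x : 0 < x -> x ^+ 2 <= l%:R * l.+1%:R -> 0 < bessel_flux x.
Proof.
move=> x0 xl.
have c : {for 0, continuous (fun y => a y * psi y)}.
  have d := is_deriveM (is_derive_a 0) (is_derive_psi 0).
  by apply: differentiable_continuous; apply/derivable1_diffP; case: d.
(* The flux itself is 0 at 0, so its sign is taken from the factor without the power of [x], which
   equals [l phi_l(0)^2] there and is positive because [l > 0]. *)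
have p0 : 0 < a 0 * psi 0.
  rewrite /psi_sq expr0n /= mul0r subr0.
  have a0 : 0 < a 0 by rewrite /phi_sq expr0n; exact: phi0_gt0.
  by rewrite mulr_gt0// mulr_gt0// ltr0n.
have nr : \forall y \near (0 : R)^'+, 0 < a y * psi y.
  apply: (cvgr_gt (a 0 * psi 0)) => //; apply: cvg_at_right_filter; exact: c.
near (0 : R)^'+ => y.
have y0 : 0 < y by near: y; exact: nbhs_right_gt.
have yx : y <= x by near: y; exact: nbhs_right_le.
have gy : 0 < bessel_flux y.
  have nry : 0 < a y * psi y by near: y; exact: nr.
  exact: mulr_gt0 (exprn_gt0 _ y0) nry.
apply: lt_le_trans gy _; apply: (MVT_nondecreasing yx is_derive_flux) => t /andP[yt tx].
have t0 : 0 <= t := le_trans (ltW y0) yt.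
rewrite mulr_ge0 ?exprn_ge0// addr_ge0 ?sqr_ge0// mulr_ge0 ?sqr_ge0// subr_ge0.
by apply: le_trans xl; rewrite lerXn2r// nnegrE ltW.
Unshelve. all: by end_near. Qed.

(* Beyond [sqrt (l (l + 1))] a double zero of [psi] would also be a zero of [j_l], where
   [bessel_energy] vanishes; but [bessel_energy] is nondecreasing there. *)
Lemma psi_simple_zero x : 0 < x -> psi x = 0 -> l.+1%:R * b x - a x != 0.
Proof.
move=> x0 px; apply/eqP => dx.
have [xl|xl] := leP (x ^+ 2) (l%:R * l.+1%:R).
  by have := flux_gt0 x0 xl; rewrite /bessel_flux px !mulr0 ltxx.
(* The two vanishing conditions are linear in [a x] and [b x], with determinant [l(l+1) - x^2],
   nonzero in this case. *)
have ax : a x = 0.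
  have : (x ^+ 2 - l%:R * l.+1%:R) * a x = 0.
    have : x ^+ 2 * (l.+1%:R * b x - a x) + l.+1%:R * psi x = 0 by rewrite dx px !mulr0 addr0.
    by rewrite /psi_sq => h; lra.
  by move/eqP; rewrite mulf_eq0 subr_eq0 gt_eqF//= => /eqP.
(* At [y] the second term of the energy drops out and [flux_gt0] still applies, so [psi y != 0] and
   the energy is positive. *)
pose y := Num.sqrt (l%:R * l.+1%:R : R).
have L0 : 0 < l%:R * l.+1%:R :> R by rewrite mulr_gt0// ltr0n.
have y0 : 0 < y by rewrite sqrtr_gt0.
have y2 : y ^+ 2 = l%:R * l.+1%:R by rewrite sqr_sqrtr// ltW.
have yx : y <= x by rewrite -y2 in xl; nra.
have : bessel_energy y <= bessel_energy x.
  apply: (MVT_nondecreasing yx is_derive_energy) => t /andP[yt tx].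
  have t0 : 0 <= t := le_trans (ltW y0) yt.
  rewrite mulr_ge0 ?sqr_ge0// mulr_ge0 ?exprn_ge0//.
  have : y ^+ 2 <= t ^+ 2 by rewrite lerXn2r// nnegrE ltW.
  by rewrite y2; lra.
rewrite /bessel_energy px ax y2 subrr mul0r !expr0n /= !mulr0 !addr0 mulr0.
apply/negP; rewrite -ltNge; apply: mulr_gt0; first exact: exprn_gt0.
rewrite lt_neqAle sqr_ge0 andbT eq_sym sqrf_eq0.
have := flux_gt0 y0; rewrite y2 lexx => /(_ isT); apply: contraTneq.
by rewrite /bessel_flux => ->; rewrite !mulr0 ltxx.
Qed.

Lemma phi_real_sq m x : phi m (x%:C ^+ 2) = (phi_sq m x)%:C.
Proof.
rewrite /phi_sq -(rmorphXn (real_complex R)) /=; have := phi_real m (x ^+ 2).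
by case: (phi m _) => p q /= ->.
Qed.

Lemma phi1_real_sq x : phi1 l (x%:C ^+ 2) = (psi x)%:C.
Proof.
rewrite /phi1 !phi_real_sq /psi_sq rmorphB; congr (_ - _); rewrite rmorphM.
  by rewrite rmorph_nat.
by rewrite rmorphXn.
Qed.

Lemma phi1_simple_zero x : x != 0 -> phi1 l (x%:C ^+ 2) = 0 ->
  l.+1%:R * phi l.+1 (x%:C ^+ 2) - phi l (x%:C ^+ 2) != 0.
Proof.
wlog x0 : x / 0 < x => [h xn|].
  have [x0|x0] := ltP 0 x; first exact: h.
  have E : x%:C ^+ 2 = (- x)%:C ^+ 2 by rewrite rmorphN sqrrN.
  by rewrite E; apply: h; rewrite ?oppr_eq0// oppr_gt0 lt_neqAle xn.
move=> _; rewrite phi1_real_sq !phi_real_sq => /eqP; rewrite fmorph_eq0 => /eqP p.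
rewrite -(rmorph_nat (real_complex R)) -rmorphM -rmorphB fmorph_eq0.
exact: psi_simple_zero.
Qed.

Lemma sph_bessel_derivE x : x != 0 ->
  sph_bessel_deriv l x = x%:C ^+ l * phi1 l (x%:C ^+ 2) / x%:C.
Proof.
move=> x0; have xC : x%:C != 0 by rewrite fmorph_eq0.
have d2 := is_derive_expr 1 x.
have dphi := has_cder_comp1 d2 (has_cder_phi l 1 (x ^+ 2)).
have dX := cdiffX l (has_cder_real (is_derive_id x 1)).
have E : (fun t : R => sph_bessel l t%:C) = fun t => t%:C ^+ l * phi l (1 * (t ^+ 2)%:C).
  by apply/funext => t; rewrite sph_besselE mul1r rmorphXn.
rewrite /sph_bessel_deriv E (cderiveE _ (cdiffM dX dphi)) /phi1 !mul1r.
rewrite rmorphXn rmorphM rmorph1 rmorph_nat /=.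
by case: (l) l_gt0 => // m _; rewrite /= !(exprS _ m); field.
Qed.

End SimpleZeros.

(** * Lamb and Minnaert resonances *)

Section Perturbation.
Variable R : realType.

Lemma hpoly0 l : hpoly l.+1 (0 : R[i]) = (2 * l + 1)%:R * hpoly l 0.
Proof.
case: l => [|l]; first by rewrite /= oppr0 sub0r mul1r.
rewrite hpolySS expr0n mul0r subr0; congr (_%:R * _); lia.
Qed.

Lemma hpoly0_neq0 l : hpoly l (0 : R[i]) != 0.
Proof.
elim: l => [|l IH]; first by rewrite /= oppr_eq0 i_neq0.
by rewrite hpoly0 mulf_neq0// pnatr_eq0 addn1.
Qed.

Lemma hpoly10 l : hpoly1 l (0 : R[i]) = - (l.+1%:R * hpoly l 0).
Proof. by rewrite /hpoly1 hpoly0 natrD natrM -[l.+1%:R]natr1; ring. Qed.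

Lemma phi10 l : phi1 l (0 : R[i]) = l%:R * phi l 0.
Proof. by rewrite /phi1 mul0r subr0. Qed.

Lemma wavenumber_scale (w v : R[i]) (K rho R0 : R) :
  wavenumber (w * v) K rho * R0%:C = w * (R0 / sound_speed K rho)%:C * v.
Proof. by rewrite /wavenumber rmorphM fmorphV /=; ring. Qed.

Lemma small_scale (w : R[i]) (R0 W c eps : R) : 0 < R0 -> 0 < c -> 0 <= W ->
  cmod w <= W -> c^-1 <= eps -> cmod (w * (R0 / c)%:C) <= W * R0 * eps.
Proof.
move=> R00 c0 W0 wW ce; rewrite cmodM cmod_real ger0_norm; last by rewrite divr_ge0 ?ltW.
rewrite -mulrA; apply: ler_pM; rewrite ?cmod_ge0 ?divr_ge0 ?(ltW R00) ?(ltW c0)//.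
by rewrite ler_wpM2l// ltW.
Qed.

Lemma inv_max_le (M c1 c2 : R) : 0 < M -> M <= c1 -> M <= c2 ->
  [/\ c1^-1 <= Num.max c1^-1 c2^-1, c2^-1 <= Num.max c1^-1 c2^-1,
      0 < Num.max c1^-1 c2^-1 & M * Num.max c1^-1 c2^-1 <= 1].
Proof.
move=> M0 M1 M2; have c10 := lt_le_trans M0 M1; have c20 := lt_le_trans M0 M2.
split; rewrite ?le_max ?lexx ?orbT//; first by rewrite lt_max invr_gt0 c10.
by rewrite maxEle; case: ifP => _; rewrite ler_pdivrMr// mul1r.
Qed.

(* [v] stands for the frequency in units of [w0]. *)
Lemma root_scale (X Y : R[i] -> R[i]) (b d W : R) (s w0 : R[i]) :
  s ^+ 2 = 1 -> d <= 1 / 100 -> lip 2 b d X -> lip 2 b d Y ->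
  cmod (X 0 - 1) <= d -> cmod (Y 0 - 1) <= d -> w0 != 0 -> cmod w0 <= W ->
  exists v, [/\ w0 * v != 0, v ^+ 2 * X v = Y v & cmod (w0 * v - s * w0) <= 6 * W * d].
Proof.
move=> s2 d1 hX hY X0 Y0 w00 wW.
have cs : cmod s = 1.
  have : cmod s ^+ 2 = 1 by rewrite -cmodX s2 cmod1.
  by move/eqP; rewrite sqrf_eq1 => /orP[/eqP//|/eqP h]; have := cmod_ge0 s; rewrite h; lra.
have d0 : 0 <= d := le_trans (cmod_ge0 _) X0.
have [v [vs vE]] := quad_root s2 cs d1 hX hY X0 Y0.
exists v; split=> //.
  rewrite mulf_neq0// -cmod_gt0; have := cmodB v (v - s).
  by rewrite opprB addrCA subrr addr0 cs; lra.
rewrite (mulrC s) -mulrBr cmodM; apply: le_trans (ler_pM (cmod_ge0 _) (cmod_ge0 _) wW vs) _.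
by lra.
Qed.

(** The weights sum to 1, so the constants do not see [th]; this is what makes the Lamb estimate
    uniform in [rho_g]. *)
Lemma lip_convex (b d th : R) (g1 g2 g3 g4 : R[i] -> R[i]) :
  0 <= b -> 0 <= d -> 0 <= th -> th <= 1 ->
  lip 2 b (b * d) g1 -> lip 2 b (b * d) g2 -> lip 2 b (b * d) g3 -> lip 2 b (b * d) g4 ->
  lip 2 (2 * b ^+ 2) (4 * b ^+ 2 * d)
    (fun v => th%:C * (g1 v * g3 v) + (1 - th)%:C * (g2 v * g4 v)) /\
  lip 2 (2 * b ^+ 2) (4 * b ^+ 2 * d) (fun v => g2 v * g3 v).
Proof.
move=> b0 d0 t0 t1 L1 L2 L3 L4; have bb : 0 <= b ^+ 2 := sqr_ge0 b.
have bd : 0 <= b ^+ 2 * d := mulr_ge0 bb d0.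
have E : b * (b * d) + b * (b * d) = 2 * (b ^+ 2 * d) by ring.
have ct : cmod th%:C = th by rewrite cmod_real ger0_norm.
have ct1 : cmod (1 - th)%:C = 1 - th by rewrite cmod_real ger0_norm// subr_ge0.
split.
  apply: lip_le (lipD (lipZ th%:C (lipM L1 L3)) (lipZ (1 - th)%:C (lipM L2 L4))).
    by rewrite -mulrDl -expr2 ct ct1; lra.
  by rewrite -mulrDl E ct ct1; lra.
by apply: lip_le (lipM L2 L3); [rewrite -expr2; lra|rewrite E; lra].
Qed.

Lemma split_small (K a e : R) : 0 <= K -> 0 <= a -> 0 < e -> (100 * K + a + 1) * e <= 1 ->
  a * e <= 1 /\ K * e <= 1 / 100.
Proof.
move=> K0 a0 e0; have Ke := mulr_ge0 K0 (ltW e0); have ae := mulr_ge0 a0 (ltW e0).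
by rewrite 2!mulrDl mul1r -[100 * K * e]mulrA => h; lra.
Qed.

Lemma minnaert_complex (sg g c r a p : R) : 2 * sg = 3 * (g * c ^+ 2) * r - a * r ^+ 3 * p ->
  2 * sg%:C = 3 * (g%:C * c%:C ^+ 2) * r%:C - a%:C * r%:C ^+ 3 * p%:C.
Proof.
rewrite !exprS !expr0 => /(congr1 (real_complex R)).
by rewrite !(rmorphB, rmorphM, rmorph1, rmorph_nat).
Qed.

Lemma lamb_complex (w r d sg n : R) : w ^+ 2 * r * d = sg * (n * (n + 1) - 2) / r ^+ 2 * (n * (n + 1)) ->
  w%:C ^+ 2 * r%:C * d%:C = sg%:C * (n%:C * (n%:C + 1) - 2) / r%:C ^+ 2 * (n%:C * (n%:C + 1)).
Proof.
rewrite !expr2 => /(congr1 (real_complex R)).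
by rewrite !(rmorphM, fmorphV, rmorphB, rmorphD, rmorph1, rmorph_nat).
Qed.

Lemma lamb_branch (sigma rho_l R0 : R) (l : nat) :
  0 < sigma -> 0 < rho_l -> 0 < R0 -> (2 <= l)%N ->
  exists B M : R, forall (rho_g K_l K_g : R) (s : R[i]), s ^+ 2 = 1 ->
    0 < rho_g ->
    let c_l := sound_speed K_l rho_l in
    let c_g := sound_speed K_g rho_g in
    M <= c_l -> M <= c_g ->
    let w0 := Num.sqrt ((l + 2)%:R * (l - 1)%:R * sigma /
                ((rho_l / (l + 1)%:R + rho_g / l%:R) * R0 ^+ 3)) in
    exists w : R[i], resonance_in_mode R0 sigma rho_l rho_g K_l K_g l w /\
      cmod (w - s * w0%:C) <= B * Num.max c_g^-1 c_l^-1.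
Proof.
move=> sigma0 rho_l0 R00 l2.
have l0 : 0 < l%:R :> R by rewrite ltr0n; lia.
have ln0 : (l != 0)%N by lia.
have lm : (l - 1)%:R = l%:R - 1 :> R by rewrite natrB//; lia.
have A0 : 0 < (l + 2)%:R * (l - 1)%:R * sigma.
  by rewrite !mulr_gt0// ltr0n; lia.
have lp1 : 0 < (l + 1)%:R :> R by rewrite ltr0n addn1.
have R3 : 0 < R0 ^+ 3 by rewrite exprn_gt0.
(* A bound on [w0] uniform in [rho_g]: dropping [rho_g / l] gives [w0^2 <= W - 1], and
   [2 w0 <= w0^2 + 1] does the rest. *)
pose W := (l + 2)%:R * (l - 1)%:R * sigma / (rho_l / (l + 1)%:R * R0 ^+ 3) + 1.
have W1 : 1 <= W by rewrite lerDr ltW// divr_gt0// mulr_gt0// divr_gt0.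
have WR0 : 0 < W * R0 by rewrite mulr_gt0// (lt_le_trans ltr01).
pose n : R[i] := l%:R; pose p0 : R[i] := hpoly l 0; pose f0 : R[i] := phi l 0.
have n0 : n != 0 by rewrite pnatr_eq0.
have n10 : n + 1 != 0 by rewrite natr1 pnatr_eq0.
have p00 : p0 != 0 := hpoly0_neq0 l.
have f00 : f0 != 0 := phi0_neq0 R l.
have np0 : (n + 1) * p0 != 0 := mulf_neq0 n10 p00.
have nf0 : n * f0 != 0 := mulf_neq0 n0 f00.
have [b [b0 h1 h2 h3 h4]] : exists b, [/\ 0 <= b,
    forall m d, cmod m <= d -> d <= 1 -> lip 2 b (b * d) (fun v => p0^-1 * hpoly l (m * v)),
    forall m d, cmod m <= d -> d <= 1 ->
      lip 2 b (b * d) (fun v => (- ((n + 1) * p0))^-1 * hpoly1 l (m * v)),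
    forall m d, cmod m <= d -> d <= 1 ->
      lip 2 b (b * d) (fun v => (n * f0)^-1 * phi1 l ((m * v) ^+ 2))
  & forall m d, cmod m <= d -> d <= 1 ->
      lip 2 b (b * d) (fun v => f0^-1 * phi l ((m * v) ^+ 2))].
  have [b1 b10 h1] := loclip_scale (loclipZ p0^-1 (@loclip_hpoly R l)).
  have [b2 b20 h2] := loclip_scale (loclipZ (- ((n + 1) * p0))^-1 (@loclip_hpoly1 R l)).
  have [b3 b30 h3] := loclip_scale (loclipZ (n * f0)^-1 (loclip_sq (@loclip_phi1 R l))).
  have [b4 b40 h4] := loclip_scale (loclipZ f0^-1 (loclip_sq (@loclip_phi R l))).
  have le1 : b1 <= b1 + b2 + b3 + b4 by lra.
  have le2 : b2 <= b1 + b2 + b3 + b4 by lra.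
  have le3 : b3 <= b1 + b2 + b3 + b4 by lra.
  have le4 : b4 <= b1 + b2 + b3 + b4 by lra.
  exists (b1 + b2 + b3 + b4); split; first by lra.
  - move=> m d md d1; apply: lip_le (h1 _ _ md d1) => //.
    by rewrite ler_wpM2r// (le_trans (cmod_ge0 _) md).
  - move=> m d md d1; apply: lip_le (h2 _ _ md d1) => //.
    by rewrite ler_wpM2r// (le_trans (cmod_ge0 _) md).
  - move=> m d md d1; apply: lip_le (h3 _ _ md d1) => //.
    by rewrite ler_wpM2r// (le_trans (cmod_ge0 _) md).
  - move=> m d md d1; apply: lip_le (h4 _ _ md d1) => //.
    by rewrite ler_wpM2r// (le_trans (cmod_ge0 _) md).
pose K := 4 * b ^+ 2 * (W * R0).
have K0 : 0 <= K by rewrite !mulr_ge0// ?sqr_ge0// ltW// (lt_le_trans ltr01).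
(* From [M eps <= 1] follow [W R0 eps <= 1], which keeps the rescaled arguments in a fixed disc, and
   [K eps <= 1/100], the threshold of [quad_root]. The factor [6 W] is that of [root_scale]. *)
exists (6 * W * K), (100 * K + W * R0 + 1) => rho_g K_l K_g s s2 rho_g0 c_l c_g Mcl Mcg w0.
have M0 : 0 < 100 * K + W * R0 + 1 by rewrite addr_gt0// ltr_wpDl// mulr_ge0.
have [eg el e0 eM] := inv_max_le M0 Mcg Mcl.
move: eg el e0 eM; set eps := Num.max _ _ => eg el e0 eM.
have cl0 : 0 < c_l := lt_le_trans M0 Mcl; have cg0 : 0 < c_g := lt_le_trans M0 Mcg.
have Ke0 : 0 <= K * eps := mulr_ge0 K0 (ltW e0).
have WRe : 0 <= W * R0 * eps := mulr_ge0 (ltW WR0) (ltW e0).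
have [e1 Kd] : W * R0 * eps <= 1 /\ K * eps <= 1 / 100 := split_small K0 (ltW WR0) e0 eM.
pose D := rho_l / (l + 1)%:R + rho_g / l%:R.
have D0 : 0 < D by rewrite addr_gt0// divr_gt0.
have w0sq : w0 ^+ 2 = (l + 2)%:R * (l - 1)%:R * sigma / (D * R0 ^+ 3).
  by rewrite sqr_sqrtr// divr_ge0// ltW// mulr_gt0.
have w0gt : 0 < w0 by rewrite sqrtr_gt0 divr_gt0// mulr_gt0.
have w0W : w0 <= W.
  have h : w0 ^+ 2 <= W - 1.
    rewrite addrK w0sq ler_wpM2l ?(ltW A0)// lef_pV2 ?posrE ?mulr_gt0 ?divr_gt0//.
    by rewrite ler_wpM2r ?(ltW R3)// lerDl divr_ge0// ltW.
  by have h2' := sqr_ge0 (w0 - 1); clear -h h2' w0gt; nra.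
have w0C : w0%:C != 0 :> R[i] by rewrite fmorph_eq0 gt_eqF.
have w0CW : cmod w0%:C <= W by rewrite cmod_real gtr0_norm.
pose D2 := rho_l * l%:R + rho_g * (l%:R + 1).
have lp1' : 0 < l%:R + 1 :> R by rewrite ltr_wpDl// ltW.
have D20 : 0 < D2 by rewrite addr_gt0 ?mulr_gt0.
(* The share of the liquid in the inertia [D2 = l (l + 1) D]; the gas has share [1 - th]. Dividing
   by [D2] makes the bracket a convex combination equal to 1 at [v = 0]. *)
pose th := rho_l * l%:R / D2.
have th0 : 0 <= th by rewrite divr_ge0 ?mulr_ge0// ltW.
have th1 : th <= 1 by rewrite ler_pdivrMr// mul1r lerDl mulr_ge0// ltW.
pose ml := w0%:C * (R0 / c_l)%:C; pose mg := w0%:C * (R0 / c_g)%:C.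
have W0 : 0 <= W := le_trans ler01 W1.
have mle : cmod ml <= W * R0 * eps by exact: small_scale.
have mge : cmod mg <= W * R0 * eps by exact: small_scale.
pose g1 v := p0^-1 * hpoly l (ml * v).
pose g2 v := (- ((n + 1) * p0))^-1 * hpoly1 l (ml * v).
pose g3 v := (n * f0)^-1 * phi1 l ((mg * v) ^+ 2).
pose g4 v := f0^-1 * phi l ((mg * v) ^+ 2).
have [LX LY] := lip_convex b0 WRe th0 th1 (h1 _ _ mle e1) (h2 _ _ mle e1)
  (h3 _ _ mge e1) (h4 _ _ mge e1).
have KE : 4 * b ^+ 2 * (W * R0 * eps) = K * eps by rewrite /K; ring.
rewrite KE in LX LY.
have g10 : g1 0 = 1 by rewrite /g1 mulr0 mulVf.
have g20 : g2 0 = 1 by rewrite /g2 mulr0 hpoly10 -natr1 mulVf// oppr_eq0.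
have g30 : g3 0 = 1 by rewrite /g3 mulr0 expr0n phi10 mulVf.
have g40 : g4 0 = 1 by rewrite /g4 mulr0 expr0n mulVf.
have X01 : cmod (th%:C * (g1 0 * g3 0) + (1 - th)%:C * (g2 0 * g4 0) - 1) <= K * eps.
  rewrite g10 g20 g30 g40 (_ : _ - _ = 0) ?cmod0//.
  by rewrite rmorphB rmorph1; ring.
have Y01 : cmod (g2 0 * g3 0 - 1) <= K * eps by rewrite g20 g30 mul1r subrr cmod0.
have [v [v0 vE vd]] := root_scale s2 Kd LX LY X01 Y01 w0C w0CW.
have vE' : v ^+ 2 * (th%:C * (g1 v * g3 v) + (1 - th)%:C * (g2 v * g4 v)) = g2 v * g3 v := vE.
exists (w0%:C * v); split; last first.
  by apply: le_trans vd _; rewrite mulrA.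
apply: char_eq_resonance => //.
rewrite /char_eq !wavenumber_scale -/c_l -/c_g -/ml -/mg.
have r0 : R0%:C != 0 :> R[i] by rewrite fmorph_eq0 gt_eqF.
have E1 : hpoly l (ml * v) = p0 * g1 v by rewrite /g1 mulrA divff// mul1r.
have E2 : hpoly1 l (ml * v) = - ((n + 1) * p0) * g2 v.
  by rewrite /g2 mulrA divff ?mul1r// oppr_eq0.
have E3 : phi1 l ((mg * v) ^+ 2) = n * f0 * g3 v.
  by rewrite /g3 mulrA divff ?mul1r.
have E4 : phi l ((mg * v) ^+ 2) = f0 * g4 v by rewrite /g4 mulrA divff// mul1r.
have key : w0%:C ^+ 2 * R0%:C * D2%:C = sigma%:C * (n * (n + 1) - 2) / R0%:C ^+ 2 * (n * (n + 1)).
  have : w0 ^+ 2 * R0 * D2 = sigma * (l%:R * (l%:R + 1) - 2) / R0 ^+ 2 * (l%:R * (l%:R + 1)).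
    have D2E : D = D2 / (l%:R * (l%:R + 1)).
      by rewrite /D /D2 !natrD; field; rewrite !gt_eqF.
    by rewrite w0sq D2E lm natrD; field; rewrite !gt_eqF.
  by move/lamb_complex; rewrite rmorph_nat.
have thE : D2%:C * th%:C = rho_l%:C * n.
  by rewrite -rmorphM /th mulrC divfK ?gt_eqF// rmorphM rmorph_nat.
have thE1 : D2%:C * (1 - th)%:C = rho_g%:C * (n + 1).
  rewrite rmorphB rmorph1 mulrBr mulr1 thE /D2 rmorphD !rmorphM rmorphD rmorph1 !rmorph_nat.
  by rewrite -/n; ring.
rewrite E1 E2 E3 E4 -[l.+1%:R]natr1 -/n.
transitivity (p0 * f0 * (w0%:C ^+ 2 * R0%:C * (v ^+ 2 * ((rho_l%:C * n) * (g1 v * g3 v)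
  + (rho_g%:C * (n + 1)) * (g2 v * g4 v)))
  - sigma%:C * (n * (n + 1) - 2) / R0%:C ^+ 2 * (n * (n + 1)) * (g2 v * g3 v))).
  by field.
rewrite -thE -thE1 -key -vE'.
move: (th%:C) ((1 - th)%:C) (g1 v) (g2 v) (g3 v) (g4 v) (D2%:C) => t t' x1 x2 x3 x4 D'.
by ring.
Qed.

(** For [l = 0] one has [phi1 0 s = - s phi 1 s], which cannot be normalised at 0. The recurrence
    rewrites [phi 0] as [3 phi 1 - s phi 2]; a factor [s], proportional to [w^2 / c_g^2], then
    divides out, and [rho_g c_g^2 = K_g] survives as the stiffness of the gas. Only [w0^2 = a] and
    [w0 != 0] matter, so either sign of [a] is covered. *)
Lemma minnaert_branch (sigma rho_l R0 K_p : R) :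
  0 < sigma -> 0 < rho_l -> 0 < R0 ->
  exists B M : R, forall (rho_g K_l K_g : R) (s : R[i]), s ^+ 2 = 1 ->
    0 < rho_g -> 0 < K_g -> K_g < K_p ->
    let c_l := sound_speed K_l rho_l in
    let c_g := sound_speed K_g rho_g in
    M <= c_l -> M <= c_g ->
    let a := 3 * K_g / (rho_l * R0 ^+ 2) - 2 * sigma / (rho_l * R0 ^+ 3) in
    a != 0 ->
    let w0 : R[i] := sqrtC a%:C in
    exists w : R[i], resonance_in_mode R0 sigma rho_l rho_g K_l K_g 0 w /\
      cmod (w - s * w0) <= B * Num.max c_g^-1 c_l^-1.
Proof.
move=> sigma0 rho_l0 R00.
have R2 : 0 < R0 ^+ 2 by rewrite exprn_gt0.
have R3 : 0 < R0 ^+ 3 by rewrite exprn_gt0.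
pose P := `|K_p|; have P0 : 0 <= P := normr_ge0 _.
have W1 : 0 <= 3 * P / (rho_l * R0 ^+ 2) by rewrite divr_ge0 ?mulr_ge0// ltW.
have W2 : 0 <= 2 * sigma / (rho_l * R0 ^+ 3) by rewrite divr_ge0 ?mulr_ge0// ltW.
pose W := 3 * P / (rho_l * R0 ^+ 2) + 2 * sigma / (rho_l * R0 ^+ 3) + 1.
have W0 : 0 < W by rewrite ltr_wpDl// addr_ge0.
have WR0 : 0 < W * R0 by rewrite mulr_gt0.
pose f0 : R[i] := phi 1 0.
have f00 : f0 != 0 := phi0_neq0 R 1.
have [b [b0 h1 h2 h3]] : exists b, [/\ 0 <= b,
    forall m d, cmod m <= d -> d <= 1 -> lip 2 b (b * d) (fun v => f0^-1 * phi 1 ((m * v) ^+ 2)),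
    forall m d, cmod m <= d -> d <= 1 -> lip 2 b (b * d) (fun v => 1 - 'i * (m * v))
  & forall m d, cmod m <= d -> d <= 1 ->
      lip 2 b (b * d) (fun v => f0^-1 * phi 2 ((m * v) ^+ 2))].
  have [b1 b10 h1] := loclip_scale (loclipZ f0^-1 (loclip_sq (@loclip_phi R 1))).
  have [b2 b20 h2] := loclip_scale (loclipB (loclip_cst 1) (loclipZ 'i (@loclip_id R))).
  have [b3 b30 h3] := loclip_scale (loclipZ f0^-1 (loclip_sq (@loclip_phi R 2))).
  have le1 : b1 <= b1 + b2 + b3 by lra.
  have le2 : b2 <= b1 + b2 + b3 by lra.
  have le3 : b3 <= b1 + b2 + b3 by lra.
  exists (b1 + b2 + b3); split; first by lra.
  - move=> m d md d1; apply: lip_le (h1 _ _ md d1) => //.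
    by rewrite ler_wpM2r// (le_trans (cmod_ge0 _) md).
  - move=> m d md d1; apply: lip_le (h2 _ _ md d1) => //.
    by rewrite ler_wpM2r// (le_trans (cmod_ge0 _) md).
  - move=> m d md d1; apply: lip_le (h3 _ _ md d1) => //.
    by rewrite ler_wpM2r// (le_trans (cmod_ge0 _) md).
have bb : 0 <= b ^+ 2 := sqr_ge0 b.
pose k := P / rho_l; have k0 : 0 <= k by rewrite divr_ge0// ltW.
have kb : 0 <= k * b := mulr_ge0 k0 b0.
have kbb : 0 <= k * b ^+ 2 := mulr_ge0 k0 bb.
(* The first summand collects the Lipschitz constants of [X] and [Y]; the last one bounds the defect
   [X 0 - 1], which is proportional to the density ratio. *)
pose K := (b + 2 * b ^+ 2 + 2 * (k * b ^+ 2)) * (W * R0) + k * b.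
have K0 : 0 <= K by rewrite addr_ge0// mulr_ge0 ?(ltW WR0)// !addr_ge0// mulr_ge0.
exists (6 * W * K), (100 * K + W * R0 + 1).
move=> rho_g K_l K_g s s2 rho_g0 K_g0 K_gp c_l c_g Mcl Mcg a a0 w0.
have M0 : 0 < 100 * K + W * R0 + 1.
  by apply: addr_gt0 => //; apply: ltr_wpDl => //; apply: mulr_ge0.
have [eg el e0 eM] := inv_max_le M0 Mcg Mcl.
move: eg el e0 eM; set eps := Num.max _ _ => eg el e0 eM.
have cl0 : 0 < c_l := lt_le_trans M0 Mcl; have cg0 : 0 < c_g := lt_le_trans M0 Mcg.
have [e1 Kd] := split_small K0 (ltW WR0) e0 eM.
have eps1 : eps <= 1.
  apply: le_trans eM; rewrite ler_peMl ?(ltW e0)// lerDr addr_ge0// ?(ltW WR0)//.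
  exact: mulr_ge0.
have KgP : K_g <= P := le_trans (ltW K_gp) (ler_norm _).
have w0sq : w0 ^+ 2 = a%:C := sqrtCK _.
have w0C : w0 != 0 by rewrite sqrtC_eq0 fmorph_eq0.
have w0CW : cmod w0 <= W.
  have h : cmod w0 ^+ 2 <= W - 1.
    rewrite -cmodX w0sq cmod_real addrK; apply: le_trans (ler_normB _ _) _.
    rewrite !ger0_norm ?divr_ge0 ?mulr_ge0 ?(ltW K_g0) ?(ltW rho_l0) ?(ltW R00) ?(ltW sigma0)//.
    by rewrite lerD2r ler_pM2r ?invr_gt0 ?mulr_gt0// ler_pM2l.
  have h2' := sqr_ge0 (cmod w0 - 1); have h3' := cmod_ge0 w0.
  by clear -h h2' h3'; nra.
pose ka := rho_g / rho_l.
have ka0 : 0 <= ka by rewrite divr_ge0// ltW.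
have cg2 : rho_g * c_g ^+ 2 = K_g.
  by rewrite /c_g sqr_sqrtr ?divr_ge0// 1?ltW// mulrC divfK ?gt_eqF.
(* The density ratio is [K_g / (rho_l c_g^2)], of order [eps^2]; with [eps <= 1] it is absorbed in
   the first-order error. *)
have kae : ka <= k * eps.
  have E : ka = K_g / rho_l * (c_g^-1 * c_g^-1) by rewrite /ka -cg2; field; rewrite !gt_eqF.
  have c0 : 0 <= c_g^-1 by rewrite invr_ge0 ltW.
  rewrite E; apply: ler_pM; rewrite ?mulr_ge0 ?invr_ge0 ?(ltW rho_l0) ?(ltW cg0) ?(ltW K_g0)//.
    by rewrite ler_wpM2r// invr_ge0 ltW.
  by rewrite -[X in _ <= X]mulr1; apply: ler_pM => //; exact: le_trans eps1.
have kak : ka <= k by apply: le_trans kae _; rewrite ler_piMr.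
pose ml := w0 * (R0 / c_l)%:C; pose mg := w0 * (R0 / c_g)%:C.
have mle : cmod ml <= W * R0 * eps by apply: small_scale => //; exact: ltW.
have mge : cmod mg <= W * R0 * eps by apply: small_scale => //; exact: ltW.
pose g1 v := f0^-1 * phi 1 ((mg * v) ^+ 2).
pose g2 v := 1 - 'i * (ml * v).
pose g3 v := f0^-1 * phi 2 ((mg * v) ^+ 2).
have L1 := h1 _ _ mge e1; have L2 := h2 _ _ mle e1; have L3 := h3 _ _ mge e1.
have d0 : 0 <= W * R0 * eps := mulr_ge0 (ltW WR0) (ltW e0).
have ck : cmod ka%:C = ka by rewrite cmod_real ger0_norm.
have KE : K * eps = (b + 2 * b ^+ 2 + 2 * (k * b ^+ 2)) * (W * R0 * eps) + k * b * eps.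
  by rewrite /K; ring.
have kbe : 0 <= k * b * eps := mulr_ge0 kb (ltW e0).
have dE : b * (b * (W * R0 * eps)) + b * (b * (W * R0 * eps)) = 2 * b ^+ 2 * (W * R0 * eps) by ring.
have LX : lip 2 (b + b ^+ 2 + k * b ^+ 2) (K * eps) (fun v => g1 v + ka%:C * (g2 v * g3 v)).
  apply: lip_le (lipD L1 (lipZ ka%:C (lipM L2 L3))).
    rewrite ck -expr2; apply: lerD; last by rewrite ler_wpM2r.
    by rewrite lerDl.
  rewrite ck KE dE; move: d0 kbe; set d := W * R0 * eps; set q := k * b * eps => d0 q0.
  have h : ka * (2 * b ^+ 2 * d) <= k * (2 * b ^+ 2 * d).
    by rewrite ler_wpM2r// mulr_ge0// mulr_ge0.
  have h' := mulr_ge0 bb d0.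
  by clear -h h' q0; nra.
have LY : lip 2 (b + b ^+ 2 + k * b ^+ 2) (K * eps) (fun v => g2 v * g1 v).
  apply: lip_le (lipM L2 L1).
    by rewrite -expr2; clear -b0 kbb; lra.
  rewrite KE dE; move: d0 kbe; set d := W * R0 * eps; set q := k * b * eps => d0 q0.
  have h' := mulr_ge0 b0 d0; have h'' := mulr_ge0 kbb d0.
  by clear -h' h'' q0; nra.
have g10 : g1 0 = 1 by rewrite /g1 mulr0 expr0n mulVf.
have g20 : g2 0 = 1 by rewrite /g2 !mulr0 subr0.
have z2 : cmod (0 : R[i]) <= 2 by rewrite cmod0.
have X01 : cmod (g1 0 + ka%:C * (g2 0 * g3 0) - 1) <= K * eps.
  rewrite g10 g20 addrC addKr mul1r cmodM ck KE.
  have [h _] := L3 _ _ z2 z2.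
  apply: le_trans (ler_pM ka0 (cmod_ge0 _) kae h) _.
  rewrite mulrAC lerDr; apply: mulr_ge0 d0.
  by rewrite !addr_ge0// mulr_ge0.
have Y01 : cmod (g2 0 * g1 0 - 1) <= K * eps.
  by rewrite g10 g20 mul1r subrr cmod0 mulr_ge0// ltW.
have [v [v0 vE vd]] := root_scale s2 Kd LX LY X01 Y01 w0C w0CW.
have vE' : v ^+ 2 * (g1 v + ka%:C * (g2 v * g3 v)) = g2 v * g1 v := vE.
exists (w0 * v); split; last first.
  by apply: le_trans vd _; rewrite mulrA.
apply: char_eq_resonance => //.
rewrite /char_eq !wavenumber_scale -/c_l -/c_g -/ml -/mg.
have r0 : R0%:C != 0 :> R[i] by rewrite fmorph_eq0 gt_eqF.
have c0 : c_g%:C != 0 :> R[i] by rewrite fmorph_eq0 gt_eqF.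
have E1 : phi 1 ((mg * v) ^+ 2) = f0 * g1 v by rewrite /g1 mulrA divff// mul1r.
have E3 : phi 2 ((mg * v) ^+ 2) = f0 * g3 v by rewrite /g3 mulrA divff// mul1r.
have E0 : phi 0 ((mg * v) ^+ 2) = 3 * (f0 * g1 v) - (mg * v) ^+ 2 * (f0 * g3 v).
  by have := phi_rec 0 ((mg * v) ^+ 2); rewrite E1 E3 => h; rewrite -[LHS]subr0 -h /=; ring.
have E2 : hpoly1 0 (ml * v) = 'i * g2 v.
  by rewrite /hpoly1 /g2 /= mul0r sub0r opprB mulrBr mulrA -expr2 sqrCi; ring.
have E4 : phi1 0 ((mg * v) ^+ 2) = - ((mg * v) ^+ 2 * (f0 * g1 v)).
  by rewrite /phi1 E1 mul0r sub0r.
have kaE : rho_g%:C = ka%:C * rho_l%:C :> R[i] by rewrite -rmorphM /ka divfK ?gt_eqF.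
have aE : 2 * sigma%:C = 3 * (ka%:C * rho_l%:C * c_g%:C ^+ 2) * R0%:C - w0 ^+ 2 * R0%:C ^+ 3 * rho_l%:C.
  rewrite -kaE w0sq.
  have : 2 * sigma = 3 * (rho_g * c_g ^+ 2) * R0 - a * R0 ^+ 3 * rho_l.
    by rewrite cg2 /a; field; rewrite !gt_eqF.
  exact: minnaert_complex.
have mE : (mg * v) ^+ 2 = w0 ^+ 2 * v ^+ 2 * R0%:C ^+ 2 / c_g%:C ^+ 2.
  by rewrite /mg rmorphM fmorphV; field.
rewrite E0 E2 E4 mE kaE.
transitivity ('i * f0 * w0 ^+ 2 * v ^+ 2 / c_g%:C ^+ 2 *
  (R0%:C * rho_l%:C * w0 ^+ 2 * v ^+ 2 * R0%:C ^+ 2 * (g1 v + ka%:C * (g2 v * g3 v))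
   - (3 * (ka%:C * rho_l%:C * c_g%:C ^+ 2) * R0%:C - 2 * sigma%:C) * (g2 v * g1 v))).
  by rewrite /=; field; rewrite c0 r0.
by rewrite aE -vE'; ring.
Qed.

End Perturbation.

(** * Fabry-Perot resonances *)

Section SimpleZeroPerturbation.
Variable R : realType.
Implicit Types (f g G N : R[i] -> R[i]) (r b d rho : R) (u v z a : R[i]).

Definition ulip (I : Type) (D : I -> Prop) r (F : I -> R[i] -> R[i]) :=
  exists2 b, 0 <= b & forall i, D i -> lip r b b (F i).

Lemma ulip_scale (I : Type) (D : I -> Prop) (t : I -> R[i]) (T r : R) f :
  0 <= T -> 0 <= r -> loclip f -> (forall i, D i -> cmod (t i) <= T) ->
  ulip D r (fun i z => f (t i * z)).
Proof.
move=> T0 r0 hf tT; have [b b0 fb] := hf (T * r).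
exists (b * (T + 1)) => [|i Di]; first by rewrite mulr_ge0// addr_ge0.
have tr : cmod (t i) * r <= T * r by rewrite ler_wpM2r// tT.
apply: lip_le (lip_scale b0 tr fb).
  by rewrite ler_peMr// lerDr.
by rewrite ler_wpM2l// (le_trans (tT _ Di))// lerDl.
Qed.

Lemma ulip_cst (I : Type) (D : I -> Prop) r f : loclip f -> ulip D r (fun=> f).
Proof. by move=> /(_ r)[b b0 fb]; exists b. Qed.

Lemma ulipD (I : Type) (D : I -> Prop) r (F G : I -> R[i] -> R[i]) : ulip D r F -> ulip D r G ->
  ulip D r (fun i z => F i z + G i z).
Proof.
move=> [b b0 fb] [c c0 gc]; exists (b + c); first exact: addr_ge0.
by move=> i Di; apply: lipD; [exact: fb|exact: gc].
Qed.

Lemma ulipM (I : Type) (D : I -> Prop) r (F G : I -> R[i] -> R[i]) : ulip D r F -> ulip D r G ->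
  ulip D r (fun i z => F i z * G i z).
Proof.
move=> [b b0 fb] [c c0 gc]; exists (b * c + c * b); first by rewrite addr_ge0// mulr_ge0.
move=> i Di; have h := lipM (fb i Di) (gc i Di).
by apply: lip_le h; rewrite [c * b]mulrC// lerDl mulr_ge0.
Qed.

Lemma ulipZ (I : Type) (D : I -> Prop) r F (c : I -> R[i]) (C : R) : 0 <= C ->
  (forall i, D i -> cmod (c i) <= C) -> @ulip I D r F -> ulip D r (fun i z => c i * F i z).
Proof.
move=> C0 cC [b b0 fb]; exists (C * b); first exact: mulr_ge0.
move=> i Di; have h := lipZ (c i) (fb i Di).
by apply: lip_le h; rewrite ler_wpM2r// cC.
Qed.

Lemma mulr_frac_le (x y : R) : 0 <= x -> 0 <= y -> x * (y / (4 * (x + 1))) <= y / 4.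
Proof.
move=> x0 y0; have x1 : 0 < x + 1 by rewrite ltr_wpDl.
rewrite mulrA ler_pdivrMr ?mulr_gt0// (_ : y / 4 * _ = x * y + y); last by field.
by rewrite lerDl.
Qed.

Lemma lip_near f a b r v : r <= 1 -> 0 <= b -> lip (cmod a + 1) b b f -> cmod (v - a) <= r ->
  cmod (f v - f a) <= b * r.
Proof.
move=> r1 b0 hf va.
have av : cmod v <= cmod a + 1.
  have := cmodD (v - a) a; rewrite subrK; lra.
have aa : cmod a <= cmod a + 1 by rewrite lerDl.
have [_ h] := hf _ _ av aa.
by apply: le_trans h _; rewrite ler_wpM2l.
Qed.

(** Newton's map normalised by [psi' a * G a]. The constants [B] and [d] precede [G], [N] and [rho],
    and depend on them only through the common bound [b] and the lower bound [g]. *)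
Lemma perturbed_zero (psi psi' : R[i] -> R[i]) a (b g : R) : tayl psi psi' ->
  psi a = 0 -> psi' a != 0 -> a != 0 -> 0 <= b -> 0 < g ->
  exists B d : R, 0 < d /\ forall G N rho,
    lip (cmod a + 1) b b G -> lip (cmod a + 1) b b N -> g <= cmod (G a) -> 0 <= rho -> rho < d ->
    exists z, [/\ z != 0, psi z * G z = rho%:C * N z & cmod (z - a) <= B * rho].
Proof.
move=> [/(_ (cmod a + 1)) [b1 b10 p1] /(_ (cmod a + 1)) [b2 b20 p2] /(_ (cmod a + 1)) [b3 b30 p3]].
move=> pa pa0 a0 b0 g0; pose e := cmod (psi' a).
have e0 : 0 < e by rewrite cmod_gt0.
have eg : 0 < e * g := mulr_gt0 e0 g0.
have ca : 0 < cmod a by rewrite cmod_gt0.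
(* The summands come from the quadratic remainder of [psi], the variation of [psi'], the variation
   of [G] at the zero, and the size of [psi] on the disc. Below, [r] makes [C1 r] at most a quarter
   of [e g] and keeps the disc away from 0. *)
pose C1 := b * (2 * b3 + b2 + e + b1).
have C10 : 0 <= C1 by rewrite mulr_ge0// !addr_ge0// ?(ltW e0)// mulr_ge0.
pose r := Num.min 1 (Num.min (cmod a / 2) (e * g / (4 * (C1 + 1)))).
have r0 : 0 < r by rewrite !lt_min ltr01 !divr_gt0// mulr_gt0// ltr_wpDl.
have r1 : r <= 1 by rewrite ge_min lexx.
have r2 : r <= cmod a / 2 by rewrite !ge_min lexx orbT.
have r3 : C1 * r <= e * g / 4.
  have h : r <= e * g / (4 * (C1 + 1)) by rewrite !ge_min lexx !orbT.
  by apply: le_trans (ler_wpM2l C10 h) _; rewrite mulr_frac_le// ltW.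
have b1' : 0 < b + 1 by rewrite ltr_wpDl.
(* [B] is twice the bound on [|F a| / rho], the displacement allowed by [zero_near]; [d] makes
   [b rho] at most [r e g / 4], the remaining quarter of the contraction budget. *)
exists (2 * b / (e * g)), (r * (e * g) / (4 * (b + 1))); split.
  by rewrite divr_gt0 ?mulr_gt0.
move=> G N rho hG hN gG rho0 rhod.
have rb : b * rho <= r * (e * g) / 4.
  apply: le_trans (ler_wpM2l b0 (ltW rhod)) _.
  by rewrite mulr_frac_le// mulr_ge0// ltW.
pose m := cmod (psi' a * G a); have mE : m = e * cmod (G a) by rewrite /m cmodM.
have mg : e * g <= m by rewrite mE ler_pM2l.
have m0 : 0 < m := lt_le_trans eg mg.
have dG0 : psi' a * G a != 0 by rewrite -cmod_gt0.
pose F z := (psi z * G z - rho%:C * N z) / (psi' a * G a).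
have crho : cmod rho%:C = rho by rewrite cmod_real ger0_norm.
have aa : cmod a <= cmod a + 1 by rewrite lerDl.
have Fa : cmod (F a) <= b * rho / (e * g).
  rewrite /F pa mul0r sub0r cmodM cmodN cmodM cmodV -/m crho.
  have [h _] := hN _ _ aa aa.
  rewrite (mulrC b); apply: ler_pM; rewrite ?mulr_ge0 ?invr_ge0 ?cmod_ge0 ?(ltW m0)//.
    by rewrite ler_wpM2l.
  by rewrite lef_pV2.
have Fr : b * rho / (e * g) <= r / 4.
  by rewrite ler_pdivrMr// mulrAC.
have [||z [za Fz]] := @zero_near R F a r; last first.
- exists z; split.
  + rewrite -cmod_gt0; have := cmodB z (z - a); rewrite opprB addrCA subrr addr0.
    by clear -za Fa Fr r2 ca; lra.
  + by move/eqP: Fz; rewrite mulf_eq0 invr_eq0 (negPf dG0) orbF subr_eq0 => /eqP.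
  + by apply: le_trans za _; apply: le_trans (ler_wpM2l _ Fa) _ => //; rewrite !mulrA mulrAC.
- by clear -Fa Fr r0; lra.
move=> u v ur vr.
have bd x : cmod (x - a) <= r -> cmod x <= cmod a + 1.
  by move=> xr; have := cmodD (x - a) a; rewrite subrK; clear -xr r1; lra.
have au := bd _ ur; have av := bd _ vr.
have [Gu Guv] := hG _ _ au av; have [_ Nuv] := hN _ _ au av.
have Gua := lip_near r1 b0 hG ur; have pva := lip_near r1 b10 p1 vr.
have p2va := lip_near r1 b20 p2 vr; have T := p3 _ _ au av.
rewrite pa subr0 in pva.
rewrite /F (_ : _ - _ = ((psi u - psi v - psi' v * (u - v)) * G u
   + (psi' v - psi' a) * G u * (u - v) + psi' a * (G u - G a) * (u - v)
   + psi v * (G u - G v) - rho%:C * (N u - N v)) / (psi' a * G a)); last first.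
  have Ga0 : G a != 0 by move: dG0; rewrite mulf_eq0 negb_or => /andP[].
  by field; rewrite pa0 Ga0.
rewrite cmodM cmodV -/m ler_pdivrMr//.
move: T Guv Nuv; set dl := cmod (u - v) => T Guv Nuv.
have dl0 : 0 <= dl := cmod_ge0 _.
have dlr : dl <= 2 * r.
  have := cmodB (u - a) (v - a); rewrite opprB addrA subrK -/dl.
  by clear -ur vr; lra.
have t1 : cmod ((psi u - psi v - psi' v * (u - v)) * G u) <= (b3 * (2 * r)) * b * dl.
  rewrite cmodM; apply: le_trans (ler_pM (cmod_ge0 _) (cmod_ge0 _) T Gu) _.
  rewrite (_ : b3 * dl ^+ 2 * b = b3 * dl * b * dl); last by ring.
  by rewrite ler_wpM2r// ler_wpM2r// ler_wpM2l.
have t2 : cmod ((psi' v - psi' a) * G u * (u - v)) <= b2 * r * b * dl.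
  by rewrite !cmodM ler_wpM2r//; apply: ler_pM; rewrite ?cmod_ge0.
have t3 : cmod (psi' a * (G u - G a) * (u - v)) <= e * (b * r) * dl.
  by rewrite !cmodM ler_wpM2r// ler_wpM2l// cmod_ge0.
have t4 : cmod (psi v * (G u - G v)) <= b1 * r * (b * dl).
  by rewrite cmodM; apply: ler_pM; rewrite ?cmod_ge0.
have t5 : cmod (rho%:C * (N u - N v)) <= rho * (b * dl).
  by rewrite cmodM crho ler_wpM2l.
apply: le_trans (cmodB _ _) _; apply: le_trans (lerD (cmodD _ _) t5) _.
apply: le_trans (lerD (lerD (cmodD _ _) t4) (lexx _)) _.
apply: le_trans (lerD (lerD (lerD (cmodD _ _) t3) (lexx _)) (lexx _)) _.
apply: le_trans (lerD (lerD (lerD (lerD t1 t2) (lexx _)) (lexx _)) (lexx _)) _.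
have E : b3 * (2 * r) * b * dl + b2 * r * b * dl + e * (b * r) * dl + b1 * r * (b * dl)
    + rho * (b * dl) = (C1 * r + b * rho) * dl by rewrite /C1; ring.
rewrite E (_ : dl / 2 * m = m / 2 * dl); last by ring.
rewrite ler_wpM2r//.
have h : r * (e * g) <= e * g by rewrite ler_piMl// ltW.
by clear -r3 rb mg h; lra.
Qed.

End SimpleZeroPerturbation.

Section FabryPerot.
Variable R : realType.

Lemma cmod_conj (z : R[i]) : cmod (conjc z) = cmod z.
Proof. by case: z => a b; rewrite /cmod /= sqrrN. Qed.

(** Real multiples of [q] in [G] and of [p] in [q] drop out of the antisymmetric expression; only
    the cross term of [p] and [p'] is left. *)
Lemma wronskian_combination n (a s : R) (p p' : R[i]) :
  let q := n%:R * p - p' in let G := a%:C * p + s%:C * q in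
  G * conjc q - conjc G * q = - (a%:C * (p * conjc p' - conjc p * p')).
Proof.
rewrite -(rmorph_nat (real_complex R)); move: n%:R => m; case: p p' => [x y] [x' y'] /=.
by apply/eqP; rewrite eq_complex /=; apply/andP; split; apply/eqP; ring.
Qed.

(* [Im (G conj(q))] is a multiple of the Wronskian of [h_l] and [conj h_l], which does not vanish. *)
Lemma hpoly1_lower_bound l (al sg y : R) : 0 <= al ->
  al * `|y| ^+ (2 * l).+1 <=
  cmod (al%:C * hpoly l y%:C + sg%:C * hpoly1 l y%:C) * cmod (hpoly1 l (y%:C)).
Proof.
move=> al0; set p := hpoly l _; set q := hpoly1 _ _; set G := _ + _.
have E : G * conjc q - conjc G * q = - (al%:C * (2 * 'i * y%:C ^+ (2 * l).+1)).
  rewrite -hpoly_wronskian -/p /G /q /hpoly1 -/p; exact: wronskian_combination.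
have ci : cmod ('i : R[i]) = 1 by rewrite /cmod /= expr0n add0r expr1n sqrtr1.
have := cmodB (G * conjc q) (conjc G * q).
rewrite E cmodN !cmodM !cmod_conj cmodX !cmod_real cmod_nat ci (ger0_norm al0).
by lra.
Qed.

(** With [z = k_g R0] one has [k_l R0 = (c_g / c_l) z], so the sound speeds enter only through
    [c_g / c_l] and [c_g^2 / R0]. These stay in a box away from 0 and infinity, which gives uniform
    bounds for [G] and [N]. The zero [x0] may have either sign, one for each branch. *)
Lemma fabry_branch (sigma rho_l R0 c_m c_p x0 : R) (l : nat) :
  0 < sigma -> 0 < rho_l -> 0 < R0 -> 0 < c_m -> (0 < l)%N ->
  x0 != 0 -> phi1 l (x0%:C ^+ 2) = 0 ->
  exists B d : R, 0 < d /\ forall rho_g K_l K_g : R, 0 < rho_g -> rho_g < d ->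
    let c_l := sound_speed K_l rho_l in
    let c_g := sound_speed K_g rho_g in
    c_m < c_l -> c_l < c_p -> c_m < c_g -> c_g < c_p ->
    exists w : R[i], resonance_in_mode R0 sigma rho_l rho_g K_l K_g l w /\
      cmod (w - (x0 * (c_g / R0))%:C) <= B * rho_g.
Proof.
move=> sigma0 rho_l0 R00 cm0 l0 x00 px0.
have x0C : x0%:C != 0 :> R[i] by rewrite fmorph_eq0.
pose p := `|c_p| + c_m; have p0 : 0 < p by rewrite ltr_wpDl.
pose T := p / c_m; have T0 : 0 < T by rewrite divr_gt0.
pose Ga := p ^+ 2 / R0; have Ga0 : 0 <= Ga by rewrite divr_ge0 ?sqr_ge0// ltW.
pose D (i : R * R) := [/\ T^-1 <= i.1, i.1 <= T, c_m ^+ 2 / R0 <= i.2 & i.2 <= Ga].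
have cm2 : 0 < c_m ^+ 2 / R0 by rewrite divr_gt0// exprn_gt0.
have Di1 i : D i -> cmod i.1%:C <= T.
  case=> h1 h2 _ _; rewrite cmod_real ger0_norm//.
  by apply: le_trans h1; rewrite invr_ge0 ltW.
have Di2 i : D i -> cmod i.2%:C <= Ga.
  case=> _ _ h1 h2; rewrite cmod_real ger0_norm//.
  by apply: le_trans h1; rewrite ltW.
pose ss : R[i] := sigma%:C * (l%:R * (l.+1)%:R - 2) / R0%:C ^+ 2.
pose s1 : R := sigma * (l%:R * (l.+1)%:R - 2) / R0 ^+ 2.
have ssE : s1%:C = ss.
  rewrite /s1 /ss !expr2 !rmorphM fmorphV rmorphM rmorphB rmorphM.
  by rewrite !rmorph_nat.
pose r := cmod x0%:C + 1; have r0 : 0 <= r by rewrite addr_ge0// cmod_ge0.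
have Up : ulip D r (fun i z => hpoly l (i.1%:C * z)).
  by apply: ulip_scale (ltW T0) r0 _ Di1; exact: loclip_hpoly.
have Uq : ulip D r (fun i z => hpoly1 l (i.1%:C * z)).
  by apply: ulip_scale (ltW T0) r0 _ Di1; exact: loclip_hpoly1.
have Uz : ulip D r (fun _ z => z ^+ 2).
  by apply: ulip_cst; exact: (loclip_sq (@loclip_id R)).
have Uf : ulip D r (fun _ z => phi l (z ^+ 2)).
  by apply: ulip_cst; apply: loclip_sq; exact: loclip_phi.
pose G (i : R * R) z := i.2%:C * (rho_l%:C * (z ^+ 2 * hpoly l (i.1%:C * z)))
  + ss * hpoly1 l (i.1%:C * z).
pose N (i : R * R) z := i.2%:C * (z ^+ 2 * (phi l (z ^+ 2) * hpoly1 l (i.1%:C * z))).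
have UG : ulip D r G.
  apply: ulipD; last by apply: (ulipZ (cmod_ge0 ss)) => // *.
  apply: (ulipZ Ga0 Di2); apply: (ulipZ (cmod_ge0 rho_l%:C)) => // *.
  exact: ulipM.
have UN : ulip D r N.
  by apply: (ulipZ Ga0 Di2); apply: ulipM => //; exact: ulipM.
have [bG bG0 hG] := UG; have [bN bN0 hN] := UN; have [bq bq0 hq] := Uq.
have x0r : cmod x0%:C <= r by rewrite /r lerDl.
pose al := c_m ^+ 2 / R0 * rho_l * x0 ^+ 2.
have al0 : 0 < al.
  apply: mulr_gt0; first exact: mulr_gt0.
  by rewrite lt_neqAle sqr_ge0 andbT eq_sym sqrf_eq0.
pose et := (T^-1 * `|x0|) ^+ (2 * l).+1.
have et0 : 0 < et by rewrite exprn_gt0// mulr_gt0 ?invr_gt0// normr_gt0.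
(* [hpoly1_lower_bound] bounds the product of [|G|] and [|hpoly1|] below by [al * et] on the whole
   box, and the second factor is at most [bq]. *)
pose g := al * et / (bq + 1).
have bq1 : 0 < bq + 1 by rewrite ltr_wpDl.
have g0 : 0 < g by rewrite divr_gt0// mulr_gt0.
have gG i : D i -> g <= cmod (G i x0%:C).
  move=> Di; case: (Di) => d1 d2 d3 d4.
  have i20 : 0 <= i.2 := le_trans (ltW cm2) d3.
  have i10 : 0 <= i.1 by apply: le_trans d1; rewrite invr_ge0 ltW.
  have a0 : 0 <= i.2 * rho_l * x0 ^+ 2.
    by apply: mulr_ge0 (sqr_ge0 _); rewrite mulr_ge0// ltW.
  have := hpoly1_lower_bound l s1 (i.1 * x0) a0.
  rewrite ssE (rmorphM _ i.1 x0) (_ : _ + ss * _ = G i x0%:C); last first.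
    by rewrite /G !rmorphM /= expr2; ring.
  have [hq' _] := hq i Di _ _ x0r x0r.
  move=> h; rewrite ler_pdivrMr//; apply: le_trans; last first.
    apply: (ler_wpM2l (cmod_ge0 (G i x0%:C)) (y := bq + 1)).
    by apply: le_trans hq' _; rewrite lerDl.
  apply: le_trans h; apply: ler_pM; rewrite ?(ltW al0) ?(ltW et0)//.
    by rewrite ler_wpM2r ?sqr_ge0// ler_pM2r.
  rewrite normrM (ger0_norm i10) lerXn2r// ?nnegrE ?mulr_ge0 ?invr_ge0 ?(ltW T0)//.
  by rewrite ler_wpM2r.
pose b := bG + bN; have b0 : 0 <= b := addr_ge0 bG0 bN0.
have dpsi := phi1_simple_zero l0 x00 px0.
have [B [d [d0 H]]] := perturbed_zero (tayl_phi1_sq R l) px0 (mulf_neq0 x0C dpsi) x0C b0 g0.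
exists (p / R0 * B), d; split=> // rho_g K_l K_g rho_g0 rho_gd c_l c_g h1 h2 h3 h4.
have cl0 : 0 < c_l := lt_trans cm0 h1; have cg0 : 0 < c_g := lt_trans cm0 h3.
have cpp : c_p <= p by rewrite /p; have := ler_norm c_p; lra.
have clp : c_l <= p := le_trans (ltW h2) cpp; have cgp : c_g <= p := le_trans (ltW h4) cpp.
pose i : R * R := (c_g / c_l, c_g ^+ 2 / R0).
have Di : D i.
  split; rewrite /i /=.
  - rewrite /T invf_div; apply: ler_pM; rewrite ?invr_ge0 ?(ltW cm0) ?(ltW p0) ?(ltW h3)//.
    by rewrite lef_pV2.
  - apply: ler_pM; rewrite ?invr_ge0 ?(ltW cg0) ?(ltW cl0)//.
    by rewrite lef_pV2 ?posrE// ltW.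
  - by rewrite ler_pM2r ?invr_gt0// lerXn2r// ?nnegrE ?(ltW cm0) ?(ltW cg0)// ltW.
  - by rewrite ler_pM2r ?invr_gt0// lerXn2r// ?nnegrE ?(ltW p0) ?(ltW cg0).
have LG : lip r b b (G i) by apply: lip_le (hG i Di); rewrite lerDl.
have LN : lip r b b (N i) by apply: lip_le (hN i Di); rewrite lerDr.
have [z [z0 zE zd]] := H _ _ _ LG LN (gG i Di) (ltW rho_g0) rho_gd.
have cR : 0 < c_g / R0 by rewrite divr_gt0.
have cRC : (c_g / R0)%:C != 0 :> R[i] by rewrite fmorph_eq0 gt_eqF.
exists ((c_g / R0)%:C * z); split; last first.
  rewrite (rmorphM _ x0) (mulrC _ z) -mulrBl cmodM cmod_real (gtr0_norm cR) mulrC -[X in _ <= X]mulrA.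
  apply: ler_pM; rewrite ?(ltW cR) ?cmod_ge0//.
  by rewrite ler_pM2r ?invr_gt0.
apply: char_eq_resonance => //; first exact: mulf_neq0.
have e1 : (c_g / R0)%:C * (R0 / c_g)%:C = 1.
  by rewrite -rmorphM -(rmorph1 (real_complex R)); congr (_%:C); field; rewrite !gt_eqF.
have e2 : (c_g / R0)%:C * (R0 / c_l)%:C = (c_g / c_l)%:C.
  by rewrite -rmorphM; congr (_%:C); field; rewrite !gt_eqF.
rewrite /char_eq !wavenumber_scale -/c_l -/c_g e1 e2 mul1r -/ss.
transitivity (phi1 l (z ^+ 2) * G i z - rho_g%:C * N i z); last by rewrite zE subrr.
have E : (c_g ^+ 2 / R0)%:C = (c_g / R0)%:C ^+ 2 * R0%:C.
  by rewrite !expr2 -!rmorphM; congr (_%:C); field; rewrite gt_eqF.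
by rewrite /G /N /= E; ring.
Qed.

End FabryPerot.

(** * Assembly of the three regimes *)

Unset Implicit Arguments.

Theorem theorem5p1 (R : realType) (sigma rho_l R0 : R)
    (sigma_gt0 : 0 < sigma) (rho_l_gt0 : 0 < rho_l) (R0_gt0 : 0 < R0) :
  (* (a) *)
  (forall (beta : R) (l : nat), (2 <= l)%N ->
   exists B M : R, forall rho_g K_l K_g : R,
     0 < rho_g -> rho_g <= beta -> 0 < K_l -> 0 < K_g ->
     let c_l := sound_speed K_l rho_l in
     let c_g := sound_speed K_g rho_g in
     M <= c_l -> M <= c_g ->
     let w0 := Num.sqrt ((l + 2)%:R * (l - 1)%:R * sigma /
                 ((rho_l / (l + 1)%:R + rho_g / l%:R) * R0 ^+ 3)) in
     exists wp wm : R[i],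
       [/\ resonance_in_mode R0 sigma rho_l rho_g K_l K_g l wp,
           resonance_in_mode R0 sigma rho_l rho_g K_l K_g l wm,
           cmod (wp - w0%:C) <= B * Num.max c_g^-1 c_l^-1
         & cmod (wm + w0%:C) <= B * Num.max c_g^-1 c_l^-1])
  /\
  (* (b) *)
  (forall K_m K_p : R,
   exists B M : R, forall rho_g K_l K_g : R,
     0 < rho_g -> 0 < K_l -> 0 < K_g -> K_m < K_g -> K_g < K_p ->
     let c_l := sound_speed K_l rho_l in
     let c_g := sound_speed K_g rho_g in
     M <= c_l -> M <= c_g ->
     let a := 3 * K_g / (rho_l * R0 ^+ 2) - 2 * sigma / (rho_l * R0 ^+ 3) in
     a != 0 ->
     let w0 : R[i] := sqrtC a%:C in
     exists wp wm : R[i],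
       [/\ resonance_in_mode R0 sigma rho_l rho_g K_l K_g 0 wp,
           resonance_in_mode R0 sigma rho_l rho_g K_l K_g 0 wm,
           cmod (wp - w0) <= B * Num.max c_g^-1 c_l^-1
         & cmod (wm + w0) <= B * Num.max c_g^-1 c_l^-1])
  /\
  (* (c): z = lam R0 / c_g labels the branch, i.e. which positive zero of j_l'
     is followed as c_g varies *)
  (forall (c_m c_p : R) (l : nat) (z : R), 0 < c_m -> (1 <= l)%N ->
   exists B d : R, 0 < d /\ forall rho_g K_l K_g : R,
     0 < rho_g -> rho_g < d -> 0 < K_l -> 0 < K_g ->
     let c_l := sound_speed K_l rho_l in
     let c_g := sound_speed K_g rho_g in
     c_m < c_l -> c_l < c_p -> c_m < c_g -> c_g < c_p ->
     forall lam : R, neumann_mode R0 c_g l lam -> lam * R0 / c_g = z ->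
     exists wp wm : R[i],
       [/\ resonance_in_mode R0 sigma rho_l rho_g K_l K_g l wp,
           resonance_in_mode R0 sigma rho_l rho_g K_l K_g l wm,
           cmod (wp - lam%:C) <= B * rho_g
         & cmod (wm + lam%:C) <= B * rho_g]).
Proof.
have s1 : (1 : R[i]) ^+ 2 = 1 by rewrite expr1n.
have s2 : (-1 : R[i]) ^+ 2 = 1 by rewrite sqrrN expr1n.
split=> [beta l l2|]; last split=> [K_m K_p|c_m c_p l z c_m0 l1].
- have [B [M H]] := @lamb_branch R sigma rho_l R0 l sigma_gt0 rho_l_gt0 R0_gt0 l2.
  exists B, M => rho_g K_l K_g rho_g0 _ _ _ c_l c_g Mcl Mcg w0.
  have [wp [rp dp]] := H rho_g K_l K_g 1 s1 rho_g0 Mcl Mcg.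
  have [wm [rm dm]] := H rho_g K_l K_g (-1) s2 rho_g0 Mcl Mcg.
  by exists wp, wm; split=> //; [rewrite mul1r in dp|rewrite mulN1r opprK in dm].
- have [B [M H]] := @minnaert_branch R sigma rho_l R0 K_p sigma_gt0 rho_l_gt0 R0_gt0.
  exists B, M => rho_g K_l K_g rho_g0 _ K_g0 _ K_gp c_l c_g Mcl Mcg a a0 w0.
  have [wp [rp dp]] := H rho_g K_l K_g 1 s1 rho_g0 K_g0 K_gp Mcl Mcg a0.
  have [wm [rm dm]] := H rho_g K_l K_g (-1) s2 rho_g0 K_g0 K_gp Mcl Mcg a0.
  by exists wp, wm; split=> //; [rewrite mul1r in dp|rewrite mulN1r opprK in dm].
(* If [z] is not a nonzero zero of the Neumann function, no [lam] meets the two conditions and any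
   constants serve. *)
have [[z0 pz]|nz] := pselect (z != 0 /\ phi1 l (z%:C ^+ 2 : R[i]) = 0); last first.
  exists 0, 1; split=> // rho_g K_l K_g _ _ _ _ c_l c_g _ _ cg1 _ lam [lam0 jl] lamz.
  have cg0 : 0 < c_g := lt_trans c_m0 cg1.
  have z0 : z != 0 by rewrite -lamz gt_eqF// divr_gt0// mulr_gt0.
  case: nz; split=> //; move: jl; rewrite lamz sph_bessel_derivE// => /eqP.
  have zC : z%:C != 0 :> R[i] by rewrite fmorph_eq0.
  by rewrite !mulf_eq0 invr_eq0 (negPf (expf_neq0 l zC)) (negPf zC) orbF /= => /eqP.
(* The Neumann function depends on [z^2] only, so [- z] is a zero as well; it carries the branch
   near [- lam]. *)
have zN : - z != 0 by rewrite oppr_eq0.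
have pzN : phi1 l ((- z)%:C ^+ 2 : R[i]) = 0 by rewrite rmorphN sqrrN.
have [B1 [d1 [d10 H1]]] :=
  @fabry_branch R sigma rho_l R0 c_m c_p z l sigma_gt0 rho_l_gt0 R0_gt0 c_m0 l1 z0 pz.
have [B2 [d2 [d20 H2]]] :=
  @fabry_branch R sigma rho_l R0 c_m c_p (- z) l sigma_gt0 rho_l_gt0 R0_gt0 c_m0 l1 zN pzN.
exists (Num.max B1 B2), (Num.min d1 d2); split; first by rewrite lt_min d10.
move=> rho_g K_l K_g rho_g0; rewrite lt_min => /andP[rd1 rd2] _ _ c_l c_g k1 k2 k3 k4 lam _ lamz.
have cg0 : 0 < c_g := lt_trans c_m0 k3.
have lamE : z * (c_g / R0) = lam by rewrite -lamz; field; rewrite !gt_eqF.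
have [wp [rp dp]] := H1 rho_g K_l K_g rho_g0 rd1 k1 k2 k3 k4.
have [wm [rm dm]] := H2 rho_g K_l K_g rho_g0 rd2 k1 k2 k3 k4.
rewrite -/c_g lamE in dp; rewrite -/c_g mulNr lamE rmorphN opprK in dm.
exists wp, wm; split=> //.
  by apply: le_trans dp _; rewrite ler_wpM2r ?(ltW rho_g0)// le_max lexx.
by apply: le_trans dm _; rewrite ler_wpM2r ?(ltW rho_g0)// le_max lexx orbT.
Qed.
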